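(* Suppose that $\mu\in\mathcal S^+$, let $\nu\in\mathcal S^+$ be the unique solution of the fluid problem whose initial condition is the null measure, and let $\xi=\mu-\nu$. Let $$y_*=\inf\Big\{y\ge 0:\lambda_0\int_0^y S_g(u,u)\,du\ge 1\Big\}\in(0,\infty]$$ ($\inf\emptyset=\infty$), and let $\mu_\infty$ be the nonnegative Radon measure on $\mathbb R_+^2$ determined by $$\langle\phi,\mu_\infty\rangle=\lambda_0\int_0^\infty\phi(u\wedge y_*,u)\,S_g(u\wedge y_*,u)\,du\qquad\text{for all }\phi\in C_c(\mathbb R_+^2).$$ Then $\xi_t$ converges vaguely to the null measure as $t\to\infty$, and the measures $\mu_t$ and $\nu_t$ converge vaguely to $\mu_\infty$ as $t\to\infty$. Further, $\xi_t$ in fact converges weakly to the null measure if $y_*<\infty$. If in addition (to $y_*<\infty$) $$\int_0^\infty S_g(u\wedge y_*,u)\,du<\infty,$$ then $\mu_\infty$ is a finite measure and $\mu_t$ and $\nu_t$ converge weakly to $\mu_\infty$ as $t\to\infty$.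
   Context: **Notation.** $\mathbb R_+=[0,\infty)$; $u\wedge v=\min\{u,v\}$; $\mathbf 1\{\cdot\}$ is an indicator. $\mathcal M_F^+(\mathbb R_+^2)$ is the space of finite nonnegative Borel measures on $\mathbb R_+^2$ with the weak topology (tested against bounded continuous functions); vague convergence is tested against $C_c(\mathbb R_+^2)$, the continuous compactly supported functions on $\mathbb R_+^2$; $\langle f,\mu\rangle=\int f\,d\mu$. $D_S[0,\infty)$ is the space of càdlàg functions $[0,\infty)\to S$. $C_c^1(\mathbb R_+^3)$ is the set of compactly supported continuously differentiable functions on $\mathbb R_+^3$ (one-sided derivatives on the boundary); values are written $\varphi_t(x,y)$. **Data and standing assumptions.** $\lambda_0>0$ is a constant and $g:\mathbb R_+^2\to\mathbb R_+$ is a probability density. $S_g(x,y)=\int_{[x,\infty)\times[y,\infty)}g(u,v)\,du\,dv$, $U_g=\{(x,y)\in\mathbb R_+^2:S_g(x,y)>0\}$, $U_g^c=\mathbb R_+^2\setminus U_g$. It is assumed that $g$ is locally bounded in $U_g$ (each $z\in U_g$ has a relatively open neighborhood $U\subset U_g$ in $\mathbb R_+^2$ on which $g$ is bounded) and that $S_g$ is continuously differentiable. The hazard rate vector field is $h_g=(h_g^x,h_g^y)=-\nabla\log S_g$ on $U_g$ and $h_g=0$ outside $U_g$. **Fluid problem.** For $\mu\in\mathcal M_F^+(\mathbb R_+^2)$ let $\bar y_*(\mu)=\inf\{y\ge 0:\mu(\mathbb R_+\times[0,y])\ge 1\}$ and $\bar r(\mu,y)=\mathbf 1\{y\le\bar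 y_*(\mu)\}$; $\bar r(\mu)$ denotes the function $(x,y)\mapsto\bar r(\mu,y)$. $\mathcal S^+$, the set of solutions of the fluid problem, consists of all $\mu\in D_{\mathcal M_F^+(\mathbb R_+^2)}[0,\infty)$ such that: (a) $\mu_t(U_g^c)=0$ for all $t\ge 0$; (b) the $y$-marginal $A\mapsto\mu_t(\mathbb R_+\times A)$ is absolutely continuous with respect to Lebesgue measure for all $t\ge 0$; (c) $\int_0^t\langle\bar r(\mu_s)h_g^x+h_g^y,\mu_s\rangle\,ds<\infty$ for all $t\ge 0$; (d) for all $t\ge 0$ and $\varphi\in C_c^1(\mathbb R_+^3)$, $$\langle\varphi_t,\mu_t\rangle=\langle\varphi_0,\mu_0\rangle+\lambda_0\int_0^t\varphi_s(0,0)\,ds-\int_0^t\langle\varphi_s[\bar r(\mu_s)h_g^x+h_g^y],\mu_s\rangle\,ds+\int_0^t\langle\partial_t\varphi_s+\bar r(\mu_s)\partial_x\varphi_s+\partial_y\varphi_s,\mu_s\rangle\,ds .$$ It is known that there is exactly one $\nu\in\mathcal S^+$ with $\nu_0$ the null measure, and that $\xi_t=\mu_t-\nu_t$ is a nonnegative finite measure for every $t\ge0$. *)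

(* Defs.v *)
From HB Require Import structures.
From mathcomp Require Import all_boot all_order all_algebra.
From mathcomp Require Import all_classical all_reals all_analysis.

Set Implicit Arguments.
Unset Strict Implicit.
Unset Printing Implicit Defensive.

Import Order.TTheory GRing.Theory Num.Theory.
Import numFieldNormedType.Exports.

Local Open Scope classical_set_scope.
Local Open Scope ring_scope.

Notation plane R := (measurableTypeR R * measurableTypeR R)%type.

Section Fluid.
Context {R : realType}.
Local Notation leb := (@lebesgue_measure R).
Implicit Types (f : R -> R) (z : R * R) (p : R * (R * R)).

(* A function on R_+^2 or R_+^3 is encoded by a function on the whole space of
   which only the restriction to [quadrant] or [octant] is ever used. *)
Definition quadrant : set (R * R) := [set z | 0 <= z.1 /\ 0 <= z.2].
Definition octant : set (R * (R * R)) := [set p | 0 <= p.1 /\ quadrant p.2].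

Definition compactly_supported (T : topologicalType) (D : set T) (f : T -> R) :=
  exists K : set T, [/\ compact K, K `<=` D &
    forall w, D w -> ~ K w -> f w = 0].

Definition Cc (T : topologicalType) (D : set T) (f : T -> R) :=
  {within D, continuous f} /\ compactly_supported D f.

Definition Cb (T : topologicalType) (D : set T) (f : T -> R) :=
  {within D, continuous f} /\ exists M : R, forall w, D w -> `|f w| <= M.

(* Differentiation on [0, +oo[: two-sided at a > 0, one-sided at 0. *)
Definition quotient_Rp f (a : R) :=
  (h^-1 * (f (a + h) - f a)) @[h --> within [set h | 0 <= a + h] 0^'].
Definition derivable_Rp f (a : R) := cvg (quotient_Rp f a).
Definition derive_Rp f (a : R) : R := lim (quotient_Rp f a).

Definition C1_quadrant (F : R * R -> R) :=
  [/\ {within quadrant, continuous F},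
      forall z, quadrant z -> derivable_Rp (fun x => F (x, z.2)) z.1,
      forall z, quadrant z -> derivable_Rp (fun y => F (z.1, y)) z.2,
      {within quadrant, continuous (fun z => derive_Rp (fun x => F (x, z.2)) z.1)}
    & {within quadrant, continuous (fun z => derive_Rp (fun y => F (z.1, y)) z.2)}].

(* phi (t, (x, y)) stands for phi_t(x, y). *)
Definition dt (phi : R * (R * R) -> R) p : R :=
  derive_Rp (fun t => phi (t, p.2)) p.1.
Definition dx (phi : R * (R * R) -> R) p : R :=
  derive_Rp (fun x => phi (p.1, (x, p.2.2))) p.2.1.
Definition dy (phi : R * (R * R) -> R) p : R :=
  derive_Rp (fun y => phi (p.1, (p.2.1, y))) p.2.2.

Definition Cc1 (phi : R * (R * R) -> R) :=
  [/\ Cc octant phi,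
      forall p, octant p ->
        [/\ derivable_Rp (fun t => phi (t, p.2)) p.1,
            derivable_Rp (fun x => phi (p.1, (x, p.2.2))) p.2.1
          & derivable_Rp (fun y => phi (p.1, (p.2.1, y))) p.2.2],
      {within octant, continuous (dt phi)},
      {within octant, continuous (dx phi)}
    & {within octant, continuous (dy phi)}].

(* Measures on R_+^2 are the Borel measures on R^2 that vanish off the quadrant. *)
Definition on_quadrant (m : {measure set plane R -> \bar R}) :=
  m (~` quadrant) = 0%E.

Definition pairing (f : R * R -> R) (m : {measure set plane R -> \bar R}) : R :=
  \int[m]_(z in quadrant) f z.

Definition vague_cvg (F : set_system R) (m : R -> {measure set plane R -> \bar R})
    (l : {measure set plane R -> \bar R}) :=
  forall f : R * R -> R, Cc quadrant f -> pairing f (m t) @[t --> F] --> pairing f l.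

Definition weak_cvg (F : set_system R) (m : R -> {measure set plane R -> \bar R})
    (l : {measure set plane R -> \bar R}) :=
  forall f : R * R -> R, Cb quadrant f -> pairing f (m t) @[t --> F] --> pairing f l.

Definition radon (m : {measure set plane R -> \bar R}) :=
  forall K : set (R * R), compact K -> (m K < +oo)%E.

(* Paths are functions of a real time of which only the restriction to
   [0, +oo[ is ever used. *)
Definition cadlag (m : R -> {finite_measure set plane R -> \bar R}) :=
  [/\ forall t : R, 0 <= t -> on_quadrant (m t),
      forall t : R, 0 <= t -> weak_cvg t^'+ m (m t)
    & forall t : R, 0 < t -> exists l : {finite_measure set plane R -> \bar R},
        on_quadrant l /\ weak_cvg t^'- m l].

Section data.
Variables (lambda0 : R) (g : R * R -> R).

Definition probability_density :=
  [/\ forall z, quadrant z -> 0 <= g z,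
      measurable_fun (quadrant : set (plane R)) g
    & (\int[leb \x leb]_(z in quadrant) (g z)%:E = 1)%E].

Definition Sg z : R :=
  \int[(leb \x leb)%E]_(w in `[z.1, +oo[ `*` `[z.2, +oo[) g w.

Definition Ug : set (R * R) := [set z | quadrant z /\ 0 < Sg z].

Definition locally_bounded_in_Ug :=
  forall z, Ug z -> exists O : set (R * R),
    [/\ open O, O z, O `&` quadrant `<=` Ug
      & exists M : R, forall w, (O `&` quadrant) w -> g w <= M].

Definition hx : R * R -> R :=
  (fun z => - derive_Rp (fun x => ln (Sg (x, z.2))) z.1) \_ Ug.
Definition hy : R * R -> R :=
  (fun z => - derive_Rp (fun y => ln (Sg (z.1, y))) z.2) \_ Ug.

Definition ybar (m : {measure set plane R -> \bar R}) : \bar R :=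
  ereal_inf [set y%:E | y in
    [set y : R | 0 <= y /\ (1 <= m (`[0%R, +oo[ `*` `[0%R, y]))%E]].

Definition rbar (m : {measure set plane R -> \bar R}) (y : R) : R :=
  (y%:E <= ybar m)%E%:R.

Definition fluid_solution (m : R -> {finite_measure set plane R -> \bar R}) :=
  [/\ cadlag m,
      forall t : R, 0 <= t -> m t (quadrant `\` Ug) = 0%E,
      forall t : R, 0 <= t -> forall A : set (measurableTypeR R), measurable A ->
        leb A = 0%E -> m t (`[0, +oo[ `*` A) = 0%E,
      forall t : R, 0 <= t ->
        (\int[leb]_(s in `[0%R, t]) \int[m s]_(z in quadrant)
            (rbar (m s) z.2 * hx z + hy z)%:E < +oo)%E
    & forall t : R, 0 <= t -> forall phi : R * (R * R) -> R, Cc1 phi ->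
        pairing (fun z => phi (t, z)) (m t) =
          pairing (fun z => phi (0, z)) (m 0)
          + lambda0 * \int[leb]_(s in `[0, t]) phi (s, (0, 0))
          - \int[leb]_(s in `[0, t])
              pairing (fun z => phi (s, z) * (rbar (m s) z.2 * hx z + hy z)) (m s)
          + \int[leb]_(s in `[0, t])
              pairing (fun z => dt phi (s, z) + rbar (m s) z.2 * dx phi (s, z)
                                + dy phi (s, z)) (m s)].

Definition ystar : \bar R :=
  ereal_inf [set y%:E | y in
    [set y : R | 0 <= y /\ 1 <= lambda0 * \int[leb]_(u in `[0, y]) Sg (u, u)]].

Definition cap_ystar (u : R) : R := fine (Order.min u%:E ystar).

Definition is_mu_infty (m : {measure set plane R -> \bar R}) :=
  [/\ on_quadrant m, radon m
    & forall f : R * R -> R, Cc quadrant f ->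
        pairing f m =
        lambda0 * \int[leb]_(u in `[0, +oo[)
          (f (cap_ystar u, u) * Sg (cap_ystar u, u))].

End data.
End Fluid.

(* Main.v *)
Require Import Defs.
From HB Require Import structures.
From mathcomp Require Import all_boot all_order all_algebra.
From mathcomp Require Import all_classical all_reals all_analysis.
From mathcomp Require Import measurable_realfun.
From mathcomp Require Import ring lra.
Set Implicit Arguments.
Unset Strict Implicit.
Unset Printing Implicit Defensive.
Import Order.TTheory GRing.Theory Num.Theory.
Import numFieldNormedType.Exports.
Local Open Scope classical_set_scope.
Local Open Scope ring_scope.

(* Write S for the survival function of g, r for the service indicator and
   H = r h^x + h^y.  A test function B(x,y) Q(x,y + T - s) is transported along
   the age direction, so the time derivative cancels against the age derivative
   of Q and only the sign of r B_x + B_y + r B Q_x/Q - B H matters.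

   - If B >= 0 vanishes at the origin and r B_x + B_y <= 0, then B = 0 almost
     everywhere on {y < T}.  Such supersolutions locate the mass of mu_T younger
     than T: x <= y always, x = y while everybody is served, and x = min(y, ystar)
     once the servers saturate exactly for ages below ystar.
   - B = 1/S solves r B_x + B_y = B H, so the (1/S)-weighted mass with age in
     [a, b) is exactly lambda0 (b - a); squeezing S between its end values on
     short age intervals gives the mass itself, lambda0 int S(min(u,ystar),u) du.
     That the servers saturate at ystar follows by advancing the age level below
     which the mass stays < 1, in steps of fixed length.
   - Hence mu_T and mu_infty coincide on {y < T}, for every solution mu, and xi_T
     is mu_T restricted to {y >= T}.
   - With B = 1/S and Q = S 1_{y >= T}, the mass older than T is at most
     int S(x,y+T)/S(x,y) mu_0(dx,dy), which vanishes for the null initial measure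
     and tends to 0 by dominated convergence in general.

   All comparisons of the two time integrals are pointwise in s, so measurability
   in s of the integrands is never needed. *)

(** * One-sided differential calculus and test functions *)

(** The service indicator r depends on the unknown solution, so the characteristics cannot be solved
    in advance. Information on r and on the support is gained in turns: each test uses an inequality
    valid for every r in [0, 1], or values of r and support facts obtained from earlier tests. The
    argument y + T - s of Q is the age at time T of a customer aged y at time s. Customers present
    at time 0 reach a final age at least T, arrivals at time s the final age T - s; so a Q supported
    below T removes the initial term, and one supported above T removes the arrivals. This separates
    the young mass from the old mass. Admissible tests are C^1 with compact support, while 1/S and
    indicators of age ranges are not. Decreasing cutoffs preserve inequalities, cutoffs flat on the
    support preserve identities, and 1/S is altered only where S is small. For a solution the limits
    are taken at a fixed time T under a finite measure, where domination by a constant suffices. *)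

Section one_sided_derivative.
Context {R : realType}.
Implicit Types (f k : R -> R) (a d e : R).

Definition increments a := within [set h : R | 0 <= a + h] 0^'.

(** The value is an argument, so that the calculus rules below compose; [derive_Rp] is recovered
    only once limits are known to be unique. *)
Definition is_dRp f a d :=
  h^-1 * (f (a + h) - f a) @[h --> increments a] --> d.

Instance increments_filter a : Filter (increments a).
Proof. exact: within_filter. Qed.

Lemma increments_neq0 a : \forall h \near increments a, h != 0.
Proof. by apply: cvg_within; exact: withinT. Qed.

(** For a < 0 no small increment is admissible and the filter is trivial; properness is what makes
    one-sided derivatives unique. *)
Lemma increments_proper a : 0 <= a -> ProperFilter (increments a).
Proof.
move=> a0; apply: Build_ProperFilter_ex => A [e /= e0 eA].
exists (e / 2); apply: eA => /=; rewrite ?sub0r ?normrN.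
- by rewrite gtr0_norm ?divr_gt0// ltr_pdivrMr// ltr_pMr// ltr1n.
- by rewrite gt_eqF// divr_gt0.
- by rewrite addr_ge0// divr_ge0// ltW.
Qed.

Lemma is_dRp_derivable f a d : is_dRp f a d -> derivable_Rp f a.
Proof. by move=> fad; apply/cvg_ex; exists d. Qed.

Lemma is_dRp_derive f a d : 0 <= a -> is_dRp f a d -> derive_Rp f a = d.
Proof.
move=> a0; have := increments_proper a0 => ? fad.
exact: (@cvg_lim _ _ _ (increments a)).
Qed.

Lemma eq_is_dRp f k a d : 0 <= a -> (forall x, 0 <= x -> f x = k x) ->
  is_dRp f a d -> is_dRp k a d.
Proof.
move=> a0 fk; apply: cvg_trans; apply: near_eq_cvg.
rewrite near_withinE; near=> h => /= ah.
by rewrite !fk.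
Unshelve. all: by end_near. Qed.

Lemma is_dRp_cvg f a d : is_dRp f a d -> f (a + h) @[h --> increments a] --> f a.
Proof.
move=> fad.
have h0 : h @[h --> increments a] --> (0 : R).
  by apply: cvg_trans; [exact: cvg_within|exact: nbhs_dnbhs].
have hq : f a + h * (h^-1 * (f (a + h) - f a)) @[h --> increments a] --> f a + 0 * d.
  by apply: cvgD; [exact: cvg_cst|exact: cvgM].
move: hq; rewrite mul0r addr0; apply: cvg_trans; apply: near_eq_cvg.
apply: filterS (increments_neq0 a) => h hn0 /=.
by rewrite mulVKf// addrC subrK.
Qed.

Lemma is_dRp_cst c a : is_dRp (fun=> c) a 0.
Proof.
rewrite /is_dRp /quotient_Rp.
under eq_fun do rewrite subrr mulr0.
exact: cvg_cst.
Qed.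

Lemma is_dRp_id a : is_dRp id a 1.
Proof.
apply: cvg_trans (near_eq_cvg _) (cvg_cst (1 : R)).
apply: filterS (increments_neq0 a) => h hn0 /=.
by rewrite addrAC subrr add0r mulVf.
Qed.

Lemma is_dRpD f k a d e : is_dRp f a d -> is_dRp k a e ->
  is_dRp (fun x => f x + k x) a (d + e).
Proof.
move=> fd ke; apply: cvg_trans (cvgD fd ke); apply: near_eq_cvg.
by near=> h; rewrite !fctE /=; ring.
Unshelve. all: by end_near. Qed.

Lemma is_dRpM f k a d e : is_dRp f a d -> is_dRp k a e ->
  is_dRp (fun x => f x * k x) a (d * k a + f a * e).
Proof.
move=> fd ke; have ka := is_dRp_cvg ke.
apply: cvg_trans (cvgD (cvgM fd ka) (cvgM (cvg_cst (f a)) ke)).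
apply: near_eq_cvg.
by near=> h; rewrite !fctE /=; ring.
Unshelve. all: by end_near. Qed.

Lemma is_dRpV f a d : (forall x, 0 <= x -> f x != 0) -> 0 <= a ->
  is_dRp f a d -> is_dRp (fun x => (f x)^-1) a (- d / f a ^+ 2).
Proof.
move=> fn0 a0 fd; have fa := is_dRp_cvg fd.
rewrite expr2 invfM.
apply: cvg_trans (cvgM (cvgN fd) (cvgM (cvgV (fn0 _ a0) fa) (cvg_cst (f a)^-1))).
apply: near_eq_cvg.
rewrite near_withinE; near=> h => /= ah.
have := fn0 _ ah; have := fn0 _ a0 => fa0 fah.
have -> : (f (a + h))^-1 - (f a)^-1 = - (f (a + h) - f a) * ((f (a + h))^-1 * (f a)^-1).
  by field; apply/andP.
by rewrite ?fctE /= !mulrA mulrN !mulNr.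
Unshelve. all: by end_near. Qed.

(** Caratheodory's slope of [k] avoids dividing by f (a + h) - f a, which may vanish. The outer
    derivative is two-sided because f (a + h) may approach f a from either side. *)
Lemma is_dRp_comp f k a d e : is_dRp f a d -> is_derive (f a) 1 k e ->
  is_dRp (fun x => k (f x)) a (e * d).
Proof.
move=> fd /is_derive1_caratheodory[g [kg gc <-]].
apply: cvg_trans (cvgM (cvg_comp _ _ (is_dRp_cvg fd) gc) fd).
apply: near_eq_cvg.
by near=> h; rewrite ?fctE /= kg mulrCA.
Unshelve. all: by end_near. Qed.

Lemma is_dRp_le0 f a d : 0 <= a -> (forall x y, 0 <= x -> x <= y -> f y <= f x) ->
  is_dRp f a d -> d <= 0.
Proof.
move=> a0 fdecr fd; have ? := increments_proper a0.
apply: (closed_cvg _ (@closed_le _ 0) _ _ fd) => /=.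
rewrite near_withinE; near=> h => /= ah.
have [h0|h0] := leP 0 h.
  by rewrite mulr_ge0_le0 ?invr_ge0// subr_le0 fdecr// lerDl.
by rewrite mulr_le0_ge0 ?invr_le0// ?subr_ge0 ?fdecr// ?gerDl ltW.
Unshelve. all: by end_near. Qed.

End one_sided_derivative.

Section C1_functions.
Context {R : realType}.
Implicit Types (k : R -> R) (F G : R * R -> R).

Definition C1_real k k' :=
  continuous k' /\ forall v : R, is_derive v (1 : R) k (k' v).

Lemma C1_real_continuous k k' : C1_real k k' -> continuous k.
Proof.
by move=> [_ kk'] v; apply/differentiable_continuous/derivable1_diffP; case: (kk' v).
Qed.

(** The square of the positive part is a simple C^1 function vanishing exactly on a half-line; every
    cutoff below is built from it. *)
Definition sqp (u : R) : R := Num.max u 0 ^+ 2.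

Lemma sqp_ge0 u : 0 <= sqp u. Proof. exact: sqr_ge0. Qed.

Lemma sqp_eq0 u : u <= 0 -> sqp u = 0.
Proof. by rewrite /sqp => /max_idPr ->; rewrite expr0n. Qed.

Lemma sqpE u : 0 <= u -> sqp u = u ^+ 2.
Proof. by rewrite /sqp => /max_idPl ->. Qed.

Lemma sqp_gt0 u : 0 < u -> 0 < sqp u.
Proof. by move=> u0; rewrite sqpE ?exprn_gt0// ltW. Qed.

Lemma le_sqp u v : u <= v -> sqp u <= sqp v.
Proof.
rewrite /sqp => uv; case: (leP u 0) => u0; case: (leP v 0) => v0; nra.
Qed.

Lemma continuous_maxr0 : continuous (fun u : R => Num.max u 0).
Proof. by move=> u; apply: continuous_max; [exact: cvg_id|exact: cvg_cst]. Qed.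

(** The quadratic remainder yields at once the derivative of [sqp] and the continuity of its slope
    function. *)
Lemma sqp_taylor u v : `|sqp u - sqp v - 2 * Num.max v 0 * (u - v)| <= `|u - v| ^+ 2.
Proof.
rewrite /sqp real_normK ?num_real// ler_norml.
have uv0 := sqr_ge0 (u - v).
by apply/andP; split; case: (leP u 0) => u0; case: (leP v 0) => v0; nra.
Qed.

Lemma C1_sqp : C1_real sqp (fun u => 2 * Num.max u 0).
Proof.
split=> [u|v]; first by apply: cvgM; [exact: cvg_cst|exact: continuous_maxr0].
apply/is_derive1_caratheodory.
exists (fun z => if z == v then 2 * Num.max v 0 else (sqp z - sqp v) / (z - v)).
split=> [z||]; last by rewrite eqxx.
- case: eqP => [->|/eqP zv]; first by rewrite !subrr mulr0.
  by rewrite divfK// subr_eq0.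
- apply/cvgrPdist_le => /= e e0; near=> z.
  rewrite eqxx; case: eqP => [_|/eqP zv]; first by rewrite subrr normr0 ltW.
  have zv0 : 0 < `|z - v| by rewrite normr_gt0 subr_eq0.
  have zvn0 : z - v != 0 by rewrite subr_eq0.
  apply: (@le_trans _ _ `|z - v|).
    have -> : 2 * Num.max v 0 - (sqp z - sqp v) / (z - v) =
              - (sqp z - sqp v - 2 * Num.max v 0 * (z - v)) / (z - v) by field.
    by rewrite normrM normfV normrN ler_pdivrMr// -expr2 sqp_taylor.
  by rewrite distrC; near: z; exact: cvgr_dist_le.
Unshelve. all: by end_near. Qed.

Lemma C1_realM k k' l l' : C1_real k k' -> C1_real l l' ->
  C1_real (fun u => k u * l u) (fun u => k' u * l u + k u * l' u).
Proof.
move=> ck cl; have [k'c kk'] := ck; have [l'c ll'] := cl; split=> v.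
  apply: cvgD; apply: cvgM; [exact: k'c|exact: (C1_real_continuous cl)| |exact: l'c].
  exact: (C1_real_continuous ck).
have := is_deriveM (kk' v) (ll' v); congr is_derive.
by rewrite addrC mulrC.
Qed.

Lemma C1_real_comp k k' l l' : C1_real k k' -> C1_real l l' ->
  C1_real (fun u => k (l u)) (fun u => k' (l u) * l' u).
Proof.
move=> ck cl; have [k'c kk'] := ck; have [l'c ll'] := cl; split=> v.
  apply: cvgM; last exact: l'c.
  by apply: (@continuous_comp _ _ _ l k'); [exact: C1_real_continuous cl v|exact: k'c].
have := @is_derive1_comp _ k l v _ _ (kk' (l v)) (ll' v).
by rewrite /comp.
Qed.

Lemma C1_realV k k' : (forall u, k u != 0) -> C1_real k k' ->
  C1_real (fun u => (k u)^-1) (fun u => - k' u / k u ^+ 2).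
Proof.
move=> kn0 ck; have [k'c kk'] := ck; have kc := C1_real_continuous ck; split=> v.
  apply: cvgM; first by apply: cvgN; exact: k'c.
  apply: cvgV; first by rewrite expf_neq0.
  by under eq_fun do rewrite expr2; apply: cvgM; exact: kc.
have := is_deriveV (kn0 v) (kk' v); congr is_derive.
by rewrite /GRing.scale /= 2!mulNr mulrC.
Qed.

Lemma C1_real_affine (a b : R) : C1_real (fun u => a * u + b) (fun=> a).
Proof.
split=> v; first exact: cvg_cst.
have := is_deriveD (is_deriveM (is_derive_cst a v 1) (is_derive_id v 1)) (is_derive_cst b v 1).
congr is_derive.
by rewrite /GRing.scale /= !(mulr0, mulr1, addr0).
Qed.

(** Retraction of the plane onto the quadrant. Composing with it turns continuity within the
    quadrant into plain continuity, to which the usual closure rules apply. *)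
Definition clamp (z : R * R) : R * R := (Num.max z.1 0, Num.max z.2 0).

Lemma quadrant_clamp z : quadrant (clamp z).
Proof. by split; rewrite /= le_max lexx orbT. Qed.

Lemma clamp_id z : quadrant z -> clamp z = z.
Proof. by case: z => x y [/= x0 y0]; rewrite /clamp/= !max_l. Qed.

Lemma continuous_clamp1 : continuous (fun z => (clamp z).1).
Proof. by move=> z; apply: continuous_max; [exact: cvg_fst|exact: cvg_cst]. Qed.

Lemma continuous_clamp2 : continuous (fun z => (clamp z).2).
Proof. by move=> z; apply: continuous_max; [exact: cvg_snd|exact: cvg_cst]. Qed.

Lemma continuous_clamp : continuous clamp.
Proof.
move=> z; have c1 : Num.max w.1 0 @[w --> z] --> Num.max z.1 0 := @continuous_clamp1 z.
have c2 : Num.max w.2 0 @[w --> z] --> Num.max z.2 0 := @continuous_clamp2 z.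
exact: cvg_pair c1 c2.
Qed.

Lemma within_continuousE (F : R * R -> R) :
  {within quadrant, continuous F} <-> continuous (F \o clamp).
Proof.
split=> [/subspace_continuousP Fc z|Fc]; last first.
  apply: (@subspace_eq_continuous _ quadrant _ (F \o clamp)).
    by move=> z /set_mem zq; rewrite /= clamp_id.
  exact: continuous_subspaceT.
move=> A FA; have H := Fc _ (quadrant_clamp z) A FA.
suff : nbhs z (clamp @^-1` [set w | quadrant w -> A (F w)]).
  by apply: (@filterS _ (nbhs z)) => w; apply; exact: quadrant_clamp.
exact: (@continuous_clamp z).
Qed.

(** The partial derivatives are parameters: the closure lemmas then produce the explicit formulas
    that the sign computations need. *)
Structure C1_quad (F Fx Fy : R * R -> R) : Prop := MkC1Quad {
  C1_quad_cont : continuous (F \o clamp);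
  C1_quad_contx : continuous (Fx \o clamp);
  C1_quad_conty : continuous (Fy \o clamp);
  C1_quad_dx : forall z, quadrant z -> is_dRp (fun x => F (x, z.2)) z.1 (Fx z);
  C1_quad_dy : forall z, quadrant z -> is_dRp (fun y => F (z.1, y)) z.2 (Fy z) }.

Lemma C1_quadrantP F : C1_quadrant F ->
  C1_quad F (fun z => derive_Rp (fun x => F (x, z.2)) z.1)
            (fun z => derive_Rp (fun y => F (z.1, y)) z.2).
Proof. by case=> *; split=> //; exact/within_continuousE. Qed.

Lemma C1_quad_fst k k' : C1_real k k' ->
  C1_quad (fun z => k z.1) (fun z => k' z.1) (fun=> 0).
Proof.
move=> ck; have [k'c kk'] := ck; split=> [z|z|z|z [z0 _]|z _].
- apply: (@continuous_comp _ _ _ (fun z => (clamp z).1) k).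
    exact: continuous_clamp1.
  exact: C1_real_continuous ck _.
- apply: (@continuous_comp _ _ _ (fun z => (clamp z).1) k').
    exact: continuous_clamp1.
  exact: k'c.
- exact: cvg_cst.
- by have := is_dRp_comp (@is_dRp_id _ z.1) (kk' z.1); rewrite mulr1.
- exact: (is_dRp_cst (k z.1)).
Qed.

Lemma C1_quad_snd k k' : C1_real k k' ->
  C1_quad (fun z => k z.2) (fun=> 0) (fun z => k' z.2).
Proof.
move=> ck; have [k'c kk'] := ck; split=> [z|z|z|z _|z [_ z0]].
- apply: (@continuous_comp _ _ _ (fun z => (clamp z).2) k).
    exact: continuous_clamp2.
  exact: C1_real_continuous ck _.
- exact: cvg_cst.
- apply: (@continuous_comp _ _ _ (fun z => (clamp z).2) k').
    exact: continuous_clamp2.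
  exact: k'c.
- exact: (is_dRp_cst (k z.2)).
- by have := is_dRp_comp (@is_dRp_id _ z.2) (kk' z.2); rewrite mulr1.
Qed.

Lemma C1_quadD F Fx Fy G Gx Gy : C1_quad F Fx Fy -> C1_quad G Gx Gy ->
  C1_quad (fun z => F z + G z) (fun z => Fx z + Gx z) (fun z => Fy z + Gy z).
Proof.
move=> [Fc Fxc Fyc Fdx Fdy] [Gc Gxc Gyc Gdx Gdy].
split=> [z|z|z|z zq|z zq].
- exact: cvgD (Fc z) (Gc z).
- exact: cvgD (Fxc z) (Gxc z).
- exact: cvgD (Fyc z) (Gyc z).
- exact: is_dRpD (Fdx z zq) (Gdx z zq).
- exact: is_dRpD (Fdy z zq) (Gdy z zq).
Qed.

Lemma C1_quadM F Fx Fy G Gx Gy : C1_quad F Fx Fy -> C1_quad G Gx Gy ->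
  C1_quad (fun z => F z * G z) (fun z => Fx z * G z + F z * Gx z)
    (fun z => Fy z * G z + F z * Gy z).
Proof.
move=> [Fc Fxc Fyc Fdx Fdy] [Gc Gxc Gyc Gdx Gdy].
split=> [z|z|z|z zq|z zq].
- exact: cvgM (Fc z) (Gc z).
- exact: cvgD (cvgM (Fxc z) (Gc z)) (cvgM (Fc z) (Gxc z)).
- exact: cvgD (cvgM (Fyc z) (Gc z)) (cvgM (Fc z) (Gyc z)).
- by have := is_dRpM (Fdx z zq) (Gdx z zq); rewrite -surjective_pairing.
- by have := is_dRpM (Fdy z zq) (Gdy z zq); rewrite -surjective_pairing.
Qed.

Lemma C1_quadV F Fx Fy : (forall z, quadrant z -> F z != 0) -> C1_quad F Fx Fy ->
  C1_quad (fun z => (F z)^-1) (fun z => - Fx z / F z ^+ 2) (fun z => - Fy z / F z ^+ 2).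
Proof.
move=> F0 [Fc Fxc Fyc Fdx Fdy].
have F2c : continuous (fun z => (F (clamp z) ^+ 2)^-1).
  move=> z; apply: cvgV; first by rewrite expf_neq0// F0//; exact: quadrant_clamp.
  by under eq_fun do rewrite expr2; exact: cvgM (Fc z) (Fc z).
split=> [z|z|z|z zq|z zq].
- by apply: cvgV (Fc z); rewrite F0//; exact: quadrant_clamp.
- exact: cvgM (cvgN (Fxc z)) (F2c z).
- exact: cvgM (cvgN (Fyc z)) (F2c z).
- have := is_dRpV _ _ (Fdx z zq); rewrite -surjective_pairing; apply; last by case: zq.
  by move=> x x0; apply: F0; split=> //; case: zq.
- have := is_dRpV _ _ (Fdy z zq); rewrite -surjective_pairing; apply; last by case: zq.
  by move=> x x0; apply: F0; split=> //; case: zq.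
Qed.

Lemma C1_quad_comp k k' F Fx Fy : C1_real k k' -> C1_quad F Fx Fy ->
  C1_quad (fun z => k (F z)) (fun z => k' (F z) * Fx z) (fun z => k' (F z) * Fy z).
Proof.
move=> ck [Fc Fxc Fyc Fdx Fdy]; have [k'c kk'] := ck.
have kFc : continuous (k' \o (F \o clamp)).
  by move=> z; apply: continuous_comp; [exact: Fc|exact: k'c].
split=> [z|z|z|z zq|z zq].
- apply: (@continuous_comp _ _ _ (F \o clamp) k); first exact: Fc.
  exact: C1_real_continuous ck _.
- exact: cvgM (kFc z) (Fxc z).
- exact: cvgM (kFc z) (Fyc z).
- by apply: is_dRp_comp (Fdx z zq) _; rewrite -surjective_pairing.
- by apply: is_dRp_comp (Fdy z zq) _; rewrite -surjective_pairing.
Qed.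

End C1_functions.

Section test_functions.
Context {R : realType}.
Implicit Types (k : R -> R) (B Q F : R * R -> R).

(** The second variable ranges over all reals, with a two-sided derivative: [Q] is read at y + T -
    s, which decreases in s and is negative for large s. *)
Structure C1_strip (Q Qx Qy : R * R -> R) : Prop := MkC1Strip {
  C1_strip_cont : continuous (fun z : R * R => Q (Num.max z.1 0, z.2));
  C1_strip_contx : continuous (fun z : R * R => Qx (Num.max z.1 0, z.2));
  C1_strip_conty : continuous (fun z : R * R => Qy (Num.max z.1 0, z.2));
  C1_strip_dx : forall x y, 0 <= x -> is_dRp (fun x => Q (x, y)) x (Qx (x, y));
  C1_strip_dy : forall x y, 0 <= x ->
    is_derive y (1 : R) (fun y => Q (x, y)) (Qy (x, y)) }.

Lemma C1_strip_snd k k' : C1_real k k' ->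
  C1_strip (fun z => k z.2) (fun=> 0) (fun z => k' z.2).
Proof.
move=> ck; have [k'c kk'] := ck; split=> [z|z|z|x y x0|x y x0].
- apply: (@continuous_cvg _ _ _ _ _ (fun z : R * R => z.2) k); last exact: cvg_snd.
  exact: C1_real_continuous ck _.
- exact: cvg_cst.
- by apply: (@continuous_cvg _ _ _ _ _ (fun z : R * R => z.2) k'); [exact: k'c|exact: cvg_snd].
- exact: (is_dRp_cst (k y)).
- exact: kk'.
Qed.

Definition test_fun B Q (T : R) (p : R * (R * R)) : R :=
  B p.2 * Q (p.2.1, p.2.2 + (T - p.1)).

Lemma within_octant (f h : R * (R * R) -> R) : continuous h ->
  (forall p, octant p -> f p = h p) -> {within octant, continuous f}.
Proof.
move=> hc fh; apply: (@subspace_eq_continuous _ octant _ h).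
  by move=> p /set_mem po; exact/esym/fh.
exact: continuous_subspaceT.
Qed.

Lemma test_fun_cont B Q T : continuous (B \o clamp) ->
  continuous (fun z : R * R => Q (Num.max z.1 0, z.2)) ->
  continuous (fun p : R * (R * R) =>
    B (clamp p.2) * Q (Num.max p.2.1 0, p.2.2 + (T - p.1))).
Proof.
move=> Bc Qc p; apply: cvgM.
  by apply: (@continuous_comp _ _ _ snd (B \o clamp)); [exact: cvg_snd|exact: Bc].
apply: (@continuous_comp _ _ _
  (fun p : R * (R * R) => (p.2.1, p.2.2 + (T - p.1))) (fun z => Q (Num.max z.1 0, z.2))).
  have s1 : w.1 @[w --> p] --> p.1 by exact: cvg_fst.
  have s2 : w.2 @[w --> p] --> p.2 by exact: cvg_snd.
  have c1 : w.2.1 @[w --> p] --> p.2.1.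
    exact: (cvg_comp _ _ s2 cvg_fst).
  have c2 : w.2.2 + (T - w.1) @[w --> p] --> p.2.2 + (T - p.1).
    apply: cvgD; first exact: (cvg_comp _ _ s2 cvg_snd).
    by apply: cvgB => //; exact: cvg_cst.
  exact: cvg_pair c1 c2.
exact: Qc.
Qed.

Section test_fun.
Variables (B Bx By Q Qx Qy : R * R -> R) (T : R).
Hypotheses (cB : C1_quad B Bx By) (cQ : C1_strip Q Qx Qy).

Lemma test_fun_dt p : octant p ->
  is_dRp (fun t => test_fun B Q T (t, p.2)) p.1 (- (B p.2 * Qy (p.2.1, p.2.2 + (T - p.1)))).
Proof.
move=> [p0 [px py]].
have dline : is_dRp (fun t : R => p.2.2 + (T - t)) p.1 (0 + (0 + -1)).
  apply: is_dRpD; first exact: is_dRp_cst.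
  apply: is_dRpD; first exact: is_dRp_cst.
  have := is_dRpM (is_dRp_cst (-1) p.1) (is_dRp_id p.1).
  rewrite mul0r add0r mulr1; apply: eq_is_dRp => // x _.
  by rewrite mulN1r.
have := is_dRpM (is_dRp_cst (B p.2) p.1) (is_dRp_comp dline (C1_strip_dy cQ _ px)).
by rewrite mul0r !add0r mulrN1 mulrN.
Qed.

Lemma test_fun_dx p : octant p ->
  is_dRp (fun x => test_fun B Q T (p.1, (x, p.2.2))) p.2.1
    (Bx p.2 * Q (p.2.1, p.2.2 + (T - p.1)) + B p.2 * Qx (p.2.1, p.2.2 + (T - p.1))).
Proof.
move=> [p0 pq]; have px := pq.1.
have := is_dRpM (C1_quad_dx cB pq) (C1_strip_dx cQ (y := p.2.2 + (T - p.1)) px).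
by rewrite -surjective_pairing.
Qed.

Lemma test_fun_dy p : octant p ->
  is_dRp (fun y => test_fun B Q T (p.1, (p.2.1, y))) p.2.2
    (By p.2 * Q (p.2.1, p.2.2 + (T - p.1)) + B p.2 * Qy (p.2.1, p.2.2 + (T - p.1))).
Proof.
move=> [p0 pq]; have [px py] := pq.
have dline : is_dRp (fun y : R => y + (T - p.1)) p.2.2 (1 + 0).
  by apply: is_dRpD; [exact: is_dRp_id|exact: is_dRp_cst].
have := is_dRpM (C1_quad_dy cB pq) (is_dRp_comp dline (C1_strip_dy cQ _ px)).
by rewrite addr0 mulr1 -surjective_pairing.
Qed.

Lemma test_fun_Cc1 (N : R) : 0 <= T ->
  (forall z, quadrant z -> B z != 0 -> z.1 <= N /\ z.2 <= N) ->
  (forall z, Q z != 0 -> - N <= z.2) ->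
  Cc1 (test_fun B Q T).
Proof.
move=> T0 BN QN.
have [Bc Bxc Byc _ _] := cB; have [Qc Qxc Qyc _ _] := cQ.
have oE (p : R * (R * R)) : octant p ->
    (clamp p.2 = p.2) * ((Num.max p.2.1 0, p.2.2 + (T - p.1)) = (p.2.1, p.2.2 + (T - p.1))).
  by case=> ? pq; rewrite clamp_id// max_l//; case: pq.
have dE := fun p (po : octant p) => is_dRp_derive po.1 (test_fun_dt po).
have dxE := fun p (po : octant p) => is_dRp_derive po.2.1 (test_fun_dx po).
have dyE := fun p (po : octant p) => is_dRp_derive po.2.2 (test_fun_dy po).
split.
- split.
    apply: (@within_octant (test_fun B Q T) _ (test_fun_cont (T := T) Bc Qc)) => p po.
    by rewrite /test_fun !(oE _ po).
  (* The support of [B] gives y <= N and that of [Q] gives -N <= y + (T - t); together t <= N + (T +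
     N). *)
  exists (`[0, N + (T + N)] `*` (`[0, N] `*` `[0, N])); split.
  + by apply: compact_setX; [|apply: compact_setX]; exact: segment_compact.
  + move=> [t [x y]] [/= + [/= + +]]; rewrite /= !in_itv/=.
    by move=> /andP[? _] /andP[? _] /andP[? _].
  + move=> [t [x y]] [/= t0 xy0] nK; apply/eqP; apply: contra_notT nK.
    rewrite /test_fun mulf_eq0 negb_or /= => /andP[/(BN _ xy0)/= [xN yN] /QN /= sN].
    have [x0 y0] := xy0.
    rewrite !in_itv/= t0 x0 xN y0 yN; split=> //.
    by move: sN yN; lra.
- move=> p po; split; apply: is_dRp_derivable.
  + exact: test_fun_dt.
  + exact: test_fun_dx.
  + exact: test_fun_dy.
- apply: (@within_octant _ (fun p => - (B (clamp p.2) * Qy (Num.max p.2.1 0, p.2.2 + (T - p.1))))).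
    by move=> p; apply: cvgN; exact: test_fun_cont.
  by move=> p po; rewrite /dt dE// !(oE _ po).
- apply: (@within_octant _ (fun p => Bx (clamp p.2) * Q (Num.max p.2.1 0, p.2.2 + (T - p.1)) +
    B (clamp p.2) * Qx (Num.max p.2.1 0, p.2.2 + (T - p.1)))).
    by move=> p; apply: cvgD; exact: test_fun_cont.
  by move=> p po; rewrite /dx dxE// !(oE _ po).
- apply: (@within_octant _ (fun p => By (clamp p.2) * Q (Num.max p.2.1 0, p.2.2 + (T - p.1)) +
    B (clamp p.2) * Qy (Num.max p.2.1 0, p.2.2 + (T - p.1)))).
    by move=> p; apply: cvgD; exact: test_fun_cont.
  by move=> p po; rewrite /dy dyE// !(oE _ po).
Qed.

End test_fun.
End test_functions.

(** * Integration *)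

Section integral_without_measurability.
Context d (T : measurableType d) (R : realType) (mu : {measure set T -> \bar R}).
Implicit Types (D N : set T).
Local Open Scope ereal_scope.
Import HBNNSimple.

(* The integral of a nonnegative function is a supremum over simple functions
   below it, so it is monotone even on non-measurable functions. *)
Lemma ge0_le_lower_integral D (f g : T -> \bar R) :
  (forall x, D x -> 0 <= f x) -> (forall x, D x -> f x <= g x) ->
  \int[mu]_(x in D) f x <= \int[mu]_(x in D) g x.
Proof.
move=> f0 fg; have g0 x : D x -> 0 <= g x by move=> Dx; exact: le_trans (f0 _ Dx) (fg _ Dx).
rewrite !ge0_integralE//; apply: le_ereal_sup => _ [h /= hf <-]; exists h => //= x.
apply: le_trans (hf x) _; rewrite /patch; case: ifPn => // /set_mem; exact: fg.
Qed.

(** Only the simple functions below [F] are restricted to the complement of [N]. They are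
    measurable, so their integrals do not change, and the restrictions lie below [G]. *)
Let ge0_le_integral_null N (F G : T -> \bar R) : measurable N -> mu N = 0 ->
  (forall x, 0 <= F x) -> (forall x, 0 <= G x) -> (forall x, ~ N x -> F x <= G x) ->
  \int[mu]_x F x <= \int[mu]_x G x.
Proof.
move=> mN N0 F0 G0 FG; rewrite ge0_integralTE//; apply: ge_ereal_sup => _ [h /= hF <-].
rewrite -integralT_nnsfun (ge0_negligible_integral mN)//; last 2 first.
  exact/measurable_EFinP.
  by move=> x _; rewrite lee_fin.
rewrite integral_mkcond; apply: ge0_le_lower_integral => x _.
  by rewrite erestrict_ge0// => z _; rewrite lee_fin.
rewrite /patch; case: ifPn => // /set_mem[_ Nx]; exact: le_trans (hF x) (FG x Nx).
Qed.

Lemma eq_integral_null D N (f g : T -> \bar R) : measurable N -> mu N = 0 ->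
  (forall x, D x -> ~ N x -> f x = g x) ->
  \int[mu]_(x in D) f x = \int[mu]_(x in D) g x.
Proof.
move=> mN N0 fg; rewrite integralE [RHS]integralE.
have fgD x : ~ N x -> (f \_ D) x = (g \_ D) x.
  by move=> Nx; rewrite /patch; case: ifPn => // /set_mem Dx; exact: fg.
congr (_ - _); rewrite !(integral_mkcond D) -?funepos_restrict -?funeneg_restrict;
  apply/eqP; rewrite eq_le.
all: by apply/andP; split; apply: (ge0_le_integral_null mN N0) => // x Nx;
  rewrite ?funeposE ?funenegE fgD.
Qed.

Lemma eq_Rintegral_null D N (f g : T -> R) : measurable N -> mu N = 0 ->
  (forall x, D x -> ~ N x -> f x = g x) ->
  (\int[mu]_(x in D) f x = \int[mu]_(x in D) g x)%R.
Proof.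
move=> mN N0 fg; rewrite /Rintegral; congr fine; apply: (eq_integral_null mN N0).
by move=> x Dx Nx; rewrite fg.
Qed.

Lemma Rintegral_le0 D (f : T -> R) : (forall x, D x -> (f x <= 0)%R) ->
  (\int[mu]_(x in D) f x <= 0)%R.
Proof.
move=> f0; rewrite /Rintegral integralE integral0_eq ?add0e; last first.
  by move=> x Dx; rewrite funeposE max_r// lee_fin f0.
(* If the negative part has infinite integral, [fine] returns 0, which is still nonpositive. *)
rewrite fine_le0// oppe_le0 integral_ge0//.
Qed.

Lemma Rintegral_null_le0 D N (f : T -> R) : measurable N -> mu N = 0 ->
  (forall x, D x -> ~ N x -> (f x <= 0)%R) -> (\int[mu]_(x in D) f x <= 0)%R.
Proof.
move=> mN N0 f0; rewrite (@eq_Rintegral_null _ N _ (f \_ (~` N))) //.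
  apply: Rintegral_le0 => x Dx; rewrite /patch; case: ifPn => // /set_mem; exact: f0.
by move=> x Dx Nx; rewrite patchT//; apply/mem_set.
Qed.

(** The negative part of [f] may have infinite integral; [fine] then returns 0, and the comparison
    survives because [g] is nonnegative. *)
Lemma le_lower_Rintegral D (f g : T -> R) : (forall x, D x -> (0 <= g x)%R) ->
  \int[mu]_(x in D) (g x)%:E < +oo ->
  (forall x, D x -> (f x <= g x)%R) ->
  (\int[mu]_(x in D) f x <= \int[mu]_(x in D) g x)%R.
Proof.
move=> g0 gfin fg; have ig0 : 0 <= \int[mu]_(x in D) (g x)%:E by exact: integral_ge0.
have fp : \int[mu]_(x in D) ((EFin \o f) ^\+ x) <= \int[mu]_(x in D) (g x)%:E.
  apply: ge0_le_lower_integral => x Dx; first exact: funepos_ge0.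
  by rewrite funeposE ge_max !lee_fin fg// g0.
have fp0 : 0 <= \int[mu]_(x in D) ((EFin \o f) ^\+ x) by apply: integral_ge0 => x _; exact: funepos_ge0.
have fn0 : 0 <= \int[mu]_(x in D) ((EFin \o f) ^\- x) by apply: integral_ge0 => x _; exact: funeneg_ge0.
rewrite /Rintegral (integralE _ _ (EFin \o f)).
have /fineK fpE : \int[mu]_(x in D) ((EFin \o f) ^\+ x) \is a fin_num.
  by rewrite ge0_fin_numE//; exact: le_lt_trans fp gfin.
have /fineK gE : \int[mu]_(x in D) (g x)%:E \is a fin_num by rewrite ge0_fin_numE.
move: fp fp0 ig0 fn0; rewrite -fpE -gE !lee_fin /=.
case: (\int[mu]_(x in D) (EFin \o f)^\- x) => [r| |] //=; rewrite ?lee_fin => *.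
by rewrite lerBlDr ler_wpDr.
Qed.

End integral_without_measurability.

Section dominated_convergence_real.
Context d (T : measurableType d) (R : realType) (mu : {measure set T -> \bar R}).

Lemma bounded_integrable (D : set T) (f : T -> R) (K : R) : measurable D ->
  (mu D < +oo)%E -> measurable_fun D f -> (forall x, D x -> `|f x| <= K) ->
  mu.-integrable D (EFin \o f).
Proof.
move=> mD Dfin mf fK; apply: (@le_integrable _ _ _ mu D mD _ (EFin \o cst K)).
- exact/measurable_EFinP.
- move=> x Dx; by rewrite lee_fin (le_trans (fK x Dx) (ler_norm _)).
- apply/integrableP; split; first exact/measurable_EFinP.
  under eq_integral do rewrite /=.
  by rewrite integral_cst// lte_mul_pinfty// lee_fin.
Qed.

Lemma cvg_Rintegral (D : set T) (f_ : nat -> T -> R) (f G : T -> R) : measurable D ->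
  (forall n, measurable_fun D (f_ n)) -> mu.-integrable D (EFin \o G) ->
  (forall x, D x -> f_ n x @[n --> \oo] --> f x) ->
  (forall n x, D x -> `|f_ n x| <= G x) ->
  \int[mu]_(x in D) f_ n x @[n --> \oo] --> \int[mu]_(x in D) f x.
Proof.
move=> mD mf_ iG f_f f_G.
have mf : measurable_fun D f by exact: (measurable_fun_cvg mf_ f_f).
have [||||| + _ +] := @dominated_convergence _ _ _ mu D mD (fun n => EFin \o f_ n)
  (EFin \o f) (EFin \o G).
- by move=> n; exact/measurable_EFinP.
- exact/measurable_EFinP.
- by apply: aeW => x Dx; apply: cvg_EFin; [exact: nearW|exact: f_f].
- exact: iG.
- by apply: aeW => x n Dx; rewrite lee_fin f_G.
move=> /(integrable_fin_num mD) /fineK <-.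
exact: fine_cvg.
Qed.

End dominated_convergence_real.

Section measurability.
Context {R : realType}.
Implicit Types (F : R * R -> R).

(** The plane carries the product sigma-algebra, so an open set is written as a countable union of
    boxes with rational centres and half-widths 1/(n+1). *)
Lemma open_measurable_plane (O : set (R * R)) :
  open O -> measurable (O : set (plane R)).
Proof.
move=> oO.
pose e n : R := n.+1%:R^-1.
pose rect n (a b : rat) : set (plane R) :=
  `]ratr a - e n, ratr a + e n[ `*` `]ratr b - e n, ratr b + e n[.
have mrect n a b : measurable (rect n a b) by apply: measurableX; exact: measurable_itv.
pose J n a b : set (plane R) := if `[< rect n a b `<=` O >] then rect n a b else set0.
suff -> : O = \bigcup_n \bigcup_a \bigcup_b J n a b.
  apply: bigcupT_measurable => n; apply: bigcupT_measurable_rat => a.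
  apply: bigcupT_measurable_rat => b.
  by rewrite /J; case: ifP => // _; exact: measurable0.
apply/seteqP; split=> [[x y] Oxy|z [n _ [a _ [b _]]]]; last first.
  by rewrite /J; case: ifPn => // /asboolP; apply.
have /nbhs_ballP[r /= r0 rO] : nbhs (x, y) O by exact: open_nbhs_nbhs.
(* A point of the box is within [e n] of its centre, which is within [e n] of (x, y): two such
   distances must fit into r. *)
have [n nr] : exists n, e n < r / 2.
  have r20 : 0 < r / 2 by rewrite divr_gt0.
  have := near_infty_natSinv_lt (PosNum r20) => -[n _ /(_ n (leqnn n)) nr].
  by exists n.
have e0 : 0 < e n by rewrite invr_gt0.
have rat_near (u : R) : exists a : rat, `|ratr a - u| < e n.
  have := @rat_in_itvoo R (u - e n) (u + e n); rewrite ltrBlDr -addrA ltrDl addr_gt0//.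
  move=> /(_ isT)[a]; rewrite in_itv/= => ua; exists a.
  by rewrite ltr_distl.
have [a ax] := rat_near x; have [b yb] := rat_near y.
exists n => //; exists a => //; exists b => //.
rewrite /J; case: ifPn => [_|/asboolP []].
  rewrite /rect /= !in_itv/=.
  move: ax yb; rewrite !ltr_distl => /andP[? ?] /andP[? ?].
  by split; apply/andP; split; lra.
move=> [u v]; rewrite /rect/= !in_itv/= => -[/andP[? ?] /andP[? ?]].
apply: rO; move: ax yb; rewrite !ltr_distl => /andP[? ?] /andP[? ?].
by split; rewrite /ball /= ltr_distl; apply/andP; split; lra.
Qed.

Lemma continuous_measurable_plane F :
  continuous F -> measurable_fun setT (F : plane R -> R).
Proof.
move=> /continuousP cF; apply: (measurability _ (RGenInftyO.measurableE R)) => //.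
move=> _ [_ [x ->] <-]; rewrite setTI; apply: open_measurable_plane.
by apply: cF; exact: interval_open.
Qed.

Lemma measurable_quadrant : measurable (quadrant : set (plane R)).
Proof.
have -> : quadrant = `[0%R, +oo[ `*` `[0%R, +oo[ :> set (R * R).
  by apply/seteqP; split=> -[x y] /=; rewrite !in_itv/= !andbT.
by apply: measurableX; exact: measurable_itv.
Qed.

Lemma measurable_on_quadrant F : continuous (F \o clamp) ->
  measurable_fun (quadrant : set (plane R)) F.
Proof.
move=> /continuous_measurable_plane cF.
apply: (eq_measurable_fun (F \o clamp)); last exact: measurable_funTS.
by move=> z /set_mem zq; rewrite /= clamp_id.
Qed.

End measurability.

(** * The weak formulation *)

Section survival_function.
Context {R : realType} (g : R * R -> R).
Hypothesis gP : probability_density g.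
Local Notation leb := (@lebesgue_measure R).
Local Notation S := (Sg g).

Definition orthant (z : R * R) : set (plane R) := `[z.1, +oo[ `*` `[z.2, +oo[.

Lemma orthantP z w : orthant z w <-> z.1 <= w.1 /\ z.2 <= w.2.
Proof. by rewrite /orthant /= !in_itv/= !andbT. Qed.

Lemma measurable_orthant z : measurable (orthant z).
Proof. by apply: measurableX; exact: measurable_itv. Qed.

Lemma orthant0 : orthant (0, 0) = quadrant.
Proof. by apply/seteqP; split=> w; [case/orthantP|move=> wq; apply/orthantP]. Qed.

Lemma orthant_sub z w : z.1 <= w.1 -> z.2 <= w.2 -> orthant w `<=` orthant z.
Proof.
move=> zw1 zw2 u /orthantP[wu1 wu2].
by apply/orthantP; split; [exact: le_trans wu1|exact: le_trans wu2].
Qed.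

Let g0 z w : quadrant z -> orthant z w -> (0 <= (g w)%:E)%E.
Proof.
move=> [z1 z2] zw; rewrite lee_fin; case: gP => + _ _; apply.
by rewrite -orthant0; exact: (orthant_sub _ _ zw).
Qed.

Let mg z : quadrant z -> measurable_fun (orthant z) (EFin \o g).
Proof.
move=> [z1 z2]; apply/measurable_EFinP.
apply: (measurable_funS measurable_quadrant); last by case: gP.
by rewrite -orthant0; exact: orthant_sub.
Qed.

(** The extended integral is used because finiteness of these integrals is itself a consequence, by
    comparison with the total mass 1. *)
Lemma Sg_anti z w : quadrant z -> z.1 <= w.1 -> z.2 <= w.2 ->
  (\int[leb \x leb]_(u in orthant w) (g u)%:E <=
   \int[leb \x leb]_(u in orthant z) (g u)%:E)%E.
Proof.
move=> zq zw1 zw2; apply: ge0_subset_integral => //; try exact: measurable_orthant.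
- exact: mg.
- by move=> u; exact: g0.
- exact: orthant_sub.
Qed.

Lemma Sg_EFin z : quadrant z ->
  (S z)%:E = (\int[leb \x leb]_(u in orthant z) (g u)%:E)%E.
Proof.
move=> zq; rewrite /Sg /Rintegral fineK// ge0_fin_numE; last first.
  by apply: integral_ge0 => w; exact: g0.
have z00 : quadrant ((0, 0) : R * R) by split.
apply: le_lt_trans (Sg_anti z00 zq.1 zq.2) _.
by rewrite orthant0; case: gP => _ _ ->; rewrite ltry.
Qed.

Lemma Sg_ge0 z : quadrant z -> 0 <= S z.
Proof. by move=> zq; apply: Rintegral_ge0 => w zw; rewrite -lee_fin (g0 zq). Qed.

Lemma le_Sg z w : quadrant z -> z.1 <= w.1 -> z.2 <= w.2 -> S w <= S z.
Proof.
move=> zq zw1 zw2; have wq : quadrant w.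
  by case: zq => z1 z2; split; [exact: le_trans zw1|exact: le_trans zw2].
by rewrite -lee_fin !Sg_EFin// Sg_anti.
Qed.

Lemma Sg00 : S (0, 0) = 1.
Proof.
apply/EFin_inj; rewrite Sg_EFin; last by split.
by rewrite orthant0; case: gP.
Qed.

Lemma Sg_le1 z : quadrant z -> S z <= 1.
Proof. by move=> [z1 z2]; rewrite -Sg00; apply: le_Sg => //; split. Qed.

(** Dominated convergence along integer ages at x = 0; monotonicity in both variables then gives all
    real ages and all x. *)
Lemma cvg_Sg0 (x : R) : 0 <= x -> S (x, y) @[y --> +oo] --> 0.
Proof.
move=> x0.
have z00 : quadrant ((0, 0) : R * R) by split.
pose f n := g \_ (orthant (0, n%:R)).
have SE n : S (0, n%:R) = \int[(leb \x leb)%E]_(w in orthant (0, 0)) f n w.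
  by rewrite -Rintegral_mkcondr setIidr//; apply: orthant_sub => /=.
have ig : (leb \x leb)%E.-integrable (orthant (0, 0)) (EFin \o g).
  apply/integrableP; split; first exact: mg.
  have -> : (\int[leb \x leb]_(w in orthant (0%R, 0%R)) `|(EFin \o g) w| =
             \int[leb \x leb]_(w in orthant (0%R, 0%R)) (g w)%:E)%E.
    by apply: eq_integral => w /set_mem /(g0 z00) w0; rewrite gee0_abs.
  by rewrite orthant0; case: gP => _ _ ->; rewrite ltry.
have S0 : S (0, n%:R) @[n --> \oo] --> 0.
  have := @cvg_Rintegral _ _ _ (leb \x leb)%E (orthant (0, 0)) f (fun=> 0) g.
  rewrite Rintegral_cst ?mul0r; last exact: measurable_orthant.
  under eq_fun do rewrite -SE.
  apply => //; first exact: measurable_orthant.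
  - move=> n; apply/(measurable_restrict _ (measurable_orthant _) (measurable_orthant _)).
    rewrite setIidr; last exact: orthant_sub.
    by apply/measurable_EFinP; apply: mg; split => /=.
  - move=> w _; apply: cvg_near_cst.
    near=> n; rewrite /f patchC// inE /setC/= => /orthantP[_ /=].
    apply/negP; rewrite -ltNge.
    near: n; exact: nbhs_infty_gtr.
  - move=> n w w0; rewrite /f /patch; case: ifPn => _.
      by rewrite ger0_norm// -lee_fin (g0 z00).
    by rewrite normr0 -lee_fin (g0 z00).
apply/cvgrPdist_le => e e0.
have [n Sn] : exists n, S (0, n%:R) <= e.
  have [n _ /(_ n (leqnn n)) /=] := (@cvgr_le _ _ _ _ _ _ S0 e e0).
  by exists n.
near=> y; have ny : n%:R <= y by near: y; apply: nbhs_pinfty_ge; exact: num_real.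
have y0 : 0 <= y by exact: le_trans ny.
rewrite sub0r normrN ger0_norm; last exact: Sg_ge0.
by apply: le_trans Sn; apply: le_Sg.
Unshelve. all: by end_near. Qed.

End survival_function.

Section hazard_rate.
Context {R : realType} (g : R * R -> R).
Hypothesis gP : probability_density g.
Hypothesis SgC1 : C1_quadrant (Sg g).
Local Notation S := (Sg g).

Definition Sx (z : R * R) : R := derive_Rp (fun x => S (x, z.2)) z.1.
Definition Sy (z : R * R) : R := derive_Rp (fun y => S (z.1, y)) z.2.

Lemma C1_quad_Sg : C1_quad S Sx Sy.
Proof. exact: C1_quadrantP. Qed.

Lemma Sx_le0 z : quadrant z -> Sx z <= 0.
Proof.
move=> zq; have [z1 z2] := zq; apply: is_dRp_le0 z1 _ (C1_quad_dx C1_quad_Sg zq).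
by move=> x y x0 xy; apply: le_Sg.
Qed.

Lemma Sy_le0 z : quadrant z -> Sy z <= 0.
Proof.
move=> zq; have [z1 z2] := zq; apply: is_dRp_le0 z2 _ (C1_quad_dy C1_quad_Sg zq).
by move=> x y x0 xy; apply: le_Sg.
Qed.

Lemma hxE z : quadrant z -> 0 < S z -> hx g z = - Sx z / S z.
Proof.
move=> zq Sz; rewrite /hx patchT; last by apply/mem_set.
have dln : is_derive (S (z.1, z.2)) (1 : R) (@ln R) (S z)^-1.
  by rewrite -surjective_pairing; exact: is_derive1_ln.
by rewrite (is_dRp_derive zq.1 (is_dRp_comp (C1_quad_dx C1_quad_Sg zq) dln)) mulNr mulrC.
Qed.

Lemma hyE z : quadrant z -> 0 < S z -> hy g z = - Sy z / S z.
Proof.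
move=> zq Sz; rewrite /hy patchT; last by apply/mem_set.
have dln : is_derive (S (z.1, z.2)) (1 : R) (@ln R) (S z)^-1.
  by rewrite -surjective_pairing; exact: is_derive1_ln.
by rewrite (is_dRp_derive zq.2 (is_dRp_comp (C1_quad_dy C1_quad_Sg zq) dln)) mulNr mulrC.
Qed.

Lemma hx_ge0 z : quadrant z -> 0 <= hx g z.
Proof.
move=> zq; have [Sz|Sz] := ltP 0 (S z).
  by rewrite hxE// divr_ge0// ?oppr_ge0 ?Sx_le0// ltW.
by rewrite /hx patchC// inE => -[_]; rewrite ltNge Sz.
Qed.

Lemma hy_ge0 z : quadrant z -> 0 <= hy g z.
Proof.
move=> zq; have [Sz|Sz] := ltP 0 (S z).
  by rewrite hyE// divr_ge0// ?oppr_ge0 ?Sy_le0// ltW.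
by rewrite /hy patchC// inE => -[_]; rewrite ltNge Sz.
Qed.

End hazard_rate.

Section weak_formulation.
Context {R : realType} (lambda0 : R) (g : R * R -> R).
Hypothesis gP : probability_density g.
Hypothesis SgC1 : C1_quadrant (Sg g).
Variable m : R -> {finite_measure set (plane R) -> \bar R}.
Hypothesis msol : fluid_solution lambda0 g m.
Local Notation leb := (@lebesgue_measure R).

Definition hazard s (z : R * R) : R := rbar (m s) z.2 * hx g z + hy g z.

Lemma rbar_ge0 (mu : {measure set (plane R) -> \bar R}) (y : R) : 0 <= rbar mu y.
Proof. by rewrite /rbar; case: (_ <= _)%E. Qed.

Lemma rbar_le1 (mu : {measure set (plane R) -> \bar R}) (y : R) : rbar mu y <= 1.
Proof. by rewrite /rbar; case: (_ <= _)%E. Qed.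

Lemma hazard_ge0 s z : quadrant z -> 0 <= hazard s z.
Proof.
move=> zq; apply: addr_ge0; last exact: hy_ge0.
by apply: mulr_ge0; [exact: rbar_ge0|exact: hx_ge0].
Qed.

Section test.
Variables (B Bx By Q Qx Qy : R * R -> R) (N : R).
Hypotheses (cB : C1_quad B Bx By) (cQ : C1_strip Q Qx Qy).
Hypothesis BN : forall z, quadrant z -> B z != 0 -> z.1 <= N /\ z.2 <= N.
Hypothesis QN : forall z, Q z != 0 -> - N <= z.2.
Variables (T : R) (T0 : 0 <= T).

Definition transport s (z : R * R) : R :=
  Q (z.1, z.2 + (T - s)) * (rbar (m s) z.2 * Bx z + By z)
  + rbar (m s) z.2 * (B z * Qx (z.1, z.2 + (T - s))).

Definition killing s (z : R * R) : R :=
  B z * Q (z.1, z.2 + (T - s)) * hazard s z.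

Lemma fluid_test :
  pairing (fun z => B z * Q z) (m T) =
  pairing (fun z => B z * Q (z.1, z.2 + T)) (m 0)
  + lambda0 * \int[leb]_(s in `[0, T]) (B (0, 0) * Q (0, T - s))
  - \int[leb]_(s in `[0, T]) pairing (killing s) (m s)
  + \int[leb]_(s in `[0, T]) pairing (transport s) (m s).
Proof.
have [_ _ _ _ /(_ T T0 _ (test_fun_Cc1 cB cQ T0 BN QN))] := msol.
rewrite /test_fun.
have -> : pairing (fun z => B z * Q (z.1, z.2 + (T - T))) (m T) =
          pairing (fun z => B z * Q z) (m T).
  by apply: eq_Rintegral => z _; rewrite subrr addr0 -surjective_pairing.
have -> : pairing (fun z => B z * Q (z.1, z.2 + (T - 0))) (m 0) =
          pairing (fun z => B z * Q (z.1, z.2 + T)) (m 0).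
  by apply: eq_Rintegral => z _; rewrite subr0.
move=> ->; congr (_ + _ * _ - _ + _).
  by apply: eq_Rintegral => s _; rewrite /= add0r.
apply: eq_Rintegral => s; rewrite inE/= in_itv/= => /andP[s0 sT].
apply: eq_Rintegral => z /set_mem zq.
have po : octant (s, z) by [].
rewrite /dt /dx /dy (is_dRp_derive s0 (test_fun_dt (T := T) cQ po)).
rewrite (is_dRp_derive zq.1 (test_fun_dx (T := T) cB cQ po)).
rewrite (is_dRp_derive zq.2 (test_fun_dy (T := T) cB cQ po)).
by rewrite /transport/=; ring.
Qed.

Variable Nu : R -> set (plane R).
Hypothesis mNu : forall s : R, 0 <= s <= T -> (m s).-negligible (Nu s).

(** The exceptional sets [Nu s] let support facts already proved for [m s] enter the pointwise
    hypothesis. *)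
Lemma fluid_test_eq :
  (forall (s : R) (z : R * R), 0 <= s <= T -> quadrant z -> ~ Nu s z -> transport s z = killing s z) ->
  pairing (fun z => B z * Q z) (m T) =
  pairing (fun z => B z * Q (z.1, z.2 + T)) (m 0)
  + lambda0 * \int[leb]_(s in `[0, T]) (B (0, 0) * Q (0, T - s)).
Proof.
move=> tk; rewrite fluid_test; set a := (X in _ - X + _); set b := (X in _ + X = _).
suff -> : b = a by rewrite subrK.
apply: eq_Rintegral => s; rewrite inE/= in_itv/= => sT; have [M [mM M0 NuM]] := mNu sT.
by apply: (eq_Rintegral_null mM M0) => z zq Mz; rewrite tk// => /NuM.
Qed.

Hypothesis B0 : forall z, quadrant z -> 0 <= B z.
Hypothesis Q0 : forall z, 0 <= z.1 -> 0 <= Q z.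

Let killing_ge0 s z : quadrant z -> 0 <= killing s z.
Proof.
move=> zq; rewrite mulr_ge0//; last exact: hazard_ge0.
by rewrite mulr_ge0 ?B0// Q0//; case: zq.
Qed.

(** Killing has a favourable sign and is dropped altogether; only the sign of [transport] is then
    needed. *)
Lemma fluid_test_le :
  (forall (s : R) (z : R * R), 0 <= s <= T -> quadrant z -> ~ Nu s z -> transport s z <= 0) ->
  pairing (fun z => B z * Q z) (m T) <=
  pairing (fun z => B z * Q (z.1, z.2 + T)) (m 0)
  + lambda0 * \int[leb]_(s in `[0, T]) (B (0, 0) * Q (0, T - s)).
Proof.
move=> t0; rewrite fluid_test.
set a := (X in _ - X + _); set b := (X in _ - _ + X).
have a0 : 0 <= a.
  by apply: Rintegral_ge0 => s _; apply: Rintegral_ge0 => z; exact: killing_ge0.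
have b0 : b <= 0.
  apply: Rintegral_le0 => s; rewrite /= in_itv/= => sT; have [M [mM M0 NuM]] := mNu sT.
  by apply: (Rintegral_null_le0 mM M0) => z zq Mz; rewrite t0// => /NuM.
by rewrite -addrA gerDl; lra.
Qed.

(* Boundedness of [killing] makes its integral over the plane finite for every
   time, so that no measurability in time is needed to compare the two terms. *)
Lemma fluid_test_killed_le (K : R) :
  (forall (s : R) (z : R * R), 0 <= s <= T -> quadrant z -> B z * Q (z.1, z.2 + (T - s)) <= 1) ->
  (forall (s : R) (z : R * R), 0 <= s <= T -> quadrant z -> killing s z <= K) ->
  (forall (s : R) (z : R * R), 0 <= s <= T -> quadrant z -> transport s z <= killing s z) ->
  pairing (fun z => B z * Q z) (m T) <=
  pairing (fun z => B z * Q (z.1, z.2 + T)) (m 0)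
  + lambda0 * \int[leb]_(s in `[0, T]) (B (0, 0) * Q (0, T - s)).
Proof.
move=> BQ1 kK tk; rewrite fluid_test.
set a := (X in _ - X + _); set b := (X in _ - _ + X).
suff : b <= a by lra.
have kfin s : 0 <= s <= T -> (\int[m s]_(z in quadrant) (killing s z)%:E < +oo)%E.
  move=> sT; apply: (@le_lt_trans _ _ (\int[m s]_(z in quadrant) (cst K%:E) z)%E).
    by apply: ge0_le_lower_integral => z zq; rewrite lee_fin; [exact: killing_ge0|exact: kK].
  rewrite integral_cst; last exact: measurable_quadrant.
  by rewrite ltey_eq fin_numM// fin_num_measure//; exact: measurable_quadrant.
apply: le_lower_Rintegral => [s _||s]; last first.
- rewrite /= in_itv/= => sT; apply: le_lower_Rintegral; last by move=> z; exact: tk.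
    by move=> z; exact: killing_ge0.
  exact: kfin.
(* Finiteness over time comes from the fourth clause of [fluid_solution]: since B Q <= 1, the
   killing term is at most the hazard. *)
- have [_ _ _ /(_ T T0) + _] := msol; apply: le_lt_trans.
  apply: ge0_le_lower_integral => s; rewrite /= in_itv/= => sT.
    by rewrite lee_fin; apply: Rintegral_ge0 => z; exact: killing_ge0.
  rewrite /pairing /Rintegral fineK; last first.
    rewrite ge0_fin_numE; first exact: kfin.
    by apply: integral_ge0 => z zq; rewrite lee_fin killing_ge0.
  apply: ge0_le_lower_integral => z zq; rewrite lee_fin; first exact: killing_ge0.
  rewrite -[leRHS]mul1r; apply: ler_wpM2r; first exact: hazard_ge0.
  exact: BQ1.
- by apply: Rintegral_ge0 => z; exact: killing_ge0.
Qed.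

End test.
End weak_formulation.

(** * Smooth cutoffs and localized tests *)

Section cutoffs.
Context {R : realType}.
Implicit Types (a b N u v : R).

Lemma C1_real_eq (k l k' l' : R -> R) : k =1 l -> k' =1 l' -> C1_real k k' -> C1_real l l'.
Proof. by move=> /funext -> /funext ->. Qed.

Lemma C1_realDc (k k' : R -> R) c : C1_real k k' -> C1_real (fun u => k u + c) k'.
Proof.
move=> ck; apply: C1_real_eq (C1_real_comp (C1_real_affine 1 c) ck) => u.
  by rewrite mul1r.
by rewrite mul1r.
Qed.

Lemma C1_sqp_affine a b :
  C1_real (fun u => sqp (a * u + b)) (fun u => 2 * Num.max (a * u + b) 0 * a).
Proof. exact: C1_real_comp C1_sqp (C1_real_affine a b). Qed.

(** This is (1 - u / N)_+^2. It decreases, so it turns supersolutions into supersolutions, and it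
    equals 1 at 0, so arrivals keep their weight. *)
Definition chi N u := sqp (- N^-1 * u + 1).
Definition dchi N u := 2 * Num.max (- N^-1 * u + 1) 0 * - N^-1.

Lemma C1_chi N : C1_real (chi N) (dchi N).
Proof. exact: C1_sqp_affine. Qed.

Lemma dchi_le0 N u : 0 < N -> dchi N u <= 0.
Proof.
move=> N0; rewrite /dchi mulrN oppr_le0 mulr_ge0//; last by rewrite invr_ge0 ltW.
by rewrite mulr_ge0// le_max lexx orbT.
Qed.

Lemma chi_neq0 N u : 0 < N -> chi N u != 0 = (u < N).
Proof.
move=> N0; rewrite /chi; have -> : - N^-1 * u + 1 = (N - u) / N by field; rewrite gt_eqF.
have [uN|Nu] := ltP u N.
  by rewrite gt_eqF// sqp_gt0// divr_gt0// subr_gt0.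
by rewrite sqp_eq0 ?eqxx// pmulr_lle0 ?invr_gt0// subr_le0.
Qed.

Lemma chi0 N : chi N 0 = 1.
Proof. by rewrite /chi mulr0 add0r sqpE// expr1n. Qed.

Lemma chi_le1 N u : 0 < N -> 0 <= u -> chi N u <= 1.
Proof.
move=> N0 u0; rewrite -(chi0 N); apply: le_sqp.
by rewrite lerD2r mulr0 mulNr oppr_le0 mulr_ge0// invr_ge0 ltW.
Qed.

Definition bump a b u := sqp (u - a) * sqp (b - u).

(** A C^1 approximation of the indicator of ]a, b[ from below: every index has the same positivity
    set, and the pointwise limit in n is 1 there. *)
Definition smooth_indic (n : nat) a b u := bump a b u / (bump a b u + n.+1%:R^-1).

Lemma bump_ge0 a b u : 0 <= bump a b u.
Proof. by rewrite mulr_ge0// sqp_ge0. Qed.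

Lemma bump_gt0 a b u : (0 < bump a b u) = (a < u < b).
Proof.
apply/idP/idP => [|/andP[au ub]]; last by rewrite mulr_gt0// sqp_gt0// subr_gt0.
apply: contraTT; rewrite negb_and -!leNgt /bump => /orP[ua|bu].
  by rewrite sqp_eq0 ?mul0r// subr_le0.
by rewrite (sqp_eq0 (u := b - u)) ?mulr0// subr_le0.
Qed.

Lemma bumpn_gt0 (n : nat) a b u : 0 < bump a b u + n.+1%:R^-1.
Proof. by rewrite ltr_wpDl// bump_ge0. Qed.

Lemma C1_smooth_indic n a b : exists k, C1_real (smooth_indic n a b) k.
Proof.
have cb : C1_real (bump a b) (fun u => 2 * Num.max (1 * u - a) 0 * 1 * sqp (-1 * u + b)
    + sqp (1 * u - a) * (2 * Num.max (-1 * u + b) 0 * -1)).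
  apply: C1_real_eq (C1_realM (C1_sqp_affine 1 (-a)) (C1_sqp_affine (-1) b)) => // u.
  by rewrite /bump mul1r mulN1r [- u + b]addrC.
eexists; apply: C1_realM cb (C1_realV _ (C1_realDc _ cb)).
by move=> u; rewrite gt_eqF// bumpn_gt0.
Qed.

Lemma smooth_indic_ge0 n a b u : 0 <= smooth_indic n a b u.
Proof. by rewrite divr_ge0// ?bump_ge0// ltW// bumpn_gt0. Qed.

Lemma smooth_indic_le1 n a b u : smooth_indic n a b u <= 1.
Proof. by rewrite ler_pdivrMr ?bumpn_gt0// mul1r lerDl. Qed.

Lemma smooth_indic_neq0 n a b u : smooth_indic n a b u != 0 = (a < u < b).
Proof.
rewrite mulf_eq0 invr_eq0 [X in _ || X]gt_eqF ?bumpn_gt0// orbF.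
by rewrite -bump_gt0 lt0r bump_ge0 andbT.
Qed.

Lemma cvg_smooth_indic a b u :
  smooth_indic n a b u @[n --> \oo] --> ((a < u < b)%R%:R : R).
Proof.
rewrite -bump_gt0 /smooth_indic; have [u0|] := ltrP 0 (bump a b u); last first.
  move=> u0; have -> : bump a b u = 0 by apply/eqP; rewrite eq_le u0 bump_ge0.
  by under eq_fun do rewrite mul0r; exact: cvg_cst.
have -> : true%:R = bump a b u / (bump a b u + 0) by rewrite addr0 divff// gt_eqF.
apply: cvgM; first exact: cvg_cst.
apply: cvgV; first by rewrite addr0 gt_eqF.
by apply: cvgD; [exact: cvg_cst|exact: cvg_harmonic].
Qed.

End cutoffs.

Section pairing_lemmas.
Context {R : realType}.
Implicit Types (mu : {finite_measure set (plane R) -> \bar R}) (F B : R * R -> R).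

Lemma compact_support_bounded B (N : R) : continuous (B \o clamp) ->
  (forall z, quadrant z -> B z != 0 -> z.1 <= N /\ z.2 <= N) ->
  exists K : R, forall z, quadrant z -> `|B z| <= K.
Proof.
move=> Bc BN; pose A : set (R * R) := `[0, N] `*` `[0, N].
have cA : compact A by apply: compact_setX; exact: segment_compact.
have /compact_bounded[M [_ /(_ (`|M| + 1))]] :=
  continuous_compact (continuous_subspaceT (A := A) Bc) cA.
have MM : M < `|M| + 1 by rewrite (le_lt_trans (ler_norm M))// ltrDl.
move=> /(_ MM) BM; exists (`|M| + 1) => z zq.
have [->|Bz] := eqVneq (B z) 0; first by rewrite normr0 addr_ge0.
apply: BM; exists z => /=; last by rewrite clamp_id.
have [z1 z2] := BN z zq Bz; have [z10 z20] := zq.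
by split; rewrite /= in_itv/= ?z10 ?z20.
Qed.

Lemma pairing_null_integrable (mu : {measure set (plane R) -> \bar R}) F :
  mu.-integrable quadrant (EFin \o F) ->
  (forall z, quadrant z -> 0 <= F z) -> pairing F mu <= 0 ->
  mu.-negligible [set z | quadrant z /\ F z != 0].
Proof.
move=> iF F0 pF; have mQ := @measurable_quadrant R.
have mF : measurable_fun (quadrant : set (plane R)) (EFin \o F) by case/integrableP : iF.
have pF0 : pairing F mu = 0.
  by apply/eqP; rewrite eq_le pF Rintegral_ge0.
have F00 : (\int[mu]_(z in quadrant) (F z)%:E = 0)%E.
  by rewrite -(fineK (integrable_fin_num mQ iF)); congr EFin.
have : ae_eq mu quadrant (EFin \o F) (cst 0%E).
  apply/ae_eq_integral_abs => //.
  rewrite -[RHS]F00; apply: eq_integral => z /set_mem /F0 F1.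
  by rewrite gee0_abs.
apply: negligibleS => z /= [zq Fz] /(_ zq) [] /eqP; exact/negP.
Qed.

Lemma pairing_null mu F (K : R) : continuous (F \o clamp) ->
  (forall z, quadrant z -> 0 <= F z <= K) -> pairing F mu <= 0 ->
  mu.-negligible [set z | quadrant z /\ F z != 0].
Proof.
move=> Fc F0K; have mQ := @measurable_quadrant R.
apply: pairing_null_integrable; last by move=> z /F0K /andP[].
apply: (@bounded_integrable _ _ _ mu _ F K) => //.
- by rewrite ltey_eq fin_num_measure.
- exact: measurable_on_quadrant.
- by move=> z /F0K /andP[F1 F2]; rewrite ger0_norm.
Qed.

End pairing_lemmas.

Section cutoff_tests.
Context {R : realType} (lambda0 : R) (g : R * R -> R).
Hypothesis gP : probability_density g.
Hypothesis SgC1 : C1_quadrant (Sg g).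
Variable m : R -> {finite_measure set (plane R) -> \bar R}.
Hypothesis msol : fluid_solution lambda0 g m.
Local Notation leb := (@lebesgue_measure R).

Section test.
Variables (B Bx By : R * R -> R) (N : R).
Hypothesis cB : C1_quad B Bx By.
Hypothesis BN : forall z, quadrant z -> B z != 0 -> z.1 <= N /\ z.2 <= N.
Variables (T a b : R) (T0 : 0 <= T) (bT : b <= T).
Variable Nu : R -> set (plane R).
Hypothesis mNu : forall s : R, 0 <= s <= T -> (m s).-negligible (Nu s).

Let BN' z : quadrant z -> B z != 0 -> z.1 <= Num.max N (- a) /\ z.2 <= Num.max N (- a).
Proof. by move=> zq /(BN zq)[z1 z2]; rewrite !le_max z1 z2. Qed.

Let QN' n (z : R * R) : smooth_indic n a b z.2 != 0 -> - Num.max N (- a) <= z.2.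
Proof.
rewrite smooth_indic_neq0 => /andP[az _].
by rewrite lerNl le_max orbC lerN2 ltW.
Qed.

(** A customer present at time 0 has age at least T at time T, hence at least b, outside the support
    of the cutoff. *)
Let initial0 n : pairing (fun z => B z * smooth_indic n a b (z.2 + T)) (m 0) = 0.
Proof.
rewrite /pairing (@eq_Rintegral _ _ _ _ _ (fun=> 0)).
  by rewrite Rintegral_cst ?mul0r//; exact: measurable_quadrant.
move=> z /set_mem[_ z2]; have [->|] := eqVneq (smooth_indic n a b (z.2 + T)) 0.
  by rewrite mulr0.
by rewrite smooth_indic_neq0 => /andP[_]; rewrite ltNge (le_trans bT)// lerDr.
Qed.

Lemma cutoff_test_eq n :
  (forall (s : R) (z : R * R), 0 <= s <= T -> quadrant z -> ~ Nu s z -> a < z.2 + (T - s) < b ->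
    rbar (m s) z.2 * Bx z + By z = B z * hazard g m s z) ->
  pairing (fun z => B z * smooth_indic n a b z.2) (m T) =
  lambda0 * \int[leb]_(s in `[0, T]) (B (0, 0) * smooth_indic n a b (T - s)).
Proof.
move=> BE; have [k ck] := C1_smooth_indic n a b.
have := fluid_test_eq msol cB (C1_strip_snd ck) BN' (@QN' n) T0 mNu.
rewrite initial0 add0r; apply => s z sT zq Nz.
rewrite /transport /killing/= mulr0 mulr0 addr0.
have [->|] := eqVneq (smooth_indic n a b (z.2 + (T - s))) 0.
  by rewrite mul0r mulr0 mul0r.
by rewrite smooth_indic_neq0 => ab; rewrite BE//; ring.
Qed.

Hypothesis B0 : forall z, quadrant z -> 0 <= B z.
Hypothesis Bdecr : forall (s : R) (z : R * R), 0 <= s <= T -> quadrant z -> ~ Nu s z ->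
  a < z.2 + (T - s) < b -> rbar (m s) z.2 * Bx z + By z <= 0.

Lemma cutoff_test_le n :
  pairing (fun z => B z * smooth_indic n a b z.2) (m T) <=
  lambda0 * \int[leb]_(s in `[0, T]) (B (0, 0) * smooth_indic n a b (T - s)).
Proof.
have [k ck] := C1_smooth_indic n a b.
have := fluid_test_le gP SgC1 msol cB (C1_strip_snd ck) BN' (@QN' n) T0 mNu B0.
rewrite initial0 add0r; apply => [z _|s z sT zq Nz]; first exact: smooth_indic_ge0.
rewrite /transport/= mulr0 mulr0 addr0.
have [->|] := eqVneq (smooth_indic n a b (z.2 + (T - s))) 0; first by rewrite mul0r.
by rewrite smooth_indic_neq0 => ab; rewrite mulr_ge0_le0 ?smooth_indic_ge0// Bdecr.
Qed.

(** Arrivals carry weight 0 and initial customers are cut off, so nothing feeds the weighted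
    mass. *)
Lemma cutoff_test_null : B (0, 0) = 0 ->
  (m T).-negligible [set z | [/\ quadrant z, B z != 0 & a < z.2 < b]].
Proof.
move=> B00; have [K BK] := compact_support_bounded (C1_quad_cont cB) BN.
(* Index 0 suffices: only the set where the cutoff is nonzero matters, and it is ]a, b[ for every
   index. *)
have [k ck] := C1_smooth_indic 0 a b.
have cBQ := C1_quad_cont (C1_quadM cB (C1_quad_snd ck)).
have : pairing (fun z => B z * smooth_indic 0 a b z.2) (m T) <= 0.
  apply: (le_trans (cutoff_test_le 0)); rewrite B00.
  under eq_Rintegral do rewrite mul0r.
  by rewrite Rintegral_cst ?mul0r ?mulr0.
move=> /(pairing_null cBQ (K := K)) H.
apply: negligibleS (H _) => [z /= [zq Bz ab]|z zq].
  by split=> //; rewrite mulf_neq0// smooth_indic_neq0.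
rewrite mulr_ge0 ?B0 ?smooth_indic_ge0//=.
rewrite -[leRHS]mulr1 ler_pM ?B0 ?smooth_indic_ge0 ?smooth_indic_le1//.
exact: le_trans (ler_norm _) (BK z zq).
Qed.

End test.
End cutoff_tests.

(** * Support of the young mass *)

Section support.
Context {R : realType} (lambda0 : R) (g : R * R -> R).
Hypothesis gP : probability_density g.
Hypothesis SgC1 : C1_quadrant (Sg g).
Variable m : R -> {finite_measure set (plane R) -> \bar R}.
Hypothesis msol : fluid_solution lambda0 g m.
Local Notation leb := (@lebesgue_measure R).

Lemma C1_quad_eq (F Fx Fy G Gx Gy : R * R -> R) :
  F =1 G -> Fx =1 Gx -> Fy =1 Gy -> C1_quad F Fx Fy -> C1_quad G Gx Gy.
Proof. by move=> /funext -> /funext -> /funext ->. Qed.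

Lemma C1_quad_affine (a b c : R) :
  C1_quad (fun z : R * R => a * z.1 + b * z.2 + c) (fun=> a) (fun=> b).
Proof.
apply: C1_quad_eq (C1_quadD (C1_quad_fst (C1_real_affine a 0))
  (C1_quad_snd (C1_real_affine b c))) => z; first by rewrite addr0 addrA.
  by rewrite addr0.
by rewrite add0r.
Qed.

Definition chi2 (N : R) (z : R * R) : R := chi N z.1 * chi N z.2.

Lemma C1_chi2 (N : R) : C1_quad (chi2 N) (fun z => dchi N z.1 * chi N z.2)
  (fun z => chi N z.1 * dchi N z.2).
Proof.
apply: C1_quad_eq (C1_quadM (C1_quad_fst (C1_chi N)) (C1_quad_snd (C1_chi N))) => z //.
  by rewrite mulr0 addr0.
by rewrite mul0r add0r.
Qed.

Lemma chi2_ge0 N z : 0 <= chi2 N z. Proof. by rewrite mulr_ge0 ?sqp_ge0. Qed.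

Lemma chi2_decr (N r : R) z : 0 < N -> 0 <= r ->
  r * (dchi N z.1 * chi N z.2) + chi N z.1 * dchi N z.2 <= 0.
Proof.
move=> N0 r0; rewrite -[leRHS]addr0; apply: lerD.
  by rewrite mulr_ge0_le0// mulr_le0_ge0 ?dchi_le0 ?sqp_ge0.
by rewrite mulr_ge0_le0 ?dchi_le0 ?sqp_ge0.
Qed.

Lemma chi2_neq0 (N : R) z : 0 < N -> chi2 N z != 0 = (z.1 < N) && (z.2 < N).
Proof. by move=> N0; rewrite mulf_eq0 negb_or !chi_neq0. Qed.

(** Compactness of the support is obtained by multiplying by [chi2], which decreases along every
    direction (r, 1) with r >= 0 and so preserves supersolutions; a countable union over its size
    recovers the whole quadrant. *)
Lemma supersolution_null (A Ax Ay : R * R -> R) (T b : R) (Nu : R -> set (plane R)) :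
  C1_quad A Ax Ay -> 0 <= T -> b <= T ->
  (forall s : R, 0 <= s <= T -> (m s).-negligible (Nu s)) ->
  (forall z, quadrant z -> 0 <= A z) -> A (0, 0) = 0 ->
  (forall (s : R) (z : R * R), 0 <= s <= T -> quadrant z -> ~ Nu s z -> z.2 + (T - s) < b ->
    rbar (m s) z.2 * Ax z + Ay z <= 0) ->
  (m T).-negligible [set z | [/\ quadrant z, A z != 0 & z.2 < b]].
Proof.
move=> cA T0 bT mNu A0 A00 Adecr.
pose N_ n : R := n.+1%:R.
have N0 n : 0 < N_ n by rewrite ltr0n.
pose B n z := A z * chi2 (N_ n) z.
(* The bound -1 imposes nothing on nonnegative ages and keeps age 0 inside the open interval. *)
have H n : (m T).-negligible [set z | [/\ quadrant z, B n z != 0 & -1 < z.2 < b]].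
  apply: (cutoff_test_null gP SgC1 msol (C1_quadM cA (C1_chi2 (N_ n))) (N := N_ n) _ T0 bT mNu).
  - move=> z zq; rewrite mulf_eq0 negb_or chi2_neq0// => /andP[_ /andP[? ?]].
    by split; exact: ltW.
  - by move=> z zq; rewrite mulr_ge0 ?A0 ?chi2_ge0.
  - move=> s z sT zq Nz /andP[_ zb].
    have -> : rbar (m s) z.2 * (Ax z * chi2 (N_ n) z + A z * (dchi (N_ n) z.1 * chi (N_ n) z.2))
        + (Ay z * chi2 (N_ n) z + A z * (chi (N_ n) z.1 * dchi (N_ n) z.2)) =
        (rbar (m s) z.2 * Ax z + Ay z) * chi2 (N_ n) z +
        A z * (rbar (m s) z.2 * (dchi (N_ n) z.1 * chi (N_ n) z.2) + chi (N_ n) z.1 * dchi (N_ n) z.2).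
      by ring.
    rewrite -[leRHS]addr0; apply: lerD; first by rewrite mulr_le0_ge0 ?chi2_ge0// Adecr.
    by rewrite mulr_ge0_le0 ?A0// chi2_decr// rbar_ge0.
  - by rewrite A00 mul0r.
apply: negligibleS (negligible_bigcup H) => z /= [zq Az zb].
have [n zn] : exists n, (z.1 < N_ n) && (z.2 < N_ n).
  have [M1 M2] := (truncnS_gt z.1, truncnS_gt z.2).
  exists (maxn (Num.truncn z.1) (Num.truncn z.2)).
  by apply/andP; split; [apply: lt_le_trans M1 _|apply: lt_le_trans M2 _];
    rewrite ler_nat ltnS ?leq_maxl ?leq_maxr.
exists n => //; split=> //; first by rewrite mulf_neq0// chi2_neq0.
by rewrite zb andbT (lt_le_trans _ zq.2)// ltrN10.
Qed.

(** The weight is (x - y)_+^2, whose derivative along (r, 1) is 2 (r - 1) (x - y)_+ <= 0: service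
    never runs faster than age. *)
Lemma null_service_gt_age T : 0 <= T ->
  (m T).-negligible [set z | [/\ quadrant z, z.2 < T & z.2 < z.1]].
Proof.
move=> T0; have cA := C1_quad_comp (@C1_sqp R) (C1_quad_affine 1 (-1) 0).
apply: negligibleS (supersolution_null cA T0 (lexx T) (Nu := fun=> set0) _ _ _ _).
- move=> z /= [zq zT zz]; split=> //.
  by rewrite gt_eqF// sqp_gt0// mul1r mulN1r addr0 subr_gt0.
- by move=> s _; exact: negligible_set0.
- by move=> z _; exact: sqp_ge0.
- by rewrite /= !mulr0 !addr0 sqp_eq0.
- move=> s z _ _ _ _; set w := 2 * Num.max _ 0.
  have -> : rbar (m s) z.2 * (w * 1) + w * -1 = (rbar (m s) z.2 - 1) * w by ring.
  by rewrite mulr_le0_ge0 ?subr_le0 ?rbar_le1// mulr_ge0// le_max lexx orbT.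
Qed.

(** The weight (x - y)^2 is constant along (1, 1), the direction of motion while r = 1. *)
Lemma null_off_diagonal T b : 0 <= T -> b <= T ->
  (forall (s : R) (z : R * R), 0 <= s <= T -> quadrant z -> z.2 + (T - s) < b -> rbar (m s) z.2 = 1) ->
  (m T).-negligible [set z | [/\ quadrant z, z.2 < b & z.1 != z.2]].
Proof.
move=> T0 bT r1; have c := C1_quad_affine 1 (-1) 0; have cA := C1_quadM c c.
apply: negligibleS (supersolution_null cA T0 bT (Nu := fun=> set0) _ _ _ _).
- move=> z /= [zq zT zz]; split=> //.
  by rewrite mul1r mulN1r addr0 mulf_neq0// subr_eq0.
- by move=> s _; exact: negligible_set0.
- by move=> z _; rewrite -expr2 sqr_ge0.
- by rewrite /= !mulr0 !addr0 mulr0.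
- by move=> s z sT zq _ /(r1 s z sT zq) ->; rewrite le_eqVlt; apply/orP; left; apply/eqP; ring.
Qed.

(** The weight is (x - k)_+^2, with derivative 2 r (x - k)_+. Where x > k, almost surely y >= x > k
    by [null_service_gt_age], and there r = 0. *)
Lemma null_service_gt T k : 0 <= T -> 0 <= k ->
  (forall (s : R) (z : R * R), 0 <= s <= T -> quadrant z -> k < z.2 < s -> rbar (m s) z.2 = 0) ->
  (m T).-negligible [set z | [/\ quadrant z, z.2 < T & k < z.1]].
Proof.
move=> T0 k0 r0; have cA := C1_quad_comp (@C1_sqp R) (C1_quad_affine 1 0 (-k)).
apply: negligibleS (supersolution_null cA T0 (lexx T)
  (Nu := fun s => [set z | [/\ quadrant z, z.2 < s & z.2 < z.1]]) _ _ _ _).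
- move=> z /= [zq zT zz]; split=> //.
  by rewrite gt_eqF// sqp_gt0// mul1r mul0r addr0 subr_gt0.
- by move=> s /andP[s0 _]; exact: null_service_gt_age.
- by move=> z _; exact: sqp_ge0.
- by rewrite /= !mulr0 !add0r sqp_eq0// oppr_le0.
- move=> s z sT zq Nz zs; rewrite mulr0 addr0 mulr1 mul1r mul0r addr0.
  have {}zs : z.2 < s by lra.
  have z12 : z.1 <= z.2 by rewrite leNgt; apply/negP => zz; apply: Nz.
  have [kz|zk] := ltP k z.2; first by rewrite r0 ?mul0r// kz zs.
  by rewrite max_r ?mulr0 ?subr_le0// (le_trans z12).
Qed.

(* In the weight [A n] the age factor is constant beyond age [k]; below [k] the mass
   sits on the diagonal, where the two factors are never both nonzero. *)
Lemma null_service_lt T k : 0 <= T ->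
  (forall s : R, 0 <= s <= T -> (m s).-negligible
     [set z | [/\ quadrant z, z.2 < k, z.2 < s & z.1 != z.2]]) ->
  (m T).-negligible [set z | [/\ quadrant z, z.2 < T, k <= z.2 & z.1 < k]].
Proof.
move=> T0 diag.
(* The weight [A n] is positive exactly where x < u n < y; letting [u n] increase to k exhausts the
   region x < k <= y. *)
pose u n : R := k - n.+1%:R^-1.
have uk n : u n < k by rewrite ltrBlDr ltrDl invr_gt0.
pose A n (z : R * R) : R := sqp (u n - z.1) * sqp ((k - u n) ^+ 2 - sqp (k - z.2)).
have H n : (m T).-negligible [set z | [/\ quadrant z, A n z != 0 & z.2 < T]].
  have c2 := C1_real_comp (C1_sqp_affine (-1) ((k - u n) ^+ 2)) (C1_sqp_affine (-1) k).
  have cA := C1_quadM (C1_quad_fst (C1_sqp_affine (-1) (u n))) (C1_quad_snd c2).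
  have AE z : A n z = sqp (-1 * z.1 + u n) * sqp (-1 * sqp (-1 * z.2 + k) + (k - u n) ^+ 2).
    by rewrite !mulN1r ![- _ + _]addrC.
  apply: negligibleS (supersolution_null cA T0 (lexx T) (Nu := fun s =>
    [set z | [/\ quadrant z, z.2 < k, z.2 < s & z.1 != z.2]]) _ _ _ _) => //.
  - by move=> z /= [zq Az zT]; split=> //; rewrite -AE.
  - by move=> z _; rewrite mulr_ge0// sqp_ge0.
  - rewrite /= !mulr0 !add0r; have [u0|u0] := leP (u n) 0; first by rewrite sqp_eq0 ?mul0r.
    rewrite (sqp_eq0 (u := -1 * _ + _)) ?mulr0// mulN1r addrC subr_le0 sqpE.
      by have := uk n; nra.
    by rewrite ltW// (lt_trans u0).
  - move=> s z sT zq Nz zs; have {}zs : z.2 < s by lra.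
    rewrite mulr0 addr0 mul0r add0r !mulN1r ![- _ + _]addrC.
    rewrite -[leRHS]addr0; apply: lerD.
      rewrite mulr_ge0_le0 ?rbar_ge0// mulr_le0_ge0 ?sqp_ge0// mulrN1 oppr_le0.
      by rewrite mulr_ge0// le_max lexx orbT.
    rewrite le_eqVlt; apply/orP; left; apply/eqP.
    have [kz|zk] := leP k z.2.
      by rewrite (max_r (x := k - z.2)) ?subr_le0// mulr0 mul0r !mulr0.
    have zz : z.1 = z.2 by apply/eqP; apply/negPn/negP => zz; exact: Nz.
    have [uz|zu] := leP (u n) z.1; first by rewrite sqp_eq0 ?mul0r// subr_le0.
    rewrite (max_r (x := (k - u n) ^+ 2 - _)) ?mulr0 ?mul0r ?mulr0// subr_le0 sqpE.
      rewrite -zz lerXn2r// ?nnegrE ?subr_ge0 ?lerD2l ?lerN2 ltW//.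
      exact: lt_trans (uk n).
    by rewrite subr_ge0 ltW.
apply: negligibleS (negligible_bigcup H) => z /= [zq zT kz zk].
have [n zn] : exists n, z.1 < u n.
  have e0 : 0 < k - z.1 by rewrite subr_gt0.
  have [n _ /(_ n (leqnn n)) /= ne] := near_infty_natSinv_lt (PosNum e0).
  by exists n; rewrite /u ltrBrDr addrC -ltrBrDr.
exists n => //; split=> //; rewrite mulf_neq0//.
  by rewrite gt_eqF// sqp_gt0// subr_gt0.
rewrite (sqp_eq0 (u := k - _)) ?subr_le0// subr0 gt_eqF// sqp_gt0// exprn_gt0//.
by rewrite subr_gt0.
Qed.

End support.

(** * Age distribution *)

Section age_distribution.
Context {R : realType} (lambda0 : R) (g : R * R -> R).
Hypothesis lambda0_gt0 : 0 < lambda0.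
Hypothesis gP : probability_density g.
Hypothesis SgC1 : C1_quadrant (Sg g).
Variable m : R -> {finite_measure set (plane R) -> \bar R}.
Hypothesis msol : fluid_solution lambda0 g m.
Local Notation leb := (@lebesgue_measure R).
Local Notation S := (Sg g).

(** An arrival at time s has age T - s at time T. The length of the set of arrival times is a
    parameter because the lower age is sometimes nonnegative, sometimes the artificial -1. *)
Lemma cvg_arrivals (a b T L : R) :
  leb (`[0, T] `&` `]T - b, T - a[) = L%:E ->
  \int[leb]_(s in `[0, T]) smooth_indic n a b (T - s) @[n --> \oo] --> L.
Proof.
move=> leL.
have -> : L = \int[leb]_(s in `[0, T]) (\1_(`]T - b, T - a[) s).
  rewrite /Rintegral integral_indic//; try exact: measurable_itv.
  by rewrite setIC; exact: (congr1 fine (esym leL)).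
apply: (@cvg_Rintegral _ _ _ leb _ _ _ (cst 1)) => //; try exact: measurable_itv.
- move=> n; have [k ck] := C1_smooth_indic n a b.
  apply: measurable_funTS; apply: continuous_measurable_fun => s.
  have := C1_real_comp ck (C1_real_affine (-1) T).
  move=> /C1_real_continuous /(_ s); congr (_ _); apply/funext => u.
  by rewrite mulN1r addrC.
- apply: (@bounded_integrable _ _ _ leb _ _ 1) => //; try exact: measurable_itv.
    rewrite /= lebesgue_measure_itv/=; case: ifP => // _; exact: ltry.
  by move=> s _; rewrite normr1.
- move=> s _; have := @cvg_smooth_indic _ a b (T - s); rewrite indicE mem_setE in_itv/=.
  have -> : (a < T - s < b) = (T - b < s < T - a) by apply/idP/idP => /andP[? ?]; apply/andP; split; lra.
  by [].
- by move=> n s _; rewrite ger0_norm ?smooth_indic_ge0// smooth_indic_le1.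
Qed.

Lemma arrivals_strip (a b T : R) : 0 <= a -> a <= b -> b <= T ->
  leb (`[0, T] `&` `]T - b, T - a[) = (b - a)%:E.
Proof.
move=> a0 ab bT; rewrite setIidr.
  rewrite lebesgue_measure_itv/= lte_fin ltrD2l ltrN2.
  case: ifPn => [_|]; first by rewrite -EFinD; congr EFin; ring.
  by rewrite -leNgt => ba; congr EFin; lra.
by move=> s; rewrite /= !in_itv/= => /andP[? ?]; apply/andP; split; lra.
Qed.

Lemma arrivals_below (b T : R) : 0 <= b -> b <= T ->
  leb (`[0, T] `&` `]T - b, T - -1[) = b%:E.
Proof.
move=> b0 bT; have -> : `[0, T] `&` `]T - b, T - -1[ = `]T - b, T]%classic :> set R.
  apply/seteqP; split=> s; rewrite /= !in_itv/=.
    by move=> [/andP[? ?] /andP[? ?]]; apply/andP; split; lra.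
  by move=> /andP[? ?]; split; apply/andP; split; lra.
rewrite lebesgue_measure_itv/= lte_fin ltrBlDr ltrDl.
case: ifPn => [_|]; first by rewrite -EFinD; congr EFin; ring.
by rewrite -leNgt => ba; congr EFin; lra.
Qed.

(** Half-open in age, so that adjacent strips add up exactly. *)
Definition strip (a b : R) : set (plane R) := quadrant `&` [set z | a <= z.2 < b].

Lemma measurable_strip a b : measurable (strip a b).
Proof.
apply: measurableI; first exact: measurable_quadrant.
have -> : [set z : plane R | a <= z.2 < b] = setT `*` `[a, b[.
  by apply/seteqP; split=> -[x y] /=; rewrite in_itv//=; case.
by apply: measurableX => //; exact: measurable_itv.
Qed.

Definition strip_mass T a b : R := fine (m T (strip a b)).

Lemma strip_mass_EFin T a b : (strip_mass T a b)%:E = m T (strip a b).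
Proof. by rewrite fineK// fin_num_measure//; exact: measurable_strip. Qed.

Lemma strip_mass_ge0 T a b : 0 <= strip_mass T a b.
Proof. exact: fine_ge0. Qed.

Lemma strip_massD T a b c : a <= b -> b <= c ->
  strip_mass T a c = strip_mass T a b + strip_mass T b c.
Proof.
move=> ab bc; apply: EFin_inj; rewrite EFinD !strip_mass_EFin -measureU; first last.
- apply/seteqP; split=> // z [[_ /= /andP[_ zb]] [_ /= /andP[bz _]]].
  by move: (lt_le_trans zb bz); rewrite ltxx.
- exact: measurable_strip.
- exact: measurable_strip.
congr (m T _); apply/seteqP; split=> [z [zq /= /andP[az zc]]|z].
  have [zb|bz] := ltP z.2 b; [left|right]; split=> //=; first by rewrite az zb.
  by rewrite bz zc.
move=> [] [zq /= /andP[h1 h2]]; split=> //=.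
  by rewrite h1 (lt_le_trans h2).
by rewrite h2 (le_trans ab).
Qed.

Lemma null_age T a : 0 <= T -> (m T).-negligible [set z | quadrant z /\ z.2 = a].
Proof.
move=> T0; have [_ _ + _ _] := msol => /(_ T T0 [set a] (measurable_set1 a) (lebesgue_measure_set1 a)) H.
exists (`[0, +oo[ `*` [set a]); split=> //.
  by apply: measurableX; [exact: measurable_itv|exact: measurable_set1].
by move=> z /= [[z1 _] z2]; split=> //=; rewrite in_itv/= z1.
Qed.

Lemma strip_massE T a b : strip_mass T a b =
  \int[m T]_(z in quadrant) (a <= z.2 < b)%R%:R.
Proof.
have -> : \int[m T]_(z in quadrant) (a <= z.2 < b)%R%:R =
    \int[m T]_(z in quadrant) (\1_(strip a b) z).
  apply: eq_Rintegral => z zq; rewrite indicE; congr (nat_of_bool _)%:R.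
  by apply/idP/idP => [zab|/set_mem[]//]; apply/mem_set; split=> //; exact/set_mem.
rewrite /Rintegral integral_indic; [|exact: measurable_quadrant|exact: measurable_strip].
by rewrite setIidl// => z [].
Qed.

Lemma cvg_chi2 z : chi2 n.+1%:R z @[n --> \oo] --> (1 : R).
Proof.
have chi_cvg (u : R) : chi n.+1%:R u @[n --> \oo] --> (1 : R).
  rewrite -[X in _ --> X](@chi0 R 1) /chi.
  apply: continuous_cvg; first exact: C1_real_continuous (@C1_sqp R) _.
  apply: cvgD; last exact: cvg_cst.
  rewrite mulr0 -(mul0r u) -oppr0; apply: cvgMl => //; apply: cvgN; exact: cvg_harmonic.
by rewrite -[X in _ --> X]mulr1; apply: cvgM; exact: chi_cvg.
Qed.

(** With the weight [chi2], killing and cutoff only lose mass, so an age range holds at most its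
    arrivals, which come at rate [lambda0]. *)
Lemma strip_mass_le T a b : 0 <= T -> 0 <= a -> a <= b -> b <= T ->
  strip_mass T a b <= lambda0 * (b - a).
Proof.
move=> T0 a0 ab bT.
have mQ := @measurable_quadrant R.
have L n : pairing (fun z => chi2 n.+1%:R z * smooth_indic n a b z.2) (m T) <=
    lambda0 * \int[leb]_(s in `[0, T]) smooth_indic n a b (T - s).
  have -> : \int[leb]_(s in `[0, T]) smooth_indic n a b (T - s) =
      \int[leb]_(s in `[0, T]) (chi2 n.+1%:R (0, 0) * smooth_indic n a b (T - s)).
    by apply: eq_Rintegral => s _; rewrite /chi2/= chi0 !mul1r.
  apply: (cutoff_test_le gP SgC1 msol (C1_chi2 n.+1%:R) (N := n.+1%:R) _ T0 bT (Nu := fun=> set0)).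
  - by move=> z zq; rewrite chi2_neq0// => /andP[? ?]; split; exact: ltW.
  - by move=> s _; exact: negligible_set0.
  - by move=> z _; exact: chi2_ge0.
  - by move=> s z _ _ _ _; apply: chi2_decr => //; exact: rbar_ge0.
have CR : lambda0 * \int[leb]_(s in `[0, T]) smooth_indic n a b (T - s) @[n --> \oo] -->
    lambda0 * (b - a).
  apply: cvgM; first exact: cvg_cst.
  exact: cvg_arrivals (arrivals_strip a0 ab bT).
suff CL : pairing (fun z => chi2 n.+1%:R z * smooth_indic n a b z.2) (m T) @[n --> \oo] -->
    strip_mass T a b by exact: ler_cvg_to CL CR (nearW _ L).
rewrite strip_massE.
(* The cutoffs converge to the indicator of the open interval; the age a is negligible by absolute
   continuity of the age marginal. *)
have [M [mM M0 aM]] := null_age a T0.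
rewrite (@eq_Rintegral_null _ _ _ (m T) _ M _ (fun z => (a < z.2 < b)%R%:R) mM M0); last first.
  move=> z zq Mz; congr (nat_of_bool (_ && _))%:R; rewrite le_eqVlt.
  by have [za|//] := eqVneq a z.2; case: Mz; apply: aM.
apply: (@cvg_Rintegral _ _ _ (m T) _ _ _ (cst 1)) => //.
- move=> n; have [k ck] := C1_smooth_indic n a b.
  exact: measurable_on_quadrant (C1_quad_cont (C1_quadM (C1_chi2 n.+1%:R) (C1_quad_snd ck))).
- apply: (@bounded_integrable _ _ _ (m T) _ _ 1) => //.
    by rewrite ltey_eq fin_num_measure.
  by move=> z _; rewrite normr1.
- by move=> z _; rewrite -[X in _ --> X]mul1r; apply: cvgM; [exact: cvg_chi2|exact: cvg_smooth_indic].
- move=> n z [z1 z2]; rewrite ger0_norm; last by apply: mulr_ge0; [exact: chi2_ge0|exact: smooth_indic_ge0].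
  apply: mulr_ile1; rewrite ?chi2_ge0 ?smooth_indic_ge0 ?smooth_indic_le1//.
  by apply: mulr_ile1; rewrite ?sqp_ge0 ?chi_le1.
Qed.

End age_distribution.

Section plateau.
Context {R : realType}.

(* Equal to 1 up to [X] and to 0 beyond [X + 1]. *)
Definition plateau (X u : R) := sqp (-1 * sqp (1 * u + - X) + 1).
Definition dplateau (X u : R) : R := 2 * Num.max (-1 * sqp (1 * u + - X) + 1) 0 * -1 *
  (2 * Num.max (1 * u + - X) 0 * 1).

Lemma C1_plateau X : C1_real (plateau X) (dplateau X).
Proof. exact: C1_real_comp (C1_sqp_affine (-1) 1) (C1_sqp_affine 1 (- X)). Qed.

Lemma plateau1 (X u : R) : u <= X -> plateau X u = 1.
Proof.
by move=> uX; rewrite /plateau [X in -1 * X]sqp_eq0 ?mulr0 ?add0r ?sqpE ?expr1n// mul1r subr_le0.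
Qed.

Lemma dplateau0 (X u : R) : u <= X -> dplateau X u = 0.
Proof.
by move=> uX; rewrite /dplateau (max_r (x := 1 * u + - X)) ?mulr0 ?mul0r ?mulr0// mul1r subr_le0.
Qed.

Lemma plateau_neq0 (X u : R) : plateau X u != 0 -> u <= X + 1.
Proof.
apply: contraNT; rewrite -ltNge => Xu; apply/eqP/sqp_eq0.
rewrite mulN1r addrC subr_le0 mul1r sqpE; last by lra.
by rewrite -(expr1n R 2) lerXn2r ?nnegrE//; lra.
Qed.

Lemma plateau_ge0 (X u : R) : 0 <= plateau X u. Proof. exact: sqp_ge0. Qed.

(* Telescoping over [n] equal steps leaves an error [L * (t / n) * (sigma 0 - sigma t)]. *)
Lemma flat_of_monotone_bound (F sigma : R -> R) (L t : R) : 0 <= t -> 0 <= L ->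
  (forall a b, 0 <= a -> a <= b -> b <= t -> `|F b - F a| <= L * (b - a) * (sigma a - sigma b)) ->
  F t = F 0.
Proof.
move=> t0 L0 FL; apply/eqP; rewrite -subr_eq0 -normr_le0; apply/ler_addgt0Pr => e e0.
have [n nP] : exists n : nat, L * t * (sigma 0 - sigma t) / n.+1%:R < e.
  have [n _ /(_ n (leqnn n)) nP] := near_infty_natSinv_lt
    (PosNum (divr_gt0 e0 (ltr_pwDr ltr01 (normr_ge0 (L * t * (sigma 0 - sigma t)))))).
  exists n; move: nP; rewrite /= ltr_pdivlMr ?ltr_pwDr// => nP.
  apply: le_lt_trans nP; rewrite mulrC ler_wpM2l ?invr_ge0//.
  by rewrite (le_trans (ler_norm _))// lerDl.
rewrite add0r; apply: le_trans (ltW nP).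
have h0 : 0 <= t / n.+1%:R by rewrite divr_ge0.
have step i : (i <= n.+1)%N ->
    `|F (i%:R * (t / n.+1%:R)) - F 0| <= L * (t / n.+1%:R) * (sigma 0 - sigma (i%:R * (t / n.+1%:R))).
  elim: i => [_|i IH iN]; first by rewrite mul0r !subrr normr0 mulr0.
  set h := t / n.+1%:R in h0 IH *.
  have -> : F (i.+1%:R * h) - F 0 = (F (i.+1%:R * h) - F (i%:R * h)) + (F (i%:R * h) - F 0).
    by ring.
  apply: le_trans (ler_normD _ _) _.
  have -> : sigma 0 - sigma (i.+1%:R * h) = (sigma (i%:R * h) - sigma (i.+1%:R * h)) +
     (sigma 0 - sigma (i%:R * h)) by ring.
  rewrite [leRHS]mulrDr; apply: lerD; last by apply: IH; exact: ltnW.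
  have := FL (i%:R * h) (i.+1%:R * h).
  have -> : i.+1%:R * h - i%:R * h = h by rewrite -natr1; ring.
  apply; first by rewrite mulr_ge0.
    by rewrite ler_wpM2r// ler_nat.
  rewrite /h mulrA ler_pdivrMr// mulrC ler_wpM2l// ler_nat//.
have := step n.+1 (leqnn _); rewrite mulrCA divff ?pnatr_eq0// mulr1.
by rewrite !mulrA -!(mulrAC _ _ n.+1%:R^-1).
Qed.

End plateau.

Section exact_age_distribution.
Context {R : realType} (lambda0 : R) (g : R * R -> R).
Hypothesis lambda0_gt0 : 0 < lambda0.
Hypothesis gP : probability_density g.
Hypothesis SgC1 : C1_quadrant (Sg g).
Variable m : R -> {finite_measure set (plane R) -> \bar R}.
Hypothesis msol : fluid_solution lambda0 g m.
Local Notation leb := (@lebesgue_measure R).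
Local Notation S := (Sg g).

(* Equal to [1 / S] where [c <= S z], and of class C^1 even where [S] vanishes. *)
Definition invS (c : R) (z : R * R) : R := (S z + sqp (-1 * S z + c))^-1.

Lemma invS_den_gt0 c z : 0 < c -> quadrant z -> 0 < S z + sqp (-1 * S z + c).
Proof.
move=> c0 zq; have := Sg_ge0 gP zq; rewrite le_eqVlt => /predU1P[<-|Sz].
  by rewrite add0r mulr0 add0r sqp_gt0.
by rewrite ltr_wpDr// sqp_ge0.
Qed.

Lemma C1_invS c : 0 < c -> C1_quad (invS c)
  (fun z => - (Sx g z + 2 * Num.max (-1 * S z + c) 0 * -1 * Sx g z) / (S z + sqp (-1 * S z + c)) ^+ 2)
  (fun z => - (Sy g z + 2 * Num.max (-1 * S z + c) 0 * -1 * Sy g z) / (S z + sqp (-1 * S z + c)) ^+ 2).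
Proof.
move=> c0; have cS := C1_quad_Sg SgC1.
apply: C1_quadV (C1_quadD cS (C1_quad_comp (C1_sqp_affine (-1) c) cS)) => z zq.
by rewrite gt_eqF// invS_den_gt0.
Qed.

Lemma invSE c z : c <= S z -> invS c z = (S z)^-1.
Proof. by move=> cS; rewrite /invS sqp_eq0 ?addr0// mulN1r addrC subr_le0. Qed.

Section exact_below.
Variables (X Y T : R).
Hypotheses (X0 : 0 <= X) (Y0 : 0 <= Y) (YT : Y <= T) (SXY : 0 < S (X, Y)).
Hypothesis null_right : forall s : R, 0 <= s <= T ->
  (m s).-negligible [set z | [/\ quadrant z, z.2 < Y, z.2 < s & X < z.1]].

(** An identity is wanted here, so the strictly decreasing [chi2] will not do: [plateau] has zero
    derivative on the region that carries the mass. *)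
Definition exact_weight (z : R * R) : R :=
  plateau X z.1 * plateau Y z.2 * invS (S (X, Y)) z.

Lemma exact_weight_cont : continuous (exact_weight \o clamp).
Proof.
exact: C1_quad_cont (C1_quadM (C1_quadM (C1_quad_fst (C1_plateau X))
  (C1_quad_snd (C1_plateau Y))) (C1_invS SXY)).
Qed.

Lemma exact_weight_supp z : quadrant z -> exact_weight z != 0 ->
  z.1 <= Num.max X Y + 1 /\ z.2 <= Num.max X Y + 1.
Proof.
move=> zq; rewrite 2!mulf_eq0 2!negb_or => /andP[/andP[/plateau_neq0 z1 /plateau_neq0 z2] _].
by split; [apply: le_trans z1 _|apply: le_trans z2 _]; rewrite lerD2r le_max lexx ?orbT.
Qed.

Lemma exact_weight_bounded : exists K : R, forall z, quadrant z -> `|exact_weight z| <= K.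
Proof. exact: compact_support_bounded exact_weight_cont exact_weight_supp. Qed.

Lemma exact_weightE z : quadrant z -> z.1 <= X -> z.2 <= Y -> exact_weight z = (S z)^-1.
Proof.
by move=> zq zX zY; rewrite /exact_weight !plateau1// !mul1r invSE// le_Sg.
Qed.

(** On the support the weight is 1/S, whose growth along the motion exactly compensates killing;
    hence the weighted mass is the mass of the arrivals, each entering with weight 1/S(0,0) = 1. *)
Lemma exact_below (b : R) : 0 <= b -> b <= Y ->
  \int[m T]_(z in quadrant) (exact_weight z * (z.2 < b)%R%:R) = lambda0 * b.
Proof.
move=> b0 bY; have T0 : 0 <= T by exact: le_trans YT.
have mQ := @measurable_quadrant R.
have cB := C1_quadM (C1_quadM (C1_quad_fst (C1_plateau X))
  (C1_quad_snd (C1_plateau Y))) (C1_invS SXY).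
have z00 : quadrant ((0, 0) : R * R) by split.
have L n : pairing (fun z => exact_weight z * smooth_indic n (-1) b z.2) (m T) =
    lambda0 * \int[leb]_(s in `[0, T]) smooth_indic n (-1) b (T - s).
  have -> : \int[leb]_(s in `[0, T]) smooth_indic n (-1) b (T - s) =
      \int[leb]_(s in `[0, T]) (exact_weight (0, 0) * smooth_indic n (-1) b (T - s)).
    by apply: eq_Rintegral => s _; rewrite exact_weightE//= Sg00// invr1 mul1r.
  apply: (cutoff_test_eq msol cB exact_weight_supp T0 (le_trans bY YT) null_right)
    => s z /andP[s0 sT] zq Nz /andP[_ zb].
  have zT := lt_le_trans zb (le_trans bY YT).
  have zs : z.2 < s by rewrite -(ltrD2r (T - s)) [ltRHS]addrC subrK.
  have zY : z.2 < Y by apply: le_lt_trans (lt_le_trans zb bY); rewrite lerDl subr_ge0.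
  have zX : z.1 <= X by rewrite leNgt; apply/negP => Xz; apply: Nz.
  have Sz : S (X, Y) <= S z by apply: le_Sg => //=; exact: ltW.
  have Sz0 : 0 < S z by exact: lt_le_trans SXY Sz.
  have zY' := ltW zY.
  (* The plateaus are flat and the correction in [invS] vanishes with its derivative, which leaves
     the definition of the hazard rates. *)
  rewrite !plateau1// !dplateau0// /hazard hxE// hyE// invSE//.
  rewrite max_r ?sqp_eq0; [|by rewrite mulN1r addrC subr_le0..].
  by field; rewrite gt_eqF.
have CR : lambda0 * \int[leb]_(s in `[0, T]) smooth_indic n (-1) b (T - s) @[n --> \oo] -->
    lambda0 * b.
  apply: cvgM; first exact: cvg_cst.
  by apply: cvg_arrivals; apply: arrivals_below => //; exact: le_trans YT.
suff CL : pairing (fun z => exact_weight z * smooth_indic n (-1) b z.2) (m T) @[n --> \oo] -->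
    \int[m T]_(z in quadrant) (exact_weight z * (z.2 < b)%R%:R).
  by move: CL; under eq_fun do rewrite L; move=> CL; exact: (cvg_unique _ CL CR).
have [K BK] := exact_weight_bounded.
apply: (@cvg_Rintegral _ _ _ (m T) _ _ _ (cst K)) => //.
- move=> n; have [k ck] := C1_smooth_indic n (-1) b.
  exact: measurable_on_quadrant (C1_quad_cont (C1_quadM cB (C1_quad_snd ck))).
- apply: (@bounded_integrable _ _ _ (m T) _ _ `|K|) => //.
  by rewrite ltey_eq fin_num_measure.
- move=> z [_ z2]; apply: cvgM; first exact: cvg_cst.
  have := @cvg_smooth_indic _ (-1) b z.2.
  by rewrite (lt_le_trans _ z2) ?ltrN10.
- move=> n z zq; rewrite normrM [X in _ * X]ger0_norm ?smooth_indic_ge0//.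
  rewrite -[leRHS]mulr1 ler_pM ?smooth_indic_ge0 ?smooth_indic_le1 ?BK//.
Qed.

End exact_below.
End exact_age_distribution.

Section survival_profile.
Context {R : realType} (g : R * R -> R).
Hypothesis gP : probability_density g.
Hypothesis SgC1 : C1_quadrant (Sg g).
Local Notation leb := (@lebesgue_measure R).
Local Notation S := (Sg g).

(* Survival probability at age [u] of a customer whose service stopped at age [k]. *)
Definition profile (k u : R) : R := S (Num.min u k, u).

Variable k : R.
Hypothesis k0 : 0 <= k.

Lemma quadrant_profile (u : R) : 0 <= u -> quadrant (Num.min u k, u).
Proof. by move=> u0; split=> //=; rewrite le_min u0. Qed.

Lemma profile_ge0 u : 0 <= u -> 0 <= profile k u.
Proof. by move=> u0; apply: Sg_ge0 => //; exact: quadrant_profile. Qed.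

Lemma profile_le1 u : 0 <= u -> profile k u <= 1.
Proof. by move=> u0; apply: Sg_le1 => //; exact: quadrant_profile. Qed.

Lemma le_profile (a b : R) : 0 <= a -> a <= b -> profile k b <= profile k a.
Proof.
move=> a0 ab; apply: le_Sg => //; first exact: quadrant_profile.
by rewrite /= le_min !ge_min ab lexx orbT.
Qed.

Lemma profile0 : profile k 0 = 1.
Proof. by rewrite /profile min_l// Sg00. Qed.

Lemma measurable_profile (D : set (measurableTypeR R)) : D `<=` `[0, +oo[ ->
  measurable_fun D (profile k).
Proof.
move=> D0; pose f (u : R) := (S \o clamp) (Num.min u k, u).
have fc : continuous f.
  move=> u; apply: (@continuous_cvg _ _ _ _ _ (fun u => (Num.min u k, u)) (S \o clamp)).
    exact: C1_quad_cont (C1_quad_Sg SgC1) _.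
  have c1 : Num.min v k @[v --> u] --> Num.min u k.
    by apply: continuous_min; [exact: cvg_id|exact: cvg_cst].
  have c2 : v @[v --> u] --> u by exact: cvg_id.
  exact: cvg_pair c1 c2.
apply: (measurable_funS _ D0); first exact: measurable_itv.
apply: (eq_measurable_fun f); last by apply: measurable_funTS; exact: continuous_measurable_fun.
move=> u /set_mem; rewrite /= in_itv/= andbT => u0.
by rewrite /f /= clamp_id//; exact: quadrant_profile.
Qed.

Lemma integrable_profile (D : set (measurableTypeR R)) : measurable D -> (leb D < +oo)%E ->
  D `<=` `[0, +oo[ -> leb.-integrable D (EFin \o profile k).
Proof.
move=> mD Dfin D0; apply: (@bounded_integrable _ _ _ leb _ _ 1) => //.
  exact: measurable_profile.
move=> u /D0; rewrite /= in_itv/= andbT => u0.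
by rewrite ger0_norm ?profile_ge0// profile_le1.
Qed.

Definition profile_int (t : R) : R := \int[leb]_(u in `[0, t]) profile k u.

Lemma leb_itv_fin (b1 b2 : bool) (x y : R) :
  (leb [set` Interval (BSide b1 x) (BSide b2 y)] < +oo)%E.
Proof. by rewrite lebesgue_measure_itv/=; case: ifP => // _; exact: ltry. Qed.

Lemma profile_int0 : profile_int 0 = 0.
Proof. by rewrite /profile_int set_itv1 Rintegral_set1. Qed.

Lemma profile_intB (a b : R) : 0 <= a -> a <= b ->
  profile_int b - profile_int a = \int[leb]_(u in `]a, b]) profile k u.
Proof.
move=> a0 ab; rewrite /profile_int.
have -> : `[0, b]%classic = `[0, a] `|` `]a, b] :> set R.
  apply/seteqP; split=> u; rewrite /= !in_itv/=.
    by move=> /andP[u0 ub]; have [ua|au] := leP u a; [left|right]; rewrite ?u0//.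
  by move=> [/andP[? ?]|/andP[? ?]]; apply/andP; split; lra.
rewrite Rintegral_setU; try exact: measurable_itv.
- by rewrite addrAC subrr add0r.
- have -> : `[0, a] `|` `]a, b] = `[0, b]%classic :> set R.
    apply/seteqP; split=> u; rewrite /= !in_itv/=; last first.
      by move=> /andP[u0 ub]; have [ua|au] := leP u a; [left|right]; rewrite ?u0//.
    by move=> [/andP[? ?]|/andP[? ?]]; apply/andP; split; lra.
  apply: integrable_profile; [exact: measurable_itv|exact: leb_itv_fin|].
  by move=> u; rewrite /= !in_itv/= => /andP[-> _].
- apply/disj_setPS => u [/=]; rewrite !in_itv/= => /andP[_ ua] /andP[au _].
  by move: (lt_le_trans au ua); rewrite ltxx.
Qed.

Lemma profile_int_bounds (a b : R) : 0 <= a -> a <= b ->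
  (b - a) * profile k b <= profile_int b - profile_int a <= (b - a) * profile k a.
Proof.
move=> a0 ab; rewrite profile_intB//.
have mI : measurable (`]a, b]%classic : set R) by exact: measurable_itv.
have ci c : leb.-integrable `]a, b] (EFin \o cst c).
  apply: (@bounded_integrable _ _ _ leb _ _ `|c|) => //; exact: leb_itv_fin.
have ip : leb.-integrable `]a, b] (EFin \o profile k).
  apply: integrable_profile => //; first exact: leb_itv_fin.
  by move=> u; rewrite /= !in_itv/= andbT => /andP[au _]; rewrite (le_trans a0)// ltW.
have lE : fine (leb `]a, b]) = b - a.
  rewrite lebesgue_measure_itv/= lte_fin; case: ifPn => // ba.
  by apply/esym/eqP; rewrite subr_eq0 eq_le ab andbT leNgt.
have cE c : (b - a) * c = \int[leb]_(u in `]a, b]) cst c u.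
  by rewrite Rintegral_cst// lE mulrC.
apply/andP; split.
  rewrite cE; apply: le_Rintegral => // u.
  by rewrite /= in_itv/= => /andP[au ub]; apply: le_profile => //; lra.
rewrite cE; apply: le_Rintegral => // u.
by rewrite /= in_itv/= => /andP[au ub]; apply: le_profile => //; lra.
Qed.

End survival_profile.

Section age_profile.
Context {R : realType} (lambda0 : R) (g : R * R -> R).
Hypothesis lambda0_gt0 : 0 < lambda0.
Hypothesis gP : probability_density g.
Hypothesis SgC1 : C1_quadrant (Sg g).
Variable m : R -> {finite_measure set (plane R) -> \bar R}.
Hypothesis msol : fluid_solution lambda0 g m.
Local Notation leb := (@lebesgue_measure R).
Local Notation S := (Sg g).

Variables (k Y0 T : R).
Hypotheses (k0 : 0 <= k) (Y00 : 0 <= Y0) (YT : Y0 <= T).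
Hypothesis supp : forall s : R, 0 <= s <= T -> (m s).-negligible
  [set z | [/\ quadrant z, z.2 < Y0, z.2 < s & z.1 != Num.min z.2 k]].

Let T0 : 0 <= T. Proof. exact: le_trans YT. Qed.

Let suppT b : b <= Y0 -> (m T).-negligible
  [set z | [/\ quadrant z, z.2 < b & z.1 != Num.min z.2 k]].
Proof.
move=> bY; apply: negligibleS (supp _); last by rewrite T0 lexx.
move=> z /= [zq zb zk]; split=> //; first exact: lt_le_trans zb bY.
exact: lt_le_trans zb (le_trans bY YT).
Qed.

(** Subtracting [exact_below] at a from the same identity at b gives the weighted mass of the strip;
    on the curve x = min (y, k), S lies there between its two end values. *)
Lemma strip_mass_bounds (a b : R) : 0 <= a -> a <= b -> b <= Y0 -> 0 < profile g k b ->
  lambda0 * (b - a) * profile g k b <= strip_mass m T a b <= lambda0 * (b - a) * profile g k a.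
Proof.
move=> a0 ab bY sb; have b0 := le_trans a0 ab.
have mQ := @measurable_quadrant R.
have X0 : 0 <= Num.min b k by rewrite le_min b0.
have bT : b <= T by exact: le_trans YT.
have nr : forall s : R, 0 <= s <= T ->
    (m s).-negligible [set z | [/\ quadrant z, z.2 < b, z.2 < s & Num.min b k < z.1]].
  move=> s sT; apply: negligibleS (supp sT) => z /= [zq zb zs zX]; split=> //.
    exact: lt_le_trans zb bY.
  rewrite gt_eqF// (le_lt_trans _ zX)// le_min !ge_min (ltW zb) lexx !orbT//.
(* One weight, adapted to the upper end b, serves both levels, so that the two identities can be
   subtracted. *)
pose W := exact_weight g (Num.min b k) b.
have Wb : \int[m T]_(z in quadrant) (W z * (z.2 < b)%R%:R) = lambda0 * b.
  exact: (exact_below gP SgC1 msol X0 b0 bT sb nr).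
have Wa : \int[m T]_(z in quadrant) (W z * (z.2 < a)%R%:R) = lambda0 * a.
  exact: (exact_below gP SgC1 msol X0 b0 bT sb nr).
have [K WK] := exact_weight_bounded gP SgC1 sb.
have mI (c : R) : measurable_fun (quadrant : set (plane R)) (fun z : plane R => (z.2 < c)%R%:R : R).
  have -> : (fun z : plane R => (z.2 < c)%R%:R : R) = \1_(setT `*` `]-oo, c[).
    apply/funext => z; rewrite indicE; congr (nat_of_bool _)%:R.
    by apply/idP/idP => [zc|/set_mem[_ /=]]; [apply/mem_set; split=> //=|]; rewrite in_itv.
  by apply: measurable_funTS; apply: measurable_indic; apply: measurableX => //; exact: measurable_itv.
have mW : measurable_fun (quadrant : set (plane R)) W.
  exact: measurable_on_quadrant (exact_weight_cont gP SgC1 sb).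
have iW (c : R) : (m T).-integrable quadrant (EFin \o (fun z => W z * (z.2 < c)%R%:R)).
  apply: (@bounded_integrable _ _ _ (m T) _ _ `|K|) => //.
  - by rewrite ltey_eq fin_num_measure.
  - exact: measurable_funM.
  - move=> z zq; rewrite normrM -[leRHS]mulr1 ler_pM//; last by case: (_ < _); rewrite ?normr1 ?normr0.
    exact: le_trans (WK z zq) (ler_norm _).
pose I (z : R * R) : R := (a <= z.2 < b)%R%:R.
have IE z : I z = (z.2 < b)%R%:R - (z.2 < a)%R%:R.
  rewrite /I; have [az|za] := leP a z.2; first by rewrite subr0.
  by rewrite (lt_le_trans za ab) subrr.
have WI : \int[m T]_(z in quadrant) (W z * I z) = lambda0 * (b - a).
  rewrite mulrBr -Wb -Wa -RintegralB//; apply: eq_Rintegral => z _.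
  by rewrite IE mulrBr.
have iI : (m T).-integrable quadrant (EFin \o I).
  apply: (@bounded_integrable _ _ _ (m T) _ _ 1) => //.
  - by rewrite ltey_eq fin_num_measure.
  - have -> : I = (fun z : plane R => (z.2 < b)%R%:R - (z.2 < a)%R%:R).
      by apply/funext => z; exact: IE.
    exact: measurable_funB.
  - by move=> z _; rewrite /I; case: (_ && _); rewrite ?normr1 ?normr0.
have iWI : (m T).-integrable quadrant (EFin \o (fun z => W z * I z)).
  have := integrableB mQ (iW b) (iW a); apply: eq_integrable => // z _ /=.
  by rewrite IE mulrBr EFinB.
have iZ c : (m T).-integrable quadrant (EFin \o (fun z => c * (W z * I z))).
  by have := integrableZl mQ c iWI; apply: eq_integrable.
have [M [mM M0 sM]] := suppT bY.
have WS z : quadrant z -> ~ M z -> a <= z.2 < b ->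
    [/\ W z = (S z)^-1, 0 < S z, S z <= profile g k a & profile g k b <= S z].
  move=> zq Mz /andP[az zb].
  have zk : z.1 = Num.min z.2 k by apply/eqP/negPn/negP => zk; apply: Mz; apply: sM.
  have Sb : profile g k b <= S z.
    apply: le_Sg => //=; last exact: ltW.
    by rewrite zk le_min !ge_min (ltW zb) lexx !orbT.
  split=> //; last by rewrite [z]surjective_pairing zk; apply: le_profile.
    apply: exact_weightE => //=; last exact: ltW.
    by rewrite zk le_min !ge_min (ltW zb) lexx !orbT.
  exact: lt_le_trans Sb.
have cE c : lambda0 * (b - a) * c = \int[m T]_(z in quadrant) (c * (W z * I z)).
  by rewrite RintegralZl// WI mulrC.
rewrite strip_massE; apply/andP; split; rewrite cE -subr_le0.
- rewrite -(RintegralB mQ (iZ _) iI).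
  apply: (Rintegral_null_le0 mM M0) => z zq Mz; rewrite subr_le0 /I.
  case: (boolP (a <= z.2 < b)) => [zab|_]; last by rewrite !mulr0.
  have [-> Sz _ Sb] := WS z zq Mz zab.
  by rewrite mulr1 ler_pdivrMr// mul1r.
- rewrite -(RintegralB mQ iI (iZ _)).
  apply: (Rintegral_null_le0 mM M0) => z zq Mz; rewrite subr_le0 /I.
  case: (boolP (a <= z.2 < b)) => [zab|_]; last by rewrite !mulr0.
  have [-> Sz Sa _] := WS z zq Mz zab.
  by rewrite mulr1 ler_pdivlMr// mul1r.
Qed.

(** Beyond age a the curve x = min (y, k) runs where S = 0, outside [Ug], which a solution does not
    charge. *)
Lemma strip_mass_null a : 0 <= a -> profile g k a = 0 -> forall t, t <= Y0 ->
  strip_mass m T a t = 0.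
Proof.
move=> a0 sa t tY; rewrite /strip_mass (_ : m T _ = 0%E)//.
have mU : measurable (quadrant `\` Ug g : set (plane R)).
  have -> : quadrant `\` Ug g = quadrant `&` [set z : plane R | S z <= 0].
    apply/seteqP; split=> z [zq].
      by move=> nU; split=> //=; rewrite leNgt; apply/negP => Sz; apply: nU.
    by move=> /= Sz; split=> // -[_]; rewrite ltNge Sz.
  have mS := measurable_on_quadrant (C1_quad_cont (C1_quad_Sg SgC1)).
  have := mS measurable_quadrant `]-oo, 0%R]%classic (measurable_itv _).
  by congr (measurable (_ `&` _)); apply/seteqP; split=> z /=; rewrite in_itv.
apply: measure_negligible; first exact: measurable_strip.
have U0 : (m T).-negligible (quadrant `\` Ug g).
  by exists (quadrant `\` Ug g); split=> //; have [_ + _ _ _] := msol; exact.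
apply: negligibleS (negligibleU (suppT tY) U0) => z [zq /= /andP[az zt]].
have [zk|zk] := eqVneq z.1 (Num.min z.2 k); [right|by left].
split=> // -[_]; rewrite ltNge => /negP; apply.
by rewrite [z]surjective_pairing zk -sa; apply: le_profile.
Qed.

Let F t := strip_mass m T 0 t - lambda0 * profile_int g k t.

Let F0 : F 0 = 0.
Proof.
rewrite /F profile_int0 mulr0 subr0 /strip_mass (_ : strip 0 0 = set0) ?measure0//.
by apply/seteqP; split=> // z [_ /= /andP[z0 /(le_lt_trans z0)]]; rewrite ltxx.
Qed.

Let FB a b : 0 <= a -> a <= b ->
  F b - F a = strip_mass m T a b - lambda0 * (profile_int g k b - profile_int g k a).
Proof. by move=> a0 ab; rewrite /F (strip_massD m T a0 ab); ring. Qed.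

(** A crude bound that asks for no positivity of the profile; it serves for the single grid step in
    which the profile reaches zero. *)
Let F_lip a b : 0 <= a -> a <= b -> b <= Y0 -> `|F b - F a| <= lambda0 * (b - a).
Proof.
move=> a0 ab bY; rewrite FB//.
have /andP[p1 p2] := profile_int_bounds gP SgC1 k0 a0 ab.
have M1 := strip_mass_le gP SgC1 msol T0 a0 ab (le_trans bY YT).
have M0 := strip_mass_ge0 m T a b.
have ba : 0 <= b - a by rewrite subr_ge0.
have p3 : 0 <= profile_int g k b - profile_int g k a.
  by apply: le_trans p1; rewrite mulr_ge0// profile_ge0// (le_trans a0).
have p4 : profile_int g k b - profile_int g k a <= b - a.
  by apply: le_trans p2 _; rewrite ler_piMr// profile_le1.
have p5 : lambda0 * (profile_int g k b - profile_int g k a) <= lambda0 * (b - a).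
  by rewrite ler_pM2l.
have p6 : 0 <= lambda0 * (profile_int g k b - profile_int g k a) by rewrite mulr_ge0// ltW.
by rewrite ler_norml; apply/andP; split; lra.
Qed.

(** The increments of both terms of [F] lie between the same bounds, lambda0 (b - a) times the end
    values of the profile; the monotone function for telescoping is the profile itself. *)
Let F_pos t : 0 <= t -> t <= Y0 -> 0 < profile g k t -> F t = 0.
Proof.
move=> t0 tY st; rewrite -F0; apply: (flat_of_monotone_bound (sigma := profile g k) t0 (ltW lambda0_gt0)).
move=> a b a0 ab bt; rewrite FB//.
have sb : 0 < profile g k b by apply: lt_le_trans st _; apply: le_profile => //; exact: le_trans ab.
have /andP[p1 p2] := profile_int_bounds gP SgC1 k0 a0 ab.
have /andP[q1 q2] := strip_mass_bounds a0 ab (le_trans bt tY) sb.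
have {}p1 : lambda0 * (b - a) * profile g k b <= lambda0 * (profile_int g k b - profile_int g k a).
  by rewrite -mulrA ler_pM2l.
have {}p2 : lambda0 * (profile_int g k b - profile_int g k a) <= lambda0 * (b - a) * profile g k a.
  by rewrite -mulrA ler_pM2l.
by rewrite mulrBr ler_norml; apply/andP; split; lra.
Qed.

(** If the profile vanishes at t, a grid of mesh t/(n+1) brackets its first zero: [F] is 0 at the
    preceding grid point, moves by at most lambda0 times the mesh over one step, and is constant
    afterwards. *)
Lemma strip_mass_profile t : 0 <= t -> t <= Y0 ->
  strip_mass m T 0 t = lambda0 * profile_int g k t.
Proof.
move=> t0 tY; apply/eqP; rewrite -subr_eq0 -/(F t).
have := profile_ge0 gP k0 t0; rewrite le_eqVlt => /predU1P[st|st]; last by rewrite F_pos.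
rewrite -normr_le0; apply/ler_addgt0Pr => e e0; rewrite add0r.
have [n nP] : exists n : nat, lambda0 * (t / n.+1%:R) < e.
  have [n _ /(_ n (leqnn n)) nP] := near_infty_natSinv_lt
    (PosNum (divr_gt0 e0 (ltr_pwDr ltr01 (mulr_ge0 (ltW lambda0_gt0) t0)))).
  exists n; move: nP; rewrite /= ltr_pdivlMr ?ltr_pwDr ?mulr_ge0// ?ltW// => nP.
  apply: le_lt_trans nP; rewrite mulrA mulrC ler_wpM2l ?invr_ge0//.
  by rewrite lerDl.
set h := t / n.+1%:R in nP; have h0 : 0 <= h by rewrite divr_ge0.
have ex : exists i : nat, profile g k (i%:R * h) == 0.
  by exists n.+1; rewrite /h mulrCA divff ?pnatr_eq0// mulr1 -st.
case: (ex_minnP ex) => -[|i] /eqP si imin.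
  by move: si; rewrite mul0r profile0// => /eqP; rewrite oner_eq0.
have u0 : 0 <= i%:R * h by rewrite mulr_ge0.
have su : 0 < profile g k (i%:R * h).
  rewrite lt0r profile_ge0// andbT; apply/negP => /imin; by rewrite ltnn.
have iuE : i.+1%:R * h - i%:R * h = h by rewrite -natr1; ring.
have iu : i%:R * h <= i.+1%:R * h by rewrite -subr_ge0 iuE.
have it : i.+1%:R * h <= t.
  have := imin n.+1; rewrite {1}/h mulrCA divff ?pnatr_eq0// mulr1 -st eqxx => /(_ isT) in_.
  by rewrite /h mulrA ler_pdivrMr// mulrC ler_wpM2l// ler_nat.
have Fu : F (i%:R * h) = 0 by apply: F_pos => //; exact: le_trans (le_trans iu it) tY.
(* Beyond a zero of the profile both the mass and the integral of the profile stop growing. *)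
have Ft : F t = F (i.+1%:R * h).
  apply/eqP; rewrite -subr_eq0 FB ?(le_trans u0)// strip_mass_null ?(le_trans u0)//.
  have /andP[p1 p2] := profile_int_bounds gP SgC1 k0 (le_trans u0 iu) it.
  rewrite sub0r oppr_eq0 mulf_eq0; apply/orP; right.
  by move: p1 p2; rewrite -st si !mulr0 => p1 p2; rewrite eq_le p1 p2.
rewrite Ft -[F _]subr0 -Fu.
by apply: le_trans (F_lip u0 iu (le_trans it tY)) _; rewrite iuE ltW.
Qed.

End age_profile.

(** * Saturation of the servers *)

Section cap.
Context {R : realType} (lambda0 : R) (g : R * R -> R).
Hypothesis lambda0_gt0 : 0 < lambda0.
Hypothesis gP : probability_density g.
Hypothesis SgC1 : C1_quadrant (Sg g).
Local Notation leb := (@lebesgue_measure R).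
Local Notation S := (Sg g).
Local Notation ystar := (ystar lambda0 g).
Local Notation cap := (cap_ystar lambda0 g).

Definition diag_mass (y : R) : R := lambda0 * \int[leb]_(u in `[0, y]) S (u, u).

Lemma diag_massE k y : y <= k -> diag_mass y = lambda0 * profile_int g k y.
Proof.
move=> yk; rewrite /diag_mass; suff -> : \int[leb]_(u in `[0, y]) S (u, u) = profile_int g k y by [].
rewrite /profile_int; apply: eq_Rintegral => u; rewrite inE /= in_itv/= => /andP[_ uy].
by rewrite /profile min_l// (le_trans uy).
Qed.

Lemma diag_massB a b : 0 <= a -> a <= b -> 0 <= diag_mass b - diag_mass a <= lambda0 * (b - a).
Proof.
move=> a0 ab; have b0 := le_trans a0 ab.
rewrite !(@diag_massE b)// -mulrBr.
have /andP[p1 p2] := profile_int_bounds gP SgC1 b0 a0 ab.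
have ba : 0 <= b - a by rewrite subr_ge0.
rewrite mulr_ge0//= ?(ltW lambda0_gt0)//; last first.
  by apply: le_trans p1; rewrite mulr_ge0// profile_ge0.
rewrite ler_pM2l// (le_trans p2)// ler_piMr// profile_le1//.
Qed.

Lemma diag_mass_lt1 y : 0 <= y -> (y%:E < ystar)%E -> diag_mass y < 1.
Proof.
move=> y0; rewrite ltNge => /negP yy; rewrite ltNge; apply/negP => G1; apply: yy.
by apply: ereal_inf_lbound; exists y.
Qed.

Lemma ystar_ge0 : (0 <= ystar)%E.
Proof. by apply: le_ereal_inf_tmp => _ [y [y0 _] <-]; rewrite lee_fin. Qed.

(** The infimum is attained because [diag_mass] is Lipschitz with constant [lambda0]: an admissible
    level within e / lambda0 of k costs at most e. *)
Lemma diag_mass_ystar k : ystar = k%:E -> 0 <= k /\ 1 <= diag_mass k.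
Proof.
move=> yk; have k0 : 0 <= k by rewrite -lee_fin -yk ystar_ge0.
split=> //; apply/ler_addgt0Pr => e e0.
have : (ystar < (k + e / lambda0)%:E)%E by rewrite yk lte_fin ltrDl divr_gt0.
move=> /ereal_inf_lt[_ [y [y0 G1] <-]]; rewrite lte_fin => yke.
have ky : k <= y by rewrite -lee_fin -yk; apply: ereal_inf_lbound; exists y.
have /andP[_ Gy] := diag_massB k0 ky.
have : lambda0 * (y - k) <= e.
  by rewrite mulrC -ler_pdivlMr// lerBlDl ltW.
rewrite -/(diag_mass y) in G1; lra.
Qed.

Lemma cap_id y : (y%:E < ystar)%E -> cap y = y.
Proof. by move=> yy; rewrite /cap_ystar min_l// ltW. Qed.

Lemma cap_fin k y : ystar = k%:E -> cap y = Num.min y k.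
Proof. by move=> yk; rewrite /cap_ystar yk -EFin_min. Qed.

Lemma cap_ge0 y : 0 <= y -> 0 <= cap y.
Proof. by move=> y0; rewrite fine_ge0// le_min lee_fin y0 ystar_ge0. Qed.

Lemma ystarP y : (y%:E < ystar)%E \/ exists2 k, ystar = k%:E & k <= y.
Proof.
case E : ystar => [k| |]; last by have := ystar_ge0; rewrite E.
  by have [yk|ky] := ltP y k; [left; rewrite lte_fin|right; exists k].
by left; rewrite ltry.
Qed.

(** Replaces the possibly infinite [ystar] by the real level [cap T], as [strip_mass_profile]
    requires; ages up to T do not see the difference. *)
Lemma cap_min y T : y <= T -> Num.min y (cap T) = cap y.
Proof.
move=> yT; have [Ty|[k yk kT]] := ystarP T.
  by rewrite !cap_id ?min_l//; apply: le_lt_trans Ty; rewrite lee_fin.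
by rewrite !(cap_fin _ yk) minA (min_l yT).
Qed.

End cap.

Section bootstrap.
Context {R : realType} (lambda0 : R) (g : R * R -> R).
Hypothesis lambda0_gt0 : 0 < lambda0.
Hypothesis gP : probability_density g.
Hypothesis SgC1 : C1_quadrant (Sg g).
Variable m : R -> {finite_measure set (plane R) -> \bar R}.
Hypothesis msol : fluid_solution lambda0 g m.
Local Notation leb := (@lebesgue_measure R).
Local Notation S := (Sg g).
Local Notation ystar := (ystar lambda0 g).
Local Notation cap := (cap_ystar lambda0 g).

Let quad_below (y : R) : set (plane R) := `[0%R, +oo[ `*` `[0%R, y].

Let mquad_below y : measurable (quad_below y).
Proof. by apply: measurableX; exact: measurable_itv. Qed.

Lemma rbar_eq1 s (y y' : R) : y < y' -> strip_mass m s 0 y' < 1 -> rbar (m s) y = 1.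
Proof.
move=> yy' M1; rewrite /rbar; suff -> : (y%:E <= ybar (m s))%E by [].
apply: le_ereal_inf_tmp => _ [u [u0 Mu] <-]; rewrite lee_fin leNgt; apply/negP => uy.
have : (1 <= m s (strip 0%R y'))%E.
  apply: le_trans Mu _; apply: le_measure; rewrite ?inE; [exact: mquad_below|exact: measurable_strip|].
  move=> z [/= + +]; rewrite !in_itv/= andbT => z1 /andP[z2 zu]; split=> //=.
  by rewrite z2 (le_lt_trans zu)// (lt_trans uy).
by rewrite -strip_mass_EFin lee_fin leNgt M1.
Qed.

Lemma rbar_eq0 s (k y : R) : 0 <= k -> k < y -> 1 <= strip_mass m s 0 k -> rbar (m s) y = 0.
Proof.
move=> k0 ky M1; rewrite /rbar; case: (boolP (_ <= _)%E) => // yb.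
suff : (ybar (m s) <= k%:E)%E.
  by move=> /(le_trans yb); rewrite lee_fin leNgt ky.
apply: ereal_inf_lbound; exists k => //; split=> //.
apply: (@le_trans _ _ (m s (strip 0%R k))); first by rewrite -strip_mass_EFin lee_fin.
apply: le_measure; rewrite ?inE; [exact: measurable_strip|exact: mquad_below|].
by move=> z [[z1 z2] /= /andP[_ zk]]; split; rewrite /= !in_itv/= ?z1 ?z2 ?(ltW zk).
Qed.

(** Only ages below s are considered at time s, since older mass comes from the arbitrary initial
    state. *)
Let underloaded (y : R) := forall s, 0 <= s -> strip_mass m s 0 (Num.min y s) < 1.

Let underloaded_diag y T : 0 <= y -> 0 <= T -> underloaded y ->
  (m T).-negligible [set z | [/\ quadrant z, z.2 < Num.min y T & z.1 != z.2]].
Proof.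
move=> y0 T0 uy; apply: (null_off_diagonal gP SgC1 msol T0).
  by rewrite ge_min lexx orbT.
move=> s z /andP[s0 sT] zq; rewrite lt_min => /andP[zy zT].
apply: (rbar_eq1 _ (uy s s0)); rewrite lt_min; apply/andP; split.
  by apply: le_lt_trans zy; rewrite lerDl subr_ge0.
by rewrite -(ltrD2r (T - s)) [ltRHS]addrC subrK.
Qed.

(** Below age y the mass sits on the diagonal, which there is the curve of [profile] at level y, so
    [strip_mass_profile] applies. *)
Let underloaded_mass y T : 0 <= y -> 0 <= T -> underloaded y ->
  strip_mass m T 0 (Num.min y T) = diag_mass lambda0 g (Num.min y T).
Proof.
move=> y0 T0 uy; have b0 : 0 <= Num.min y T by rewrite le_min y0.
have bT : Num.min y T <= T by rewrite ge_min lexx orbT.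
rewrite (@diag_massE _ _ _ y); last by rewrite ge_min lexx.
apply: (strip_mass_profile lambda0_gt0 gP SgC1 msol y0 b0 bT _ b0 (lexx _)).
move=> s /andP[s0 sT]; apply: negligibleS (underloaded_diag y0 s0 uy) => z /= [zq].
by rewrite !lt_min => /andP[zy _] zs; rewrite (min_l (ltW zy)) zy zs.
Qed.

(* A strip of width [e] carries at most [lambda0 * e], half of what separates
   [diag_mass y] from 1, so the level can be raised by [e] until it reaches [y]. *)
Lemma mass_lt1 y : 0 <= y -> diag_mass lambda0 g y < 1 ->
  forall s, 0 <= s -> strip_mass m s 0 (Num.min y s) < 1.
Proof.
move=> y0 Gy; pose e := (1 - diag_mass lambda0 g y) / (2 * lambda0).
have e0 : 0 < e by rewrite divr_gt0 ?mulr_gt0// subr_gt0.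
have le : lambda0 * e = (1 - diag_mass lambda0 g y) / 2.
  by rewrite /e; field; rewrite gt_eqF.
suff uP i : underloaded (Num.min (i%:R * e) y).
  have [i ie] : exists i : nat, y <= i%:R * e.
    exists (Num.truncn (y / e)).+1; rewrite -ler_pdivrMr// ltW//; exact: truncnS_gt.
  by have := uP i; rewrite (min_r ie).
elim: i => [|i IH] s s0.
  rewrite mul0r (min_l y0) (min_l s0) /strip_mass (_ : strip 0 0 = set0) ?measure0//.
  by apply/seteqP; split=> // z [_ /= /andP[z0 /(le_lt_trans z0)]]; rewrite ltxx.
set a := Num.min _ y in IH; set b := Num.min _ y.
have ie0 : 0 <= i%:R * e by rewrite mulr_ge0// ltW.
have a0 : 0 <= a by rewrite le_min ie0.
have ab : a <= b by rewrite /a/b le_min !ge_min lexx orbT ler_wpM2r ?ler_nat// ltW.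
have bae : b <= a + e.
  rewrite /a /b -natr1 mulrDl mul1r; set w := i%:R * e.
  by case: (leP w y) => ?; case: (leP (w + e) y) => ?; lra.
have ay : a <= y by rewrite /a ge_min lexx orbT.
clearbody a b.
have as0 : 0 <= Num.min a s by rewrite le_min a0.
have asbs : Num.min a s <= Num.min b s by rewrite le_min !ge_min ab lexx orbT.
have bs : Num.min b s <= s by rewrite ge_min lexx orbT.
have d : Num.min b s - Num.min a s <= e.
  case: (leP b s) => ?; case: (leP a s) => ?; lra.
rewrite (strip_massD m s as0 asbs) underloaded_mass//.
have := strip_mass_le gP SgC1 msol s0 as0 asbs bs.
have : lambda0 * (Num.min b s - Num.min a s) <= lambda0 * e by rewrite ler_pM2l.
have asy : Num.min a s <= y by rewrite ge_min ay.
have /andP[+ _] := diag_massB lambda0_gt0 gP SgC1 as0 asy.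
rewrite le; lra.
Qed.

Lemma null_off_diag T y : 0 <= T -> 0 <= y -> (y%:E <= ystar)%E ->
  (m T).-negligible [set z | [/\ quadrant z, z.2 < Num.min y T & z.1 != z.2]].
Proof.
move=> T0 y0 yy; apply: (null_off_diagonal gP SgC1 msol T0).
  by rewrite ge_min lexx orbT.
move=> s z /andP[s0 sT] [_ z2]; rewrite lt_min => /andP[zy zT].
have {}zy : z.2 < y by apply: le_lt_trans zy; rewrite lerDl subr_ge0.
have zs : z.2 < s by rewrite -(ltrD2r (T - s)) [ltRHS]addrC subrK.
(* The midpoint lies strictly below [ystar] even when y equals it, so [mass_lt1] applies at this
   level. *)
pose y' := (z.2 + y) / 2; have zy' : z.2 < y' by rewrite /y'; lra.
have y'y : y' < y by rewrite /y'; lra.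
have y'0 : 0 <= y' by exact: le_trans (ltW zy').
have Gy' : diag_mass lambda0 g y' < 1.
  by apply: diag_mass_lt1 => //; apply: lt_le_trans yy; rewrite lte_fin.
by apply: (rbar_eq1 _ (mass_lt1 y'0 Gy' s0)); rewrite lt_min zy' zs.
Qed.

(** Either T < [ystar] and every young customer has always been served, or k = [ystar] <= T: below
    age k the mass is diagonal, and beyond it x > k and x < k are excluded separately. *)
Lemma null_off_cap T : 0 <= T ->
  (m T).-negligible [set z | [/\ quadrant z, z.2 < T & z.1 != cap z.2]].
Proof.
move=> T0; have [Ty|[k yk kT]] := ystarP lambda0 g T.
  apply: negligibleS (null_off_diag T0 T0 (ltW Ty)) => z /= [zq zT].
  rewrite minxx cap_id//; apply: lt_trans Ty; rewrite lte_fin//.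
have [k0 Gk] := diag_mass_ystar lambda0_gt0 gP SgC1 yk.
have diag s : 0 <= s -> (m s).-negligible
    [set z | [/\ quadrant z, z.2 < k, z.2 < s & z.1 != z.2]].
  move=> s0; have := @null_off_diag s k s0 k0; rewrite yk lexx => /(_ isT).
  by apply: negligibleS => z /= [zq zk zs zz]; rewrite lt_min zk zs.
(* An age between k and s forces s > k; the mass younger than k is then complete, equal to
   [diag_mass] at k, hence at least 1, and saturates the servers. *)
have r0 s z : 0 <= s <= T -> quadrant z -> k < z.2 < s -> rbar (m s) z.2 = 0.
  move=> /andP[s0 sT] zq /andP[kz zs]; apply: (rbar_eq0 k0 kz).
  have ks : k <= s by rewrite ltW// (lt_trans kz).
  rewrite (strip_mass_profile lambda0_gt0 gP SgC1 msol k0 k0 ks _ k0 (lexx k)).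
    by rewrite -(@diag_massE _ _ _ k).
  move=> v /andP[v0 vs]; apply: negligibleS (diag v v0) => w /= [wq wk wv].
  by rewrite (min_l (ltW wk)).
have N1 := null_service_gt gP SgC1 msol T0 k0 r0.
have N2 := null_service_lt gP SgC1 msol T0 (fun s sT => diag s (andP sT).1).
apply: negligibleS (negligibleU (negligibleU N1 N2) (diag T T0)) => z /= [zq zT].
rewrite (cap_fin _ yk); have [zk|kz] := leP k z.2; last by move=> zz; right.
by rewrite neq_lt => /orP[zz|zz]; left; [right|left].
Qed.

Lemma mass_below_cap T t : 0 <= t -> t <= T ->
  strip_mass m T 0 t = lambda0 * \int[leb]_(u in `[0, t]) S (cap u, u).
Proof.
move=> t0 tT; have T0 := le_trans t0 tT.
rewrite (strip_mass_profile lambda0_gt0 gP SgC1 msol (cap_ge0 lambda0 g T0) T0 (lexx T) _ t0 tT).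
  suff -> : profile_int g (cap T) t = \int[leb]_(u in `[0, t]) S (cap u, u) by [].
  rewrite /profile_int; apply: eq_Rintegral => u; rewrite inE /= in_itv/= => /andP[u0 ut].
  by rewrite /profile cap_min// (le_trans ut).
move=> s /andP[s0 sT]; apply: negligibleS (null_off_cap s0) => z /= [zq zT zs].
by rewrite cap_min ?ltW.
Qed.

End bootstrap.

(** * Decay of the old mass *)

Section strip_extension.
Context {R : realType}.

Lemma is_dRp_is_derive (f : R -> R) (a d : R) : 0 < a -> is_dRp f a d ->
  is_derive a (1 : R) f d.
Proof.
move=> a0 fd.
suff H : h^-1 *: (f (h *: (1 : R) + a) - f a) @[h --> 0^'] --> d.
  by apply: DeriveDef; [apply/cvg_ex; exists d|apply: cvg_lim].
apply: cvg_trans fd => A /= FA.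
have : \forall h \near 0^', 0 <= a + h.
  apply: filterS (@dnbhs0_lt _ R^o a a0) => h; rewrite ltr_norml => /andP[ha _].
  by rewrite -lerBlDl sub0r ltW.
move=> aD; have FA' : \forall h \near (0 : R)^', 0 <= a + h -> A (h^-1 * (f (a + h) - f a)) := FA.
apply: filterS (filterI FA' aD) => h [+ ah].
by move=> /(_ ah); rewrite /= /GRing.scale /= mulr1 (addrC a h).
Qed.

(** Extending [G] by its boundary values at y = 0 creates a kink there, but [q] vanishes up to t >
    0, so the product is identically zero around it. *)
Lemma C1_strip_quad (G Gx Gy : R * R -> R) (q q' : R -> R) (t : R) : 0 < t ->
  C1_quad G Gx Gy -> C1_real q q' -> (forall u, u <= t -> q u = 0) ->
  C1_strip (fun z => G (z.1, Num.max z.2 0) * q z.2)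
    (fun z => Gx (z.1, Num.max z.2 0) * q z.2)
    (fun z => Gy (z.1, Num.max z.2 0) * q z.2 + G (z.1, Num.max z.2 0) * q' z.2).
Proof.
move=> t0 cG cq q0; have [Gc Gxc Gyc Gdx Gdy] := cG; have [q'c qd] := cq.
have qc : continuous (fun z : R * R => q z.2).
  move=> z; apply: (@continuous_cvg _ _ _ _ _ (fun z : R * R => z.2) q); last exact: cvg_snd.
  exact: C1_real_continuous cq _.
have q'c2 : continuous (fun z : R * R => q' z.2).
  by move=> z; apply: (@continuous_cvg _ _ _ _ _ (fun z : R * R => z.2) q'); [exact: q'c|exact: cvg_snd].
split=> [z|z|z|x y x0|x y x0] /=.
- exact: cvgM (Gc z) (qc z).
- exact: cvgM (Gxc z) (qc z).
- exact: cvgD (cvgM (Gyc z) (qc z)) (cvgM (Gc z) (q'c2 z)).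
- have yq : quadrant (x, Num.max y 0) by split=> //=; rewrite le_max lexx orbT.
  by have := is_dRpM (Gdx _ yq) (is_dRp_cst (q y) x); rewrite /= mulr0 addr0.
- have [y0|y0] := ltP 0 y.
    have yq : quadrant (x, y) by split=> //=; exact: ltW.
    have dG : is_derive y (1 : R) (fun y => G (x, Num.max y 0)) (Gy (x, y)).
      apply: is_dRp_is_derive => //; apply: eq_is_dRp (ltW y0) _ (Gdy _ yq) => u u0 /=.
      by rewrite max_l.
    have := is_deriveM dG (qd y); congr is_derive.
    by rewrite /GRing.scale /= (max_l (ltW y0)) addrC mulrC.
  have yt : \forall u \near y, u < t by apply: lt_nbhsl; exact: le_lt_trans t0.
  have q'0 : q' y = 0.
    have d0 : is_derive y (1 : R) q 0.
      apply: (near_eq_is_derive _ (is_derive_cst (0 : R) y (1 : R))).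
      by apply: filterS yt => u ut; rewrite q0// ltW.
    by rewrite -(@derive_val _ _ _ _ _ _ _ (qd y)) (@derive_val _ _ _ _ _ _ _ d0).
  rewrite q'0 q0 ?(le_trans y0 (ltW t0))// !mulr0 addr0.
  apply: (near_eq_is_derive _ (is_derive_cst (0 : R) y (1 : R))).
  by apply: filterS yt => u ut; rewrite q0 ?mulr0// ltW.
Qed.

End strip_extension.

Section old_mass.
Context {R : realType} (lambda0 : R) (g : R * R -> R).
Hypothesis gP : probability_density g.
Hypothesis SgC1 : C1_quadrant (Sg g).
Variable m : R -> {finite_measure set (plane R) -> \bar R}.
Hypothesis msol : fluid_solution lambda0 g m.
Local Notation leb := (@lebesgue_measure R).
Local Notation S := (Sg g).

(* A monotone C^1 approximation of the identity on [0, +oo[ that vanishes below [c]: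
   it keeps [old_target] away from the zeros of [S]. *)
Definition trunc_id (c v : R) : R := sqp (1 * v + - c) / (1 * v + c).

Lemma trunc_idE c v : c <= v -> trunc_id c v = (v - c) ^+ 2 / (v + c).
Proof. by move=> cv; rewrite /trunc_id !mul1r sqpE// subr_ge0. Qed.

Lemma trunc_id0 c v : v <= c -> trunc_id c v = 0.
Proof. by move=> vc; rewrite /trunc_id mul1r sqp_eq0 ?mul0r// subr_le0. Qed.

Lemma trunc_id_ge0 c v : 0 < c -> 0 <= v -> 0 <= trunc_id c v.
Proof. by move=> c0 v0; rewrite divr_ge0 ?sqp_ge0// mul1r addr_ge0// ltW. Qed.

Lemma trunc_id_le c v : 0 < c -> 0 <= v -> trunc_id c v <= v.
Proof.
move=> c0 v0; have [vc|cv] := leP v c; first by rewrite trunc_id0.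
have v1 := lt_trans c0 cv.
rewrite (trunc_idE (ltW cv)) ler_pdivrMr ?addr_gt0//; nra.
Qed.

Lemma le_trunc_id c v w : 0 < c -> 0 <= v -> v <= w -> trunc_id c v <= trunc_id c w.
Proof.
move=> c0 v0 vw; have w0 := le_trans v0 vw.
have [vc|cv] := leP v c; first by rewrite trunc_id0// trunc_id_ge0.
have cw := lt_le_trans cv vw; have v1 := lt_trans c0 cv; have w1 := lt_trans c0 cw.
rewrite (trunc_idE (ltW cv)) (trunc_idE (ltW cw)) ler_pdivrMr ?addr_gt0// mulrAC ler_pdivlMr ?addr_gt0//.
(* This is the factored form of (w - c)^2 (v + c) - (v - c)^2 (w + c), the cross-multiplied
   difference. *)
have H : 0 <= (w - v) * ((v - c) * (w - c) + 2 * c * ((w - c) + (v - c))).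
  have a0 : 0 <= v - c by rewrite subr_ge0 ltW.
  have b0 : 0 <= w - c by rewrite subr_ge0 ltW.
  apply: mulr_ge0; first by rewrite subr_ge0.
  apply: addr_ge0; first exact: mulr_ge0.
  by apply: mulr_ge0; [apply: mulr_ge0 => //; exact: ltW|exact: addr_ge0].
rewrite -subr_ge0; apply: le_trans H _; rewrite le_eqVlt; apply/orP; left; apply/eqP.
by ring.
Qed.

Lemma cvg_trunc_id v : 0 <= v -> trunc_id n.+1%:R^-1 v @[n --> \oo] --> v.
Proof.
rewrite le_eqVlt => /predU1P[<-|v0].
  under eq_fun do rewrite trunc_id0 ?invr_ge0//; exact: cvg_cst.
have h0 : n.+1%:R^-1 @[n --> \oo] --> (0 : R) by exact: cvg_harmonic.
have L : (v - n.+1%:R^-1) * (v - n.+1%:R^-1) / (v + n.+1%:R^-1) @[n --> \oo] --> (v - 0) * (v - 0) / (v + 0).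
  apply: cvgM; first by apply: cvgM; apply: cvgB => //; exact: cvg_cst.
  by apply: cvgV; [rewrite addr0 gt_eqF|apply: cvgD => //; exact: cvg_cst].
move: L; rewrite subr0 addr0 mulfK ?gt_eqF//; apply: cvg_trans; apply: near_eq_cvg.
have : \forall n \near \oo, n.+1%:R^-1 < v :> R by exact: (near_infty_natSinv_lt (PosNum v0)).
by apply: filterS => n nv; rewrite trunc_idE -?expr2// ltW.
Qed.

(** The ratio is the conditional probability of surviving t more units of age with service frozen at
    x; at zeros of S it is 0 by the convention for inverses. *)
Lemma survival_ratio (z : R * R) t : quadrant z -> 0 <= t ->
  0 <= S (z.1, z.2 + t) / S z <= 1.
Proof.
move=> zq t0; have [z1 z2] := zq.
have wq : quadrant (z.1, z.2 + t) by split=> //=; rewrite addr_ge0.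
have Sw : S (z.1, z.2 + t) <= S z by apply: le_Sg => //=; rewrite lerDl.
rewrite divr_ge0 ?Sg_ge0//=; have := Sg_ge0 gP zq; rewrite le_eqVlt => /predU1P[<-|Sz].
  by rewrite invr0 mulr0.
by rewrite ler_pdivrMr// mul1r.
Qed.

Lemma survival_ratio_fin t : 0 <= t ->
  (\int[m 0]_(z in quadrant) (S (z.1, z.2 + t) / S z)%:E < +oo)%E.
Proof.
move=> t0; apply: le_lt_trans (_ : (\int[m 0]_(z in quadrant) (cst 1%E) z < +oo)%E).
  by apply: ge0_le_lower_integral => z zq; rewrite lee_fin;
    have /andP[] := survival_ratio zq t0.
rewrite integral_cst; last exact: measurable_quadrant.
by rewrite mul1e ltey_eq fin_num_measure//; exact: measurable_quadrant.
Qed.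

Section stopped.
Variables (T : R) (n : nat).
Hypothesis T0 : 0 < T.
Let e : R := n.+1%:R^-1.
Let N : R := n.+1%:R.
Let e0 : 0 < e. Proof. by rewrite invr_gt0. Qed.
Let N0 : 0 < N. Proof. by []. Qed.

(** A C^1 approximation of the indicator of u > T. Vanishing on all of u <= T, it eliminates every
    customer arrived since time 0. *)
Definition age_ge (u : R) : R := sqp (1 * u + - T) / (sqp (1 * u + - T) + n.+1%:R^-1).

Let age_den u : 0 < sqp (1 * u + - T) + n.+1%:R^-1.
Proof. by rewrite ltr_wpDl ?sqp_ge0. Qed.

Lemma C1_age_ge : exists k, C1_real age_ge k.
Proof.
have c := C1_sqp_affine 1 (- T).
eexists; apply: C1_realM c (C1_realV _ (C1_realDc _ c)) => u.
by rewrite gt_eqF// age_den.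
Qed.

Lemma age_ge0 u : 0 <= age_ge u. Proof. by rewrite divr_ge0 ?sqp_ge0// ltW// age_den. Qed.
Lemma age_ge_le1 u : age_ge u <= 1.
Proof. by rewrite /age_ge ler_pdivrMr ?age_den// [leRHS]mul1r lerDl invr_ge0 ler0n. Qed.
Lemma age_ge_eq0 u : u <= T -> age_ge u = 0.
Proof. by move=> uT; rewrite /age_ge sqp_eq0 ?mul0r// mul1r subr_le0. Qed.

(** The threshold e is shared with [trunc_id] in [old_target]: if the target is nonzero at a point
    beyond z in both coordinates, then S exceeds e there and hence at z, where [invS] is therefore
    exactly 1/S. *)
Definition old_weight (z : R * R) : R := chi2 N z * invS g e z.

Definition old_target (z : R * R) : R :=
  trunc_id e (S (z.1, Num.max z.2 0)) * age_ge z.2.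

Lemma C1_trunc_S : C1_quad (fun z => trunc_id e (S z))
  (fun z => (2 * Num.max (1 * S z + - e) 0 * 1 * Sx g z) * (1 * S z + e)^-1
     + sqp (1 * S z + - e) * (- (1 * Sx g z) / (1 * S z + e) ^+ 2))
  (fun z => (2 * Num.max (1 * S z + - e) 0 * 1 * Sy g z) * (1 * S z + e)^-1
     + sqp (1 * S z + - e) * (- (1 * Sy g z) / (1 * S z + e) ^+ 2)).
Proof.
have cS := C1_quad_Sg SgC1.
apply: C1_quadM; first exact: C1_quad_comp (C1_sqp_affine 1 (- e)) cS.
apply: C1_quadV (C1_quad_comp (C1_real_affine 1 e) cS) => z zq.
by rewrite gt_eqF// mul1r ltr_wpDl// Sg_ge0.
Qed.

Lemma old_target_ge0 z : 0 <= z.1 -> 0 <= old_target z.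
Proof.
move=> z1; rewrite mulr_ge0 ?age_ge0// trunc_id_ge0// Sg_ge0//.
by split=> //=; rewrite le_max lexx orbT.
Qed.

Lemma old_weight_target_le1 z w : quadrant z -> quadrant w -> z.1 <= w.1 -> z.2 <= w.2 ->
  0 <= invS g e z * old_target w <= 1.
Proof.
move=> zq wq z1 z2; have Sz := le_Sg gP zq z1 z2; have Sw0 := Sg_ge0 gP wq.
have i0 : 0 < invS g e z by rewrite invr_gt0 invS_den_gt0.
rewrite mulr_ge0 ?(ltW i0) ?old_target_ge0//=; last by case: wq.
rewrite /old_target (max_l wq.2) -surjective_pairing mulrA.
apply: (@le_trans _ _ (invS g e z * trunc_id e (S w))).
  by rewrite ler_piMr ?age_ge_le1// mulr_ge0 ?(ltW i0)// trunc_id_ge0.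
have [Se|eS] := leP (S w) e; first by rewrite trunc_id0// mulr0.
rewrite invSE; last by rewrite (le_trans _ Sz)// ltW.
have Sz0 : 0 < S z by rewrite (lt_le_trans _ Sz)// (lt_trans e0).
by rewrite mulrC ler_pdivrMr// mul1r (le_trans _ Sz)// trunc_id_le.
Qed.

(** Freezing service can only improve survival: the term with [Qx] is nonpositive, the cutoff
    decreases, and 1/S balances killing, so transport is dominated by killing. *)
Lemma old_mass_stopped :
  pairing (fun z => old_weight z * old_target z) (m T) <=
  \int[m 0]_(z in quadrant) (S (z.1, z.2 + T) / S z).
Proof.
have [k ck] := C1_age_ge; have T0' := ltW T0.
have cB := C1_quadM (C1_chi2 N) (C1_invS gP SgC1 e0).
have [Qx [Qy cQ]] : exists Qx Qy, C1_strip old_target Qx Qy.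
  by do 2 eexists; exact: C1_strip_quad T0 C1_trunc_S ck age_ge_eq0.
have Qx_le0 z : 0 <= z.1 -> Qx z <= 0.
  case: z => z1 z2 /= z10.
  have dQ : is_dRp (fun x => old_target (x, z2)) z1 (Qx (z1, z2)) by exact: (C1_strip_dx cQ z10).
  apply: is_dRp_le0 z10 _ dQ => x y x0 xy; rewrite ler_wpM2r ?age_ge0//=.
  have xq : quadrant (x, Num.max z2 0) by split=> //=; rewrite le_max lexx orbT.
  have yq : quadrant (y, Num.max z2 0) by split=> /=; [exact: le_trans xy|rewrite le_max lexx orbT].
  by apply: le_trunc_id => //; [exact: Sg_ge0|exact: le_Sg].
have BN z : quadrant z -> chi2 N z * invS g e z != 0 -> z.1 <= N /\ z.2 <= N.
  by move=> zq; rewrite mulf_eq0 negb_or chi2_neq0// => /andP[/andP[? ?] _]; split; exact: ltW.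
have QN z : old_target z != 0 -> - N <= z.2.
  rewrite mulf_eq0 negb_or => /andP[_]; apply: contraNT; rewrite -ltNge => zN.
  by rewrite age_ge_eq0// (le_trans (ltW zN))// (le_trans _ T0')// oppr_le0 ltW.
have B0 z : quadrant z -> 0 <= chi2 N z * invS g e z.
  by move=> zq; rewrite mulr_ge0 ?chi2_ge0// invr_ge0 ltW// invS_den_gt0.
have shift s z : 0 <= s <= T -> quadrant z ->
    [/\ quadrant (z.1, z.2 + (T - s)), z.1 <= (z.1, z.2 + (T - s)).1 &
       z.2 <= (z.1, z.2 + (T - s)).2].
  move=> /andP[s0 sT] [z1 z2]; have Ts : 0 <= T - s by rewrite subr_ge0.
  by split=> //=; [split=> //=; rewrite addr_ge0|rewrite lerDl].
have := C1_quad_Sg SgC1 => -[_ Sxc Syc _ _].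
have chic := C1_quad_cont (C1_chi2 N).
have cSx : continuous ((fun z => chi2 N z * Sx g z) \o clamp).
  by move=> z; apply: cvgM; [exact: chic|exact: Sxc].
have cSy : continuous ((fun z => chi2 N z * Sy g z) \o clamp).
  by move=> z; apply: cvgM; [exact: chic|exact: Syc].
have chiN (f : R * R -> R) z : quadrant z -> chi2 N z * f z != 0 -> z.1 <= N /\ z.2 <= N.
  by move=> zq; rewrite mulf_eq0 negb_or chi2_neq0// => /andP[/andP[? ?] _]; split; exact: ltW.
have [K1 K1P] := compact_support_bounded cSx (chiN (Sx g)).
have [K2 K2P] := compact_support_bounded cSy (chiN (Sy g)).
(* Either the target vanishes and there is nothing to prove, or S z > e, which allows division by S
   and the exact form of [invS]. *)
have target0 s z : 0 <= s <= T -> quadrant z ->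
    old_target (z.1, z.2 + (T - s)) = 0 \/ e < S z.
  move=> sT zq; have [wq w1 w2] := shift s z sT zq.
  have [Se|eS] := leP (S (z.1, z.2 + (T - s))) e; [left|right].
    by rewrite /old_target /= max_l ?trunc_id0 ?mul0r//; case: wq.
  by apply: lt_le_trans eS _; exact: le_Sg.
(* The constant bounds the hazard on the support: K1 and K2 bound the partial derivatives of S
   multiplied by the cutoff, and S > e wherever killing is nonzero. *)
apply: le_trans (fluid_test_killed_le (K := (K1 + K2) / e) gP SgC1 msol cB cQ BN QN T0' B0 _ _ _ _) _.
- by move=> z z1; exact: old_target_ge0.
- move=> s z sT zq; have [wq w1 w2] := shift s z sT zq.
  have /andP[u0 u1] := old_weight_target_le1 zq wq w1 w2.
  have [z1 z2] := zq.
  rewrite -mulrA; apply: mulr_ile1 => //; first exact: chi2_ge0.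
  by apply: mulr_ile1; rewrite ?sqp_ge0 ?chi_le1.
- move=> s z sT zq; have [wq w1 w2] := shift s z sT zq.
  have /andP[u0 u1] := old_weight_target_le1 zq wq w1 w2.
  have K10 : 0 <= K1 by exact: le_trans (K1P z zq).
  have K20 : 0 <= K2 by exact: le_trans (K2P z zq).
  rewrite /killing; have [tz|eS] := target0 s z sT zq.
    by rewrite tz mulr0 mul0r divr_ge0 ?addr_ge0// ltW.
  have Sz : 0 < S z by exact: lt_trans eS.
  have -> : chi2 N z * invS g e z * old_target (z.1, z.2 + (T - s)) * hazard g m s z =
     (invS g e z * old_target (z.1, z.2 + (T - s))) * (chi2 N z * hazard g m s z) by ring.
  have H0 : 0 <= chi2 N z * hazard g m s z by rewrite mulr_ge0 ?chi2_ge0// hazard_ge0.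
  apply: (@le_trans _ _ (chi2 N z * hazard g m s z)); first by rewrite ler_piMl.
  rewrite /hazard hxE// hyE// mulrDr.
  have a1 := K1P z zq; have a2 := K2P z zq.
  have r0 := rbar_ge0 (m s) z.2; have r1 := rbar_le1 (m s) z.2.
  have b1 : rbar (m s) z.2 * - (chi2 N z * Sx g z) <= K1.
    apply: (@le_trans _ _ (rbar (m s) z.2 * K1)); last by rewrite ler_piMl.
    by rewrite ler_wpM2l// (le_trans _ a1)// -normrN ler_norm.
  have b2 : - (chi2 N z * Sy g z) <= K2 by rewrite (le_trans _ a2)// -normrN ler_norm.
  have -> : chi2 N z * (rbar (m s) z.2 * (- Sx g z / S z)) + chi2 N z * (- Sy g z / S z) =
    (rbar (m s) z.2 * - (chi2 N z * Sx g z) + - (chi2 N z * Sy g z)) / S z by ring.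
  apply: (@le_trans _ _ ((K1 + K2) / S z)).
    by rewrite ler_wpM2r ?invr_ge0 ?(ltW Sz)// lerD.
  by rewrite ler_wpM2l ?addr_ge0// lef_pV2 ?posrE// ltW.
- move=> s z sT zq; have [wq w1 w2] := shift s z sT zq.
  rewrite /transport /killing.
  have r0 := rbar_ge0 (m s) z.2.
  have Q0 : 0 <= old_target (z.1, z.2 + (T - s)) by apply: old_target_ge0; case: wq.
  have q_le0 : rbar (m s) z.2 * (chi2 N z * invS g e z * Qx (z.1, z.2 + (T - s))) <= 0.
    rewrite mulr_ge0_le0// mulr_ge0_le0 ?B0// Qx_le0//; by case: wq.
  have [tz|eS] := target0 s z sT zq.
    by rewrite tz !mul0r mulr0 mul0r add0r.
  have Sz : 0 < S z by exact: lt_trans eS.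
  have d_le0 := chi2_decr z N0 r0.
  rewrite /hazard hxE// hyE// (invSE (ltW eS)) (max_r (x := -1 * S z + e)); last first.
    by rewrite mulN1r addrC subr_le0 ltW.
  rewrite (sqp_eq0 (u := -1 * S z + e)); last by rewrite mulN1r addrC subr_le0 ltW.
  have d2_le0 : old_target (z.1, z.2 + (T - s)) * (S z)^-1 *
    (rbar (m s) z.2 * (dchi N z.1 * chi N z.2) + chi N z.1 * dchi N z.2) <= 0.
    by rewrite mulr_ge0_le0// mulr_ge0// invr_ge0 ltW.
  move: q_le0; rewrite (invSE (ltW eS)) => q_le0.
  rewrite -subr_ge0; set rhs := (X in 0 <= X).
  (* The derivatives of 1/S cancel against the hazard; what remains comes from [chi2] and from the
     x-derivative of the target. *)
  have -> : rhs = - (old_target (z.1, z.2 + (T - s)) * (S z)^-1 *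
    (rbar (m s) z.2 * (dchi N z.1 * chi N z.2) + chi N z.1 * dchi N z.2)) -
    rbar (m s) z.2 * (chi2 N z * (S z)^-1 * Qx (z.1, z.2 + (T - s))).
    by rewrite /rhs; field; rewrite gt_eqF.
  by rewrite addr_ge0// oppr_ge0.
(* An arrival at time s has age T - s <= T at time T, where [age_ge] vanishes. *)
have -> : \int[leb]_(s in `[0, T])
    (chi2 N (0, 0) * invS g e (0, 0) * old_target (0, T - s)) = 0.
  rewrite (@eq_Rintegral _ _ _ leb _ (fun=> 0)).
    by rewrite Rintegral_cst ?mul0r//; exact: measurable_itv.
  move=> s; rewrite inE /= in_itv/= => /andP[s0 sT].
  by rewrite /old_target/= age_ge_eq0 ?mulr0// gerBl.
rewrite mulr0 addr0; apply: le_lower_Rintegral => [z||z].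
- by move=> zq; exact: (andP (survival_ratio zq T0')).1.
- exact: survival_ratio_fin.
- move=> zq; have sT : 0 <= (0 : R) <= T by rewrite lexx.
  have [wq w1 w2] := shift 0 z sT zq; rewrite subr0 in wq w1 w2.
  have := target0 0 z sT zq; rewrite subr0 => -[tz|eS].
    by rewrite tz mulr0; exact: (andP (survival_ratio zq T0')).1.
  have Sz : 0 < S z by exact: lt_trans eS.
  rewrite (invSE (ltW eS)) -mulrA; have Sw0 := Sg_ge0 gP wq.
  have Q0 := old_target_ge0 wq.1.
  have QS : old_target (z.1, z.2 + T) <= S (z.1, z.2 + T).
    rewrite /old_target /= max_l; last by case: wq.
    by apply: le_trans (trunc_id_le e0 Sw0); rewrite ler_piMr ?age_ge_le1// trunc_id_ge0.
  apply: (@le_trans _ _ ((S z)^-1 * old_target (z.1, z.2 + T))).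
    rewrite ler_piMl//; first by rewrite mulr_ge0// invr_ge0 ltW.
    by case: zq => ? ?; apply: mulr_ile1; rewrite ?sqp_ge0 ?chi_le1.
  by rewrite mulrC ler_wpM2r// invr_ge0 ltW.
Qed.

End stopped.

Definition old_set (T : R) : set (plane R) := quadrant `&` [set z | T <= z.2].

Lemma measurable_old_set T : measurable (old_set T).
Proof.
apply: measurableI; first exact: measurable_quadrant.
have -> : [set z : plane R | T <= z.2] = setT `*` `[T, +oo[.
  by apply/seteqP; split=> -[x y] /=; rewrite in_itv/= andbT//; case.
by apply: measurableX => //; exact: measurable_itv.
Qed.

Lemma null_outside_Ug T : 0 <= T -> (m T).-negligible [set z | quadrant z /\ S z <= 0].
Proof.
move=> T0; exists (quadrant `&` [set z : plane R | S z <= 0]); split.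
- have mS := measurable_on_quadrant (C1_quad_cont (C1_quad_Sg SgC1)).
  have := mS measurable_quadrant `]-oo, 0%R]%classic (measurable_itv _).
  by congr (measurable (_ `&` _)); apply/seteqP; split=> z /=; rewrite in_itv.
- have [_ + _ _ _] := msol => /(_ T T0); congr (m T _ = _).
  apply/seteqP; split=> z [zq].
    by move=> nU; split=> //=; rewrite leNgt; apply/negP => Sz; apply: nU.
  by move=> /= Sz; split=> // -[_]; rewrite ltNge Sz.
- by move=> z [].
Qed.

Lemma cvg_age_ge T u : age_ge T n u @[n --> \oo] --> ((T < u)%R%:R : R).
Proof.
rewrite /age_ge; have [Tu|uT] := ltP T u; last first.
  have -> : sqp (1 * u + - T) = 0 by rewrite sqp_eq0// mul1r subr_le0.
  by under eq_fun do rewrite mul0r; exact: cvg_cst.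
have u0 : 0 < sqp (1 * u + - T) by rewrite sqp_gt0// mul1r subr_gt0.
have -> : true%:R = sqp (1 * u + - T) / (sqp (1 * u + - T) + 0) :> R.
  by rewrite addr0 divff// gt_eqF.
apply: cvgM; first exact: cvg_cst.
apply: cvgV; first by rewrite addr0 gt_eqF.
by apply: cvgD; [exact: cvg_cst|exact: cvg_harmonic].
Qed.

(** The weights tend to the indicator of y > T and S > 0, which differs from that of [old_set T]
    only at the age T and at zeros of S, both negligible. *)
Lemma old_mass_le T : 0 < T -> fine (m T (old_set T)) <=
  \int[m 0]_(z in quadrant) (S (z.1, z.2 + T) / S z).
Proof.
move=> T0; have T0' := ltW T0; have mQ := @measurable_quadrant R.
have e0 n : 0 < n.+1%:R^-1 :> R by rewrite invr_gt0.
have E n z : quadrant z -> old_weight n z * old_target T n z =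
    chi2 n.+1%:R z * invS g n.+1%:R^-1 z * (trunc_id n.+1%:R^-1 (S z) * age_ge T n z.2).
  by move=> [z1 z2]; rewrite /old_weight /old_target max_l// -surjective_pairing.
have -> : fine (m T (old_set T)) =
    \int[m T]_(z in quadrant) ((T < z.2)%R%:R * (0 < S z)%R%:R).
  have -> : fine (m T (old_set T)) = \int[m T]_(z in quadrant) (\1_(old_set T) z).
    rewrite /Rintegral integral_indic//; last exact: measurable_old_set.
    by rewrite setIidl// => z [].
  have [M [mM M0 sM]] := negligibleU (null_age msol T T0') (null_outside_Ug T0').
  apply: (eq_Rintegral_null mM M0) => z zq Mz.
  have -> : 0 < S z by rewrite ltNge; apply/negP => Sz; apply: Mz; apply: sM; right.
  rewrite mulr1 indicE; congr (nat_of_bool _)%:R; apply/idP/idP => [/set_mem[_ /=]|Tz].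
    by rewrite le_eqVlt => /predU1P[zT|//]; case: Mz; apply: sM; left.
  by apply/mem_set; split=> //=; exact: ltW.
suff CL : pairing (fun z => old_weight n z * old_target T n z) (m T) @[n --> \oo] -->
    \int[m T]_(z in quadrant) ((T < z.2)%R%:R * (0 < S z)%R%:R).
  apply: (ler_cvg_to CL (cvg_cst _) _); apply: nearW => n; exact: old_mass_stopped.
apply: (@cvg_Rintegral _ _ _ (m T) _ _ _ (cst 1)) => //.
- move=> n; have [k ck] := C1_age_ge T n.
  have cF := C1_quadM (C1_quadM (C1_chi2 n.+1%:R) (C1_invS gP SgC1 (e0 n)))
    (C1_quadM (C1_trunc_S n) (C1_quad_snd ck)).
  have := measurable_on_quadrant (C1_quad_cont cF); apply: eq_measurable_fun => z /set_mem zq.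
  by rewrite E.
- apply: (@bounded_integrable _ _ _ (m T) _ _ 1) => //.
    by rewrite ltey_eq fin_num_measure.
  by move=> z _; rewrite normr1.
- move=> z zq; apply: cvg_trans (near_eq_cvg _) (_ : (fun n =>
    chi2 n.+1%:R z * (invS g n.+1%:R^-1 z * trunc_id n.+1%:R^-1 (S z)) * age_ge T n z.2) @ \oo --> _).
    by apply: nearW => n; rewrite E//; ring.
  have -> : (T < z.2)%R%:R * (0 < S z)%R%:R = 1 * (0 < S z)%R%:R * (T < z.2)%R%:R :> R.
    by rewrite mul1r mulrC.
  apply: cvgM; last exact: cvg_age_ge.
  apply: cvgM; first exact: cvg_chi2.
  have := Sg_ge0 gP zq; rewrite le_eqVlt => /predU1P[<-|Sz].
    rewrite ltxx; under eq_fun do rewrite trunc_id0 ?mulr0 ?invr_ge0//.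
    exact: cvg_cst.
  have -> : (0 < S z)%R%:R = (S z)^-1 * S z :> R by rewrite Sz mulVf// gt_eqF.
  apply: cvg_trans (near_eq_cvg _) (_ : (fun n => (S z)^-1 * trunc_id n.+1%:R^-1 (S z)) @ \oo --> _).
    have : \forall n \near \oo, n.+1%:R^-1 < S z :> R by exact: (near_infty_natSinv_lt (PosNum Sz)).
    by apply: filterS => n nS; rewrite invSE// ltW.
  by apply: cvgM; [exact: cvg_cst|apply: cvg_trunc_id; exact: ltW].
- move=> n z zq; rewrite /old_weight -mulrA.
  have /andP[u0 u1] := old_weight_target_le1 T n zq zq (lexx _) (lexx _).
  have [z1 z2] := zq.
  rewrite ger0_norm; last by apply: mulr_ge0 => //; exact: chi2_ge0.
  apply: mulr_ile1 => //; first exact: chi2_ge0.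
  by apply: mulr_ile1; rewrite ?sqp_ge0 ?chi_le1.
Qed.

(** S may vanish, so the denominator is regularized by 1/(n+1); at zeros of S the numerator vanishes
    as well and the limit agrees with the convention 0. *)
Lemma measurable_survival_ratio t : 0 <= t ->
  measurable_fun (quadrant : set (plane R)) (fun z => S (z.1, z.2 + t) / S z).
Proof.
move=> t0; have [Sc _ _ _ _] := C1_quad_Sg SgC1.
have shiftc : continuous ((fun z => S (z.1, z.2 + t)) \o clamp).
  have -> : (fun z => S (z.1, z.2 + t)) \o clamp =
      (S \o clamp) \o (fun z => ((clamp z).1, (clamp z).2 + t)).
    apply/funext => z /=; rewrite clamp_id//; have [z1 z2] := quadrant_clamp z.
    by split=> //=; rewrite addr_ge0.
  move=> z; apply: (@continuous_cvg _ _ _ _ _ (fun z => ((clamp z).1, (clamp z).2 + t)) (S \o clamp)).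
    exact: Sc.
  have c1 : (clamp w).1 @[w --> z] --> (clamp z).1 := @continuous_clamp1 R z.
  have c2 : (clamp w).2 + t @[w --> z] --> (clamp z).2 + t.
    by apply: cvgD; [exact: continuous_clamp2|exact: cvg_cst].
  exact: cvg_pair c1 c2.
have mr (n : nat) : measurable_fun (quadrant : set (plane R)) (fun z => S (z.1, z.2 + t) / (S z + n.+1%:R^-1)).
  apply: measurable_on_quadrant => z.
  apply: cvgM; first exact: shiftc.
  apply: cvgV; last by apply: cvgD; [exact: Sc|exact: cvg_cst].
  by rewrite gt_eqF// ltr_wpDl ?invr_gt0// Sg_ge0//; exact: quadrant_clamp.
apply: (measurable_fun_cvg mr) => z zq.
have := Sg_ge0 gP zq; rewrite le_eqVlt => /predU1P[Sz|Sz].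
    have -> : S (z.1, z.2 + t) = 0.
      have [z1 z2] := zq; apply/eqP; rewrite eq_le Sg_ge0 ?andbT//; last first.
        by split=> //=; rewrite addr_ge0.
      by rewrite Sz; apply: le_Sg => //=; rewrite lerDl.
    by rewrite mul0r; under eq_fun do rewrite mul0r; exact: cvg_cst.
  apply: cvgM; first exact: cvg_cst.
  apply: cvgV; first by rewrite gt_eqF.
  by rewrite -[X in _ --> X]addr0; apply: cvgD; [exact: cvg_cst|exact: cvg_harmonic].
Qed.

Lemma cvg_survival_ratio :
  \int[m 0]_(z in quadrant) (S (z.1, z.2 + n%:R) / S z) @[n --> \oo] --> 0.
Proof.
have mQ := @measurable_quadrant R.
have := @cvg_Rintegral _ _ _ (m 0) quadrant
  (fun n z => S (z.1, z.2 + n%:R) / S z) (fun=> 0) (cst 1) mQ.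
rewrite Rintegral_cst// mul0r; apply.
- by move=> n; exact: measurable_survival_ratio.
- apply: (@bounded_integrable _ _ _ (m 0) _ _ 1) => //.
    by rewrite ltey_eq fin_num_measure.
  by move=> z _; rewrite normr1.
- move=> z [z1 z2]; rewrite -(mul0r (S z)^-1); apply: cvgM; last exact: cvg_cst.
  have := cvg_Sg0 gP z1 => /cvgrPdist_le S0.
  apply/cvgrPdist_le => d d0; have [M [_ MS]] := S0 d d0.
  near=> n; apply: MS; apply: (@lt_le_trans _ _ n%:R); last by rewrite lerDr.
  by near: n; exact: nbhs_infty_gtr.
- by move=> n z zq; have /andP[r0 r1] := survival_ratio zq (ler0n R n); rewrite ger0_norm.
Unshelve. all: by end_near. Qed.

(** The bound of [old_mass_le] is nonincreasing in T, so its limit along the integers is enough. *)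
Lemma cvg_old_mass : fine (m T (old_set T)) @[T --> +oo] --> 0.
Proof.
apply/cvgrPdist_le => e e0.
have [n ne] : exists n : nat, \int[m 0]_(z in quadrant) (S (z.1, z.2 + n%:R) / S z) <= e.
  have [n _ /(_ n (leqnn n)) /=] := cvgr_le _ cvg_survival_ratio _ e0.
  by exists n.
near=> T; have nT : n%:R <= T by near: T; apply: nbhs_pinfty_ge; exact: num_real.
have T0 : 0 < T by near: T; apply: nbhs_pinfty_gt; exact: num_real.
rewrite sub0r normrN ger0_norm ?fine_ge0//.
apply: (le_trans (old_mass_le T0)); apply: le_trans ne.
apply: le_lower_Rintegral => [z zq||z zq]; last first.
- apply: ler_wpM2r; first by rewrite invr_ge0 Sg_ge0.
  have [z1 z2] := zq; apply: le_Sg => //=; last by rewrite lerD2l.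
  by split=> //=; rewrite addr_ge0.
- exact: survival_ratio_fin.
- by have /andP[] := survival_ratio zq (ler0n R n).
Unshelve. all: by end_near. Qed.

End old_mass.

(** * The limit measure *)

Section limit_measure.
Context {R : realType} (lambda0 : R) (g : R * R -> R).
Hypothesis lambda0_gt0 : 0 < lambda0.
Hypothesis gP : probability_density g.
Hypothesis SgC1 : C1_quadrant (Sg g).
Variable mi : {measure set (plane R) -> \bar R}.
Hypothesis miP : is_mu_infty lambda0 g mi.
Local Notation leb := (@lebesgue_measure R).
Local Notation S := (Sg g).
Local Notation ystar := (ystar lambda0 g).
Local Notation cap := (cap_ystar lambda0 g).

Lemma continuous_cap : continuous cap.
Proof.
case E : ystar => [k| |]; last by have := ystar_ge0 lambda0 g; rewrite E.
  have -> : cap = (fun u => Num.min u k) by apply/funext => u; exact: cap_fin.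
  by move=> u; apply: continuous_min; [exact: cvg_id|exact: cvg_cst].
have -> : cap = id by apply/funext => u; rewrite cap_id// E ltry.
by move=> u; exact: cvg_id.
Qed.

Lemma cap_le u : 0 <= u -> cap u <= u.
Proof. by move=> u0; rewrite -(@cap_min _ lambda0 g u u)// ge_min lexx. Qed.

(** The limit measure may be infinite; the Radon property on a box containing the support gives
    integrability. *)
Lemma compact_support_integrable (F : R * R -> R) (K N : R) :
  measurable_fun (quadrant : set (plane R)) F ->
  (forall z, quadrant z -> `|F z| <= K) ->
  (forall z, quadrant z -> F z != 0 -> z.1 <= N /\ z.2 <= N) ->
  mi.-integrable quadrant (EFin \o F).
Proof.
move=> mF FK FN; pose box : set (R * R) := `[0, N] `*` `[0, N].
have mbox : measurable (box : set (plane R)) by apply: measurableX; exact: measurable_itv.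
have mQ := @measurable_quadrant R.
have bQ : box `<=` quadrant.
  by move=> z [/= + +]; rewrite !in_itv/= => /andP[? _] /andP[? _].
have [_ rad _] := miP.
have boxfin : (mi box < +oo)%E.
  by apply: rad; apply: compact_setX; exact: segment_compact.
have : mi.-integrable (quadrant `&` box) (EFin \o F).
  rewrite setIidr//; apply: (@bounded_integrable _ _ _ mi _ _ K) => //.
    exact: measurable_funS mF.
  by move=> z /bQ; exact: FK.
move=> /(integrable_restrict mi mbox mQ (EFin \o F)).
apply: eq_integrable => // z /set_mem zq.
rewrite /patch; case: ifPn => // zb; apply/eqP; rewrite eq_sym /= eqe.
apply: contraNT zb => Fz; have [z1 z2] := FN z zq Fz; have [z10 z20] := zq.
by apply/mem_set; split; rewrite /= in_itv/= ?z10 ?z20.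
Qed.

Lemma Cc_quadrant (F : R * R -> R) (N : R) : continuous (F \o clamp) ->
  (forall z, quadrant z -> F z != 0 -> z.1 <= N /\ z.2 <= N) -> Cc quadrant F.
Proof.
move=> Fc FN; split; first exact/within_continuousE.
exists (`[0, N] `*` `[0, N]); split.
- by apply: compact_setX; exact: segment_compact.
- by move=> z [/= + +]; rewrite !in_itv/= => /andP[? _] /andP[? _].
- move=> z zq nK; apply/eqP; apply: contra_notT nK => Fz.
  by have [z1 z2] := FN z zq Fz; have [z10 z20] := zq; split; rewrite /= in_itv/= ?z10 ?z20.
Qed.

(** The test |x - cap y| times a cutoff vanishes along the curve defining the limit, so its integral
    is 0; continuity suffices for tests here. *)
Lemma limit_null_off_cap : mi.-negligible [set z | quadrant z /\ z.1 != cap z.2].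
Proof.
have mQ := @measurable_quadrant R.
pose F n (z : R * R) := `|z.1 - cap z.2| * chi2 n.+1%:R z.
have Fc n : continuous (F n \o clamp).
  move=> z; apply: cvgM; last exact: C1_quad_cont (C1_chi2 n.+1%:R) z.
  apply: cvg_norm; apply: cvgB; first exact: continuous_clamp1.
  by apply: (@continuous_cvg _ _ _ _ _ (fun z => (clamp z).2) cap);
    [exact: continuous_cap|exact: continuous_clamp2].
have FN n z : quadrant z -> F n z != 0 -> z.1 <= n.+1%:R /\ z.2 <= n.+1%:R.
  by move=> zq; rewrite mulf_eq0 negb_or chi2_neq0// => /andP[_ /andP[? ?]]; split; exact: ltW.
have F0 n z : quadrant z -> 0 <= F n z by move=> _; rewrite mulr_ge0// chi2_ge0.
have H n : mi.-negligible [set z | quadrant z /\ F n z != 0].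
  have [K FK] := compact_support_bounded (Fc n) (FN n).
  apply: pairing_null_integrable; [|exact: F0|].
    exact: (compact_support_integrable (measurable_on_quadrant (Fc n)) FK (FN n)).
  have [_ _ ->] := miP; last exact: Cc_quadrant (Fc n) (FN n).
  rewrite (@eq_Rintegral _ _ _ leb _ (fun=> 0)).
    by rewrite Rintegral_cst ?mul0r ?mulr0//; exact: measurable_itv.
  by move=> u _; rewrite /F/= subrr normr0 !mul0r.
apply: negligibleS (negligible_bigcup H) => z /= [zq zz].
have [n zn] : exists n : nat, (z.1 < n.+1%:R) && (z.2 < n.+1%:R).
  have [M1 M2] := (truncnS_gt z.1, truncnS_gt z.2).
  exists (maxn (Num.truncn z.1) (Num.truncn z.2)).
  by apply/andP; split; [apply: lt_le_trans M1 _|apply: lt_le_trans M2 _];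
    rewrite ler_nat ltnS ?leq_maxl ?leq_maxr.
exists n => //; split=> //; rewrite /F mulf_neq0// ?chi2_neq0//.
by rewrite normr_eq0 subr_eq0.
Qed.

Let cap_profile_cont : continuous (fun u : R => (S \o clamp) (cap u, u)).
Proof.
move=> u; apply: (@continuous_cvg _ _ _ _ _ (fun u => (cap u, u)) (S \o clamp)).
  exact: C1_quad_cont (C1_quad_Sg SgC1) _.
have c1 : cap v @[v --> u] --> cap u := @continuous_cap u.
have c2 : v @[v --> u] --> u by exact: cvg_id.
exact: cvg_pair c1 c2.
Qed.

Lemma quadrant_cap u : 0 <= u -> quadrant (cap u, u).
Proof. by move=> u0; split=> //=; exact: cap_ge0. Qed.

Lemma measurable_cap_profile : measurable_fun (`[0, +oo[ : set (measurableTypeR R))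
  (fun u => S (cap u, u)).
Proof.
apply: (eq_measurable_fun (fun u : R => (S \o clamp) (cap u, u))).
  move=> u /set_mem; rewrite /= in_itv/= andbT => u0.
  by rewrite /= clamp_id//; exact: quadrant_cap.
by apply: measurable_funTS; exact: continuous_measurable_fun cap_profile_cont.
Qed.

(** A strip is unbounded in x, so its indicator is not approximated by compactly supported tests
    directly. A plateau in x is inserted, which equals 1 on the curve because cap y <= y < t. *)
Lemma limit_strip_mass t : 0 <= t -> (mi (strip 0 t) < +oo)%E /\
  fine (mi (strip 0 t)) = lambda0 * \int[leb]_(u in `[0, t]) S (cap u, u).
Proof.
move=> t0; have mQ := @measurable_quadrant R.
pose F n (z : R * R) := plateau t z.1 * smooth_indic n (-1) t z.2.
pose G (z : R * R) : R := plateau t z.1 * (z.2 < t)%R%:R.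
have cF n : continuous (F n \o clamp).
  have [k ck] := C1_smooth_indic n (-1) t.
  exact: C1_quad_cont (C1_quadM (C1_quad_fst (C1_plateau t)) (C1_quad_snd ck)).
have FN n z : quadrant z -> F n z != 0 -> z.1 <= t + 1 /\ z.2 <= t + 1.
  move=> zq; rewrite mulf_eq0 negb_or smooth_indic_neq0 => /andP[/plateau_neq0 z1 /andP[_ z2]].
  by split=> //; rewrite ltW// (lt_le_trans z2)// lerDl.
have plat1 u : 0 <= plateau t u <= 1.
  rewrite plateau_ge0 /= -(@expr1n R 2) -sqpE//; apply: le_sqp.
  by rewrite gerDr mulN1r oppr_le0 sqp_ge0.
have GN z : quadrant z -> G z != 0 -> z.1 <= t + 1 /\ z.2 <= t + 1.
  move=> zq; rewrite mulf_eq0 negb_or pnatr_eq0 eqb0 negbK => /andP[/plateau_neq0 z1 z2].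
  by split=> //; rewrite ltW// (lt_le_trans z2)// lerDl.
have F_G z : quadrant z -> F n z @[n --> \oo] --> G z.
  move=> [_ z2]; apply: cvgM; first exact: cvg_cst.
  have := @cvg_smooth_indic _ (-1) t z.2.
  by rewrite (lt_le_trans _ z2) ?ltrN10.
have mF n := measurable_on_quadrant (cF n).
have mG : measurable_fun (quadrant : set (plane R)) G by apply: (measurable_fun_cvg mF) => z; exact: F_G.
have iG : mi.-integrable quadrant (EFin \o G).
  apply: (compact_support_integrable mG (K := 1) _ GN) => z zq.
  have /andP[p0 p1] := plat1 z.1.
  rewrite /G ger0_norm; last exact: mulr_ge0.
  by apply: mulr_ile1 => //; case: (_ < _).
have CL : pairing (F n) mi @[n --> \oo] --> \int[mi]_(z in quadrant) G z.
  (* The limit [G] itself dominates, as the smooth indicators approximate from below; a constant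
     need not be integrable for [mi]. *)
  apply: (@cvg_Rintegral _ _ _ mi _ _ _ G) => // n z zq.
  have /andP[p0 p1] := plat1 z.1.
  rewrite ger0_norm; last by apply: mulr_ge0 => //; exact: smooth_indic_ge0.
  apply: ler_wpM2l => //.
  have [->|] := eqVneq (smooth_indic n (-1) t z.2) 0; first by rewrite ler0n.
  by rewrite smooth_indic_neq0 => /andP[_ ->]; rewrite smooth_indic_le1.
have mI : measurable (`[0, +oo[%classic : set R) by exact: measurable_itv.
have CR : pairing (F n) mi @[n --> \oo] -->
    lambda0 * \int[leb]_(u in `[0, t]) S (cap u, u).
  have FE n : pairing (F n) mi =
      lambda0 * \int[leb]_(u in `[0, +oo[) (smooth_indic n (-1) t u * S (cap u, u)).
    have [_ _ ->] := miP; last exact: Cc_quadrant (cF n) (FN n).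
    congr (_ * _); apply: eq_Rintegral => u; rewrite inE/= in_itv/= andbT => u0.
    have [q0|] := eqVneq (smooth_indic n (-1) t u) 0; first by rewrite /F/= q0 mulr0.
    rewrite smooth_indic_neq0 => /andP[_ ut].
    by rewrite /F/= plateau1 ?mul1r// (le_trans (cap_le u0))// ltW.
  under eq_fun do rewrite FE.
  apply: cvgM; first exact: cvg_cst.
  have mP := measurable_cap_profile.
  have mt : measurable (`[0, t[%classic : set R) by exact: measurable_itv.
  have t_sub : `[0, t[ `<=` (`[0, +oo[%classic : set R).
    by move=> u; rewrite /= !in_itv/= => /andP[-> _].
  have mPt : measurable_fun (`[0, t[%classic : set (measurableTypeR R)) (fun u => S (cap u, u)).
    exact: measurable_funS mP.
  have SP u : 0 <= u -> 0 <= S (cap u, u) <= 1.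
    by move=> u0; rewrite Sg_ge0 ?Sg_le1//; exact: quadrant_cap.
  pose h (u : R) : R := ((fun u => S (cap u, u)) \_ `[0, t[) u.
  have iSt : leb.-integrable (`[0, t[%classic : set R) (EFin \o (fun u => S (cap u, u))).
    apply: (@bounded_integrable _ _ _ leb _ _ 1) => //; first exact: leb_itv_fin.
    by move=> u /t_sub; rewrite /= in_itv/= andbT => /SP /andP[? ?]; rewrite ger0_norm.
  have ih : leb.-integrable (`[0, +oo[%classic : set R) (EFin \o h).
    have : leb.-integrable (`[0, +oo[ `&` `[0, t[) (fun u => (S (cap u, u))%:E).
      by rewrite setIidr.
    move=> /(integrable_restrict leb mt mI); apply: eq_integrable => // u _.
    by rewrite /h /patch /=; case: ifP.
  have -> : \int[leb]_(u in `[0, t]) S (cap u, u) = \int[leb]_(u in `[0, +oo[) h u.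
    by rewrite -Rintegral_mkcondr setIidr// Rintegral_itv_bndo_bndc.
  apply: (@cvg_Rintegral _ _ _ leb (`[0, +oo[%classic : set R)
    (fun n u => smooth_indic n (-1) t u * S (cap u, u)) h h) => //.
  - move=> n; apply: measurable_funM => //.
    have [k ck] := C1_smooth_indic n (-1) t.
    apply: measurable_funTS; apply: continuous_measurable_fun; exact: C1_real_continuous ck.
  - move=> u; rewrite /= in_itv/= andbT => u0.
    have -> : h u = (u < t)%R%:R * S (cap u, u).
      rewrite /h /patch mem_setE in_itv/= u0; case: (u < t); by rewrite ?mul1r ?mul0r.
    apply: cvgM; last exact: cvg_cst.
    have := @cvg_smooth_indic _ (-1) t u.
    by rewrite (lt_le_trans _ u0) ?ltrN10.
  - move=> n u; rewrite /= in_itv/= andbT => u0; have /andP[S0 S1] := SP u u0.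
    rewrite ger0_norm; last by apply: mulr_ge0 => //; exact: smooth_indic_ge0.
    have -> : h u = (u < t)%R%:R * S (cap u, u).
      rewrite /h /patch mem_setE in_itv/= u0; case: (u < t); by rewrite ?mul1r ?mul0r.
    apply: ler_wpM2r => //; have [->|] := eqVneq (smooth_indic n (-1) t u) 0.
      by rewrite ler0n.
    by rewrite smooth_indic_neq0 => /andP[_ ->]; exact: smooth_indic_le1.
have GE : \int[mi]_(z in quadrant) G z = lambda0 * \int[leb]_(u in `[0, t]) S (cap u, u).
  exact: (cvg_unique _ CL CR).
have mS := measurable_strip (0 : R) t.
have [M [mM M0 sM]] := limit_null_off_cap.
have EG : (\int[mi]_(z in quadrant) (G z)%:E = mi (strip 0%R t))%E.
  rewrite (@eq_integral_null _ _ _ mi quadrant M _ (fun z => (\1_(strip 0 t) z)%:E) mM M0).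
    rewrite integral_indic//.
    by rewrite setIidl// => z [].
  move=> z zq Mz; congr EFin.
  have zc : z.1 = cap z.2.
    by apply/eqP; apply/negPn/negP => zc; apply: Mz; apply: sM.
  rewrite /G indicE; have [zt|tz] := ltP z.2 t; last first.
    rewrite mulr0; case: (boolP (z \in _)) => // /set_mem[_ /= /andP[_]].
    by rewrite ltNge tz.
  rewrite mem_set; last by split=> //=; rewrite zt andbT; case: zq.
  rewrite plateau1 ?mul1r// zc (le_trans (cap_le _))//; last exact: ltW.
  by case: zq.
have fin := integrable_fin_num mQ iG.
split; last by rewrite -GE -EG.
by rewrite -EG ltey_eq fin.
Qed.

End limit_measure.

(** * Measures carried by a graph over the age axis *)

Section measures_on_graph.
Context {R : realType}.

Definition snd_restr (M : {measure set (plane R) -> \bar R}) (D : set (plane R))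
    (mD : measurable D) : {measure set (measurableTypeR R) -> \bar R} :=
  measure_function_pushforward__canonical__measure_function_Measure
    (mrestr M mD) (@measurable_snd _ _ (measurableTypeR R) (measurableTypeR R)).

Lemma snd_restrE M D mD B : @snd_restr M D mD B = M (snd @^-1` B `&` D).
Proof. by []. Qed.

(** The age marginals agree on the half-lines ]-oo, x[, which are stable under intersection and
    generate the Borel sets. *)
Lemma eq_measure_snd (M1 M2 : {measure set (plane R) -> \bar R}) (T : R) : 0 <= T ->
  (forall t, 0 <= t -> t <= T -> M1 (strip 0 t) = M2 (strip 0 t)) ->
  (M1 (strip 0 T) < +oo)%E ->
  forall B : set (measurableTypeR R), measurable B ->
    M1 (snd @^-1` B `&` strip 0 T) = M2 (snd @^-1` B `&` strip 0 T).
Proof.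
move=> T0 M12 fin B mB; have mS := measurable_strip (0 : R) T.
rewrite -!(snd_restrE _ mS).
apply: (@measure_unique _ _ (measurableTypeR R) (@RGenInftyO.G R)
  (fun n => `]-oo, n%:R[%classic) _ _ _ _ (snd_restr M1 mS) (snd_restr M2 mS)) => //.
- exact: RGenInftyO.measurableE.
- move=> _ _ [x ->] [y ->]; exists (Num.min x y).
  by apply/seteqP; split=> u /=; rewrite !in_itv/= lt_min => /andP.
- by move=> n; exists n%:R.
- apply/seteqP; split=> // u _; exists (Num.truncn u).+1 => //.
  by rewrite /= in_itv/= truncnS_gt.
- move=> _ [x ->]; rewrite !snd_restrE.
  have E : snd @^-1` `]-oo, x[ `&` strip 0 T = strip 0 (Num.min x T) :> set (plane R).
    apply/seteqP; split=> z.
      by move=> [/=]; rewrite in_itv/= => zx [zq /andP[z0 zT]]; split=> //=; rewrite z0 lt_min zx.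
    by move=> [zq /= /andP[z0]]; rewrite lt_min => /andP[zx zT]; split; [rewrite /= in_itv|split=> //=; rewrite z0].
  rewrite E; have [x0|x0] := leP 0 x.
    by apply: M12; rewrite ?le_min ?x0// ge_min lexx orbT.
  suff -> : strip 0 (Num.min x T) = set0 by rewrite !measure0.
  apply/seteqP; split=> // z [_ /= /andP[z0]]; rewrite lt_min => /andP[zx _].
  by move: (lt_trans (le_lt_trans z0 zx) x0); rewrite ltxx.
- move=> k; rewrite snd_restrE; apply: le_lt_trans fin; apply: le_measure; rewrite ?inE//.
  apply: measurableI => //; rewrite -[X in measurable X]setTI.
  by apply: measurable_snd => //; exact: measurable_itv.
Qed.

(** Up to a null set, A agrees on the strip with the set of points whose age y satisfies A (c y, y);
    so the age marginal determines the measure. *)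
Lemma eq_measure_graph (M1 M2 : {measure set (plane R) -> \bar R}) (c : R -> R) (T : R) :
  0 <= T -> continuous c ->
  M1.-negligible [set z | strip 0 T z /\ z.1 != c z.2] ->
  M2.-negligible [set z | strip 0 T z /\ z.1 != c z.2] ->
  (forall t, 0 <= t -> t <= T -> M1 (strip 0 t) = M2 (strip 0 t)) ->
  (M1 (strip 0 T) < +oo)%E ->
  forall A : set (plane R), measurable A -> M1 (A `&` strip 0 T) = M2 (A `&` strip 0 T).
Proof.
move=> T0 cc N1 N2 M12 fin A mA; have mS := measurable_strip (0 : R) T.
pose B : set (measurableTypeR R) := [set y | A (c y, y)].
have mB : measurable B.
  have mcf : measurable_fun setT (fun y : measurableTypeR R => (c y, y) : plane R).
    by apply: measurable_fun_pair => //; exact: continuous_measurable_fun.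
  by have := mcf measurableT A mA; rewrite setTI.
have mB2 : measurable (snd @^-1` B `&` strip 0 T : set (plane R)).
  apply: measurableI => //; rewrite -[X in measurable X]setTI.
  exact: measurable_snd.
have mAS : measurable (A `&` strip 0 T) by exact: measurableI.
have E (M : {measure set (plane R) -> \bar R}) :
    M.-negligible [set z | strip 0 T z /\ z.1 != c z.2] ->
    M (A `&` strip 0 T) = M (snd @^-1` B `&` strip 0 T).
  move=> [N [mN N0 sN]].
  have cz z : strip 0 T z -> ~ N z -> z = (c z.2, z.2).
    move=> zS Nz; rewrite {1}[z]surjective_pairing; congr pair.
    by apply/eqP; apply/negPn/negP => zc; apply: Nz; apply: sN.
  apply/eqP; rewrite eq_le; apply/andP; split.
    rewrite -[leRHS]adde0 -N0; apply: (le_trans _ (measureU2 M mB2 mN)).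
    apply: le_measure; rewrite ?inE//; first exact: measurableU.
    move=> z [Az zS]; have [Nz|Nz] := pselect (N z); [by right|left].
    by split=> //; rewrite /B /= -(cz z).
  rewrite -[leRHS]adde0 -N0; apply: (le_trans _ (measureU2 M mAS mN)).
  apply: le_measure; rewrite ?inE//; first exact: measurableU.
  move=> z [Bz zS]; have [Nz|Nz] := pselect (N z); [by right|left].
  by split=> //; rewrite (cz z).
by rewrite !E//; exact: eq_measure_snd.
Qed.

Lemma pairing_split (M : {measure set (plane R) -> \bar R}) (T : R) (f : R * R -> R) (K : R) :
  (M quadrant < +oo)%E ->
  measurable_fun (quadrant : set (plane R)) f -> (forall z, quadrant z -> `|f z| <= K) ->
  pairing f M = \int[M]_(z in strip 0 T) f z + \int[M]_(z in old_set T) f z.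
Proof.
move=> fin mf fK; have mS := measurable_strip (0 : R) T; have mO := @measurable_old_set R T.
have mQ := @measurable_quadrant R.
have E : strip 0 T `|` old_set T = quadrant :> set (plane R).
  apply/seteqP; split=> z; first by move=> [] [].
  by move=> zq; have [zT|Tz] := ltP z.2 T; [left|right]; split=> //=; rewrite zT andbT; case: zq.
rewrite -Rintegral_setU ?E//; last first.
  apply/disj_setPS => z [[_ /= /andP[_ zT]] [_ /= Tz]].
  by move: (lt_le_trans zT Tz); rewrite ltxx.
exact: (@bounded_integrable _ _ _ M _ _ K).
Qed.

End measures_on_graph.

(** * Agreement of solutions with the limit measure, and convergence *)

Section convergence.
Context {R : realType} (lambda0 : R) (g : R * R -> R).
Hypothesis lambda0_gt0 : 0 < lambda0.
Hypothesis gP : probability_density g.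
Hypothesis SgC1 : C1_quadrant (Sg g).
Variable mi : {measure set (plane R) -> \bar R}.
Hypothesis miP : is_mu_infty lambda0 g mi.
Local Notation leb := (@lebesgue_measure R).
Local Notation S := (Sg g).
Local Notation cap := (cap_ystar lambda0 g).

Section solution.
Variable m : R -> {finite_measure set (plane R) -> \bar R}.
Hypothesis msol : fluid_solution lambda0 g m.

Lemma solution_strip T : 0 <= T -> forall A : set (plane R), measurable A ->
  m T (A `&` strip 0 T) = mi (A `&` strip 0 T).
Proof.
move=> T0; apply: (eq_measure_graph T0 (@continuous_cap _ lambda0 g)).
- apply: negligibleS (null_off_cap lambda0_gt0 gP SgC1 msol T0) => z /= [[zq /= /andP[_ zT]] zc].
  by split.
- by apply: negligibleS (limit_null_off_cap miP) => z /= [[zq _] zc].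
- move=> t t0 tT; have [fin E] := limit_strip_mass gP SgC1 miP t0.
  rewrite -[RHS]fineK ?E ?ge0_fin_numE//.
  by rewrite -(mass_below_cap lambda0_gt0 gP SgC1 msol t0 tT); exact/esym/strip_mass_EFin.
- by rewrite ltey_eq fin_num_measure//; exact: measurable_strip.
Qed.

Lemma pairing_strip (T : R) (f : R * R -> R) : 0 <= T ->
  \int[m T]_(z in strip 0 T) f z = \int[mi]_(z in strip 0 T) f z.
Proof.
move=> T0; congr fine; apply: eq_measure_integral => A mA AS.
by rewrite -(setIidl AS); exact: solution_strip.
Qed.

Lemma solution_split T : 0 <= T -> forall A : set (plane R), measurable A ->
  m T A = (mi (A `&` strip 0%R T) + m T (A `&` old_set T))%E.
Proof.
move=> T0 A mA; have mS := measurable_strip (0 : R) T; have mO := @measurable_old_set R T.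
rewrite -solution_strip// -measureU//; [|exact: measurableI|exact: measurableI|]; last first.
  apply/seteqP; split=> // z [[_ [_ /= /andP[_ zT]]] [_ [_ /= Tz]]].
  by move: (lt_le_trans zT Tz); rewrite ltxx.
have -> : A `&` strip 0 T `|` A `&` old_set T = A `&` quadrant.
  apply/seteqP; split=> z; first by move=> [[Az [zq _]]|[Az [zq _]]].
  move=> [Az zq]; have [zT|Tz] := ltP z.2 T; [left|right]; split=> //; split=> //=.
  by rewrite zT andbT; case: zq.
have mQ := @measurable_quadrant R.
rewrite -[in LHS](setIT A) -(setUv quadrant) setIUr measureU//; first last.
- by rewrite setIACA setICr setI0.
- by apply: measurableI => //; exact: measurableC.
- exact: measurableI.
have [[onq _ _] _ _ _ _] := msol.
rewrite [X in (_ + X)%E](_ : _ = 0%E) ?adde0//.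
apply/eqP; rewrite -measure_le0 -(onq T T0); apply: le_measure; rewrite ?inE//.
- by apply: measurableI => //; exact: measurableC.
- exact: measurableC.
Qed.

Lemma solution_pairing_split (T : R) (f : R * R -> R) (K : R) : 0 <= T ->
  measurable_fun (quadrant : set (plane R)) f -> (forall z, quadrant z -> `|f z| <= K) ->
  pairing f (m T) = \int[mi]_(z in strip 0 T) f z + \int[m T]_(z in old_set T) f z.
Proof.
move=> T0 mf fK; rewrite -pairing_strip//; apply: pairing_split mf fK.
by rewrite ltey_eq fin_num_measure//; exact: measurable_quadrant.
Qed.

(** An equality at finite time rather than a limit: a test that sees only ages below T sees only the
    strip on which both measures coincide. *)
Lemma solution_pairing_eventually (f : R * R -> R) (T : R) : 0 <= T ->
  (forall z, quadrant z -> T <= z.2 -> f z = 0) -> pairing f (m T) = pairing f mi.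
Proof.
move=> T0 f0.
have E (M : {measure set (plane R) -> \bar R}) : pairing f M = \int[M]_(z in strip 0 T) f z.
  rewrite /pairing Rintegral_mkcond [RHS]Rintegral_mkcond; congr Rintegral; apply/funext => z.
  rewrite /patch; case: ifPn => [/set_mem zq|zq]; case: ifPn => // zS.
    have [zT|Tz] := ltP z.2 T; last exact: f0.
    by case/negP: zS; apply/mem_set; split=> //=; rewrite zT andbT; case: zq.
  by case/negP: zq; apply/mem_set; case: (set_mem zS).
by rewrite E [RHS]E; exact: pairing_strip.
Qed.

End solution.

Lemma Cc_bounded_age (f : R * R -> R) : Cc quadrant f ->
  exists N : R, forall z, quadrant z -> N <= z.2 -> f z = 0.
Proof.
move=> [_ [K [cK KQ fK]]].
have snd_cont : continuous (@snd R R) by move=> z; exact: cvg_snd.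
have /compact_bounded[M [_ /(_ (`|M| + 1))]] :=
  continuous_compact (continuous_subspaceT (A := K) snd_cont) cK.
have MM : M < `|M| + 1 by rewrite (le_lt_trans (ler_norm M))// ltrDl.
move=> /(_ MM) KM; exists (`|M| + 2) => z zq Mz; apply: fK => // Kz.
have : `|z.2| <= `|M| + 1 by apply: KM; exists z.
by rewrite ler_norml => /andP[_]; move: Mz; lra.
Qed.

Lemma Cb_measurable (f : R * R -> R) : Cb quadrant f ->
  measurable_fun (quadrant : set (plane R)) f /\ exists K, forall z, quadrant z -> `|f z| <= K.
Proof.
by move=> [fc bf]; split=> //; apply: measurable_on_quadrant; exact/within_continuousE.
Qed.

Lemma Rintegral_bound (M : {measure set (plane R) -> \bar R}) (D : set (plane R)) (f : R * R -> R) (K : R) :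
  measurable D -> D `<=` quadrant -> (M D < +oo)%E ->
  measurable_fun (quadrant : set (plane R)) f -> (forall z, quadrant z -> `|f z| <= K) ->
  `|\int[M]_(z in D) f z| <= K * fine (M D).
Proof.
move=> mD DQ fin mf fK; have mfD : measurable_fun D f.
  by apply: measurable_funS mf => //; exact: measurable_quadrant.
have fKD z : D z -> `|f z| <= K by move=> /DQ; exact: fK.
have fi : M.-integrable D (EFin \o f) by exact: (bounded_integrable mD fin mfD fKD).
rewrite -Rintegral_cst//; apply: le_trans (le_normr_Rintegral mD fi) _.
apply: le_Rintegral => //.
- apply: (bounded_integrable (K := K) mD fin) => [|z Dz].
    by apply: measurableT_comp => //; exact: measurable_normr.
  by rewrite normr_id fKD.
- by apply: (bounded_integrable (K := `|K|) mD fin).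
Qed.

Section finite_limit.
Hypothesis S_fin : (\int[leb]_(u in `[0%R, +oo[) (S (cap u, u))%:E < +oo)%E.

Let C : R := lambda0 * fine (\int[leb]_(u in `[0%R, +oo[) (S (cap u, u))%:E)%E.

Let S0 (u : R) : 0 <= u -> 0 <= S (cap u, u).
Proof. by move=> u0; apply: Sg_ge0 => //; exact: quadrant_cap. Qed.

Lemma limit_strip_le t : 0 <= t -> (mi (strip 0%R t) <= C%:E)%E.
Proof.
move=> t0; have [fin E] := limit_strip_mass gP SgC1 miP t0.
rewrite -[leLHS]fineK ?ge0_fin_numE// E lee_fin ler_pM2l//.
apply: fine_le.
- rewrite ge0_fin_numE; last by apply: integral_ge0 => u; rewrite /= in_itv/= => /andP[/S0].
  apply: le_lt_trans S_fin; apply: ge0_subset_integral => //; try exact: measurable_itv.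
  + by apply/measurable_EFinP; exact: measurable_cap_profile.
  + by move=> u; rewrite /= in_itv/= andbT lee_fin; exact: S0.
  + by move=> u; rewrite /= !in_itv/= => /andP[->].
- rewrite ge0_fin_numE//; last by apply: integral_ge0 => u; rewrite /= in_itv/= andbT => /S0.
- apply: ge0_subset_integral => //; try exact: measurable_itv.
  + by apply/measurable_EFinP; exact: measurable_cap_profile.
  + by move=> u; rewrite /= in_itv/= andbT lee_fin; exact: S0.
  + by move=> u; rewrite /= !in_itv/= => /andP[->].
Qed.

Lemma bigcup_strip : \bigcup_n strip 0 n%:R = quadrant :> set (plane R).
Proof.
apply/seteqP; split=> [z [n _ []]//|z zq]; exists (Num.truncn z.2).+1 => //.
by split=> //=; rewrite truncnS_gt andbT; case: zq.
Qed.

Lemma cvg_limit_strip :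
  mi (strip 0%R n%:R) @[n --> \oo] --> mi quadrant.
Proof.
rewrite -bigcup_strip; apply: (@nondecreasing_cvg_mu _ _ _ mi (fun n => strip 0 n%:R)).
- by move=> n; exact: measurable_strip.
- by rewrite bigcup_strip; exact: measurable_quadrant.
- move=> i j ij; apply/subsetPset => z [zq /= /andP[z0 zi]]; split=> //=.
  by rewrite z0 (lt_le_trans zi)// ler_nat.
Qed.

Lemma limit_quadrant_fin : (mi quadrant < +oo)%E.
Proof.
apply: (@le_lt_trans _ _ C%:E); last exact: ltry.
rewrite -(cvg_lim (@ereal_hausdorff _) cvg_limit_strip).
apply: lime_le; first by apply/cvg_ex; eexists; exact: cvg_limit_strip.
by apply: nearW => n; exact: limit_strip_le.
Qed.

Lemma limit_fin : (mi setT < +oo)%E.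
Proof.
have [onq _ _] := miP; have mQ := @measurable_quadrant R.
rewrite -(setUv quadrant) measureU//; [|exact: measurableC|exact: setICr].
by rewrite [X in (_ + X)%E](onq : _ = 0%E) adde0 limit_quadrant_fin.
Qed.

Lemma limit_old_fin t : (mi (old_set t) < +oo)%E.
Proof.
apply: le_lt_trans limit_quadrant_fin; apply: le_measure; rewrite ?inE.
- exact: measurable_old_set.
- exact: measurable_quadrant.
- by move=> z [].
Qed.

Lemma limit_split t : mi quadrant = (mi (strip 0%R t) + mi (old_set t))%E.
Proof.
rewrite -measureU; [|exact: measurable_strip|exact: measurable_old_set|].
  congr (mi _); apply/seteqP; split=> z; last by move=> [] [].
  by move=> zq; have [zT|Tz] := ltP z.2 t; [left|right]; split=> //=; rewrite zT andbT; case: zq.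
apply/seteqP; split=> // z [[_ /= /andP[_ zT]] [_ /= Tz]].
by move: (lt_le_trans zT Tz); rewrite ltxx.
Qed.

(** The limit measure is finite here, so its tails are differences of finite masses and vanish along
    the integers; monotonicity covers real t. *)
Lemma cvg_limit_old : fine (mi (old_set t)) @[t --> +oo] --> 0.
Proof.
have fS t : mi (strip 0%R t) \is a fin_num.
  rewrite ge0_fin_numE//; apply: le_lt_trans limit_quadrant_fin; apply: le_measure; rewrite ?inE.
  - exact: measurable_strip.
  - exact: measurable_quadrant.
  - by move=> z [].
have fO t : mi (old_set t) \is a fin_num by rewrite ge0_fin_numE// limit_old_fin.
have fQ : mi quadrant \is a fin_num by rewrite ge0_fin_numE// limit_quadrant_fin.
have oE t : fine (mi (old_set t)) = fine (mi quadrant) - fine (mi (strip 0%R t)).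
  by rewrite (limit_split t) fineD// addrAC subrr add0r.
have cS : fine (mi (strip 0%R n%:R)) @[n --> \oo] --> fine (mi quadrant).
  by apply: fine_cvg; rewrite fineK//; exact: cvg_limit_strip.
apply/cvgrPdist_le => e e0.
have [n ne] : exists n : nat, fine (mi (old_set n%:R)) <= e.
  have /cvgrPdist_le /(_ e e0) [n _ /(_ n (leqnn n)) /= h] := cS.
  by exists n; rewrite oE (le_trans (ler_norm _)).
near=> t; have nt : n%:R <= t by near: t; apply: nbhs_pinfty_ge; exact: num_real.
rewrite sub0r normrN ger0_norm ?fine_ge0//; apply: le_trans ne.
apply: fine_le => //; apply: le_measure; rewrite ?inE; try exact: measurable_old_set.
by move=> z [zq /= tz]; split=> //=; exact: le_trans tz.
Unshelve. all: by end_near. Qed.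

End finite_limit.

End convergence.

Theorem theorem3p6 (R : realType) (lambda0 : R) (g : R * R -> R)
    (lambda0_gt0 : 0 < lambda0)
    (g_density : probability_density g)
    (g_locally_bounded : locally_bounded_in_Ug g)
    (Sg_C1 : C1_quadrant (Sg g))
    (mu nu : R -> {finite_measure set plane R -> \bar R})
    (mu_sol : fluid_solution lambda0 g mu)
    (nu_sol : fluid_solution lambda0 g nu)
    (nu0 : forall A : set (plane R), measurable A -> nu 0 A = 0%E)
    (mu_infty : {measure set plane R -> \bar R})
    (mu_inftyP : is_mu_infty lambda0 g mu_infty) :
  exists xi : R -> {finite_measure set plane R -> \bar R},
    (forall t : R, 0 <= t -> forall A : set (plane R), measurable A ->
       xi t A = (mu t A - nu t A)%E) /\
    [/\ vague_cvg +oo xi mzero,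
        vague_cvg +oo mu mu_infty,
        vague_cvg +oo nu mu_infty,
        (ystar lambda0 g < +oo)%E -> weak_cvg +oo xi mzero
      & (ystar lambda0 g < +oo)%E ->
        (\int[lebesgue_measure]_(u in `[0%R, +oo[)
           (Sg g (cap_ystar lambda0 g u, u))%:E < +oo)%E ->
        [/\ (mu_infty setT < +oo)%E,
            weak_cvg +oo mu mu_infty
          & weak_cvg +oo nu mu_infty]].
Proof.
have mQ := @measurable_quadrant R; have mO := @measurable_old_set R.
have old_fin (m : {finite_measure set plane R -> \bar R}) t : (m (old_set t) < +oo)%E.
  by rewrite ltey_eq fin_num_measure.
(* Taking the old part of [mu] as the witness makes it a measure by construction; the difference
   formula is verified afterwards. *)
pose xi t : {finite_measure set plane R -> \bar R} := mfrestr (mO t) (old_fin (mu t) t).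
have xiE t A : xi t A = mu t (A `&` old_set t) by [].
have nu_old t : 0 <= t -> nu t (old_set t) = 0%E.
  rewrite le_eqVlt => /predU1P[<-|t0]; first exact: nu0.
  have := old_mass_le g_density Sg_C1 nu_sol t0.
  have -> : \int[nu 0]_(z in quadrant) (Sg g (z.1, z.2 + t) / Sg g z) = 0.
    rewrite (@eq_Rintegral_null _ _ _ (nu 0) quadrant setT _ (fun=> 0)); first 1 last.
    - exact: measurableT.
    - exact: nu0.
    - by move=> z _ [].
    by rewrite Rintegral_cst ?mul0r.
  move=> nt; rewrite -[LHS]fineK ?fin_num_measure//; congr EFin; apply/eqP.
  by rewrite eq_le nt fine_ge0.
have vague m : fluid_solution lambda0 g m -> vague_cvg +oo m mu_infty.
  move=> msol f fC; have [N fN] := Cc_bounded_age fC.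
  (* The ages seen by f are below N, so the pairing is constant once t >= N. *)
  apply: cvg_near_cst; near=> t.
  have Nt : N <= t by near: t; apply: nbhs_pinfty_ge; exact: num_real.
  have t0 : 0 <= t by near: t; apply: nbhs_pinfty_ge; exact: num_real.
  apply: (solution_pairing_eventually lambda0_gt0 g_density Sg_C1 mu_inftyP msol t0).
  by move=> z zq tz; apply: fN => //; exact: le_trans tz.
have xi_out t (f : R * R -> R) : (forall z, old_set t z -> f z = 0) -> pairing f (xi t) = 0.
  move=> f0; rewrite /pairing (@eq_Rintegral_null _ _ _ (xi t) quadrant (~` old_set t) _ (fun=> 0)); first 1 last.
  - exact: measurableC.
  - by have := xiE t (~` old_set t); rewrite setICl measure0.
  - by move=> z _ /contrapT; exact: f0.
  by rewrite Rintegral_cst ?mul0r.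
have pairing0 (f : R * R -> R) : pairing f (@mzero _ (plane R) R) = 0.
  by rewrite /pairing /Rintegral integral_measure_zero.
have vague_xi : vague_cvg +oo xi mzero.
  move=> f fC; have [N fN] := Cc_bounded_age fC; rewrite pairing0.
  apply: cvg_near_cst; near=> t; apply: xi_out => z [zq /= tz]; apply: fN => //.
  by apply: le_trans tz; near: t; apply: nbhs_pinfty_ge; exact: num_real.
have weak_xi : weak_cvg +oo xi mzero.
  move=> f /Cb_measurable[mf [K fK]]; rewrite pairing0.
  have c0 : K * fine (mu t (old_set t)) @[t --> +oo] --> K * 0.
    by apply: cvgM; [exact: cvg_cst|apply: (cvg_old_mass g_density Sg_C1 mu_sol)].
  rewrite mulr0 in c0; move/cvgr0Pnorm_le: c0 => c0; apply/cvgr0Pnorm_le => e e0; near=> t.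
  apply: (@le_trans _ _ (K * fine (mu t (old_set t)))); last first.
    apply: le_trans (ler_norm _) _; near: t; exact: c0.
  have -> : mu t (old_set t) = xi t quadrant by rewrite xiE setIidr// => z [].
  by apply: Rintegral_bound => //; rewrite ltey_eq fin_num_measure.
exists xi; split; [|split=> //].
- move=> t t0 A mA; rewrite xiE.
  rewrite (solution_split lambda0_gt0 g_density Sg_C1 mu_inftyP mu_sol t0 mA).
  rewrite (solution_split lambda0_gt0 g_density Sg_C1 mu_inftyP nu_sol t0 mA).
  have -> : nu t (A `&` old_set t) = 0%E.
    apply/eqP; rewrite -measure_le0 -(nu_old t t0); apply: le_measure; rewrite ?inE//.
    exact: measurableI.
  rewrite adde0 addeAC subee ?add0e//.
  (* Cancelling the common young part requires it to be finite; rewritten as a mass of [mu t], it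
     is. *)
  rewrite -(solution_strip lambda0_gt0 g_density Sg_C1 mu_inftyP mu_sol t0 mA).
  by rewrite fin_num_measure//; apply: measurableI => //; exact: measurable_strip.
- exact: vague.
- exact: vague.
- move=> _ S_fin.
  have weak m : fluid_solution lambda0 g m -> weak_cvg +oo m mu_infty.
    move=> msol f /Cb_measurable[mf [K fK]].
    have oldi t := limit_old_fin lambda0_gt0 g_density Sg_C1 mu_inftyP S_fin t.
    have c0 : K * fine (m t (old_set t)) + K * fine (mu_infty (old_set t)) @[t --> +oo] -->
        K * 0 + K * 0.
      apply: cvgD; apply: cvgM; try exact: cvg_cst.
        apply: (cvg_old_mass g_density Sg_C1 msol).
      apply: (cvg_limit_old lambda0_gt0 g_density Sg_C1 mu_inftyP S_fin).
    rewrite mulr0 addr0 in c0; move/cvgr0Pnorm_le: c0 => c0; apply/cvgrPdist_le => e e0; near=> t.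
    have t0 : 0 <= t by near: t; apply: nbhs_pinfty_ge; exact: num_real.
    rewrite (solution_pairing_split lambda0_gt0 g_density Sg_C1 mu_inftyP msol t0 mf fK).
    have Qi := limit_quadrant_fin lambda0_gt0 g_density Sg_C1 mu_inftyP S_fin.
    rewrite (pairing_split t Qi mf fK).
    (* The young parts of both pairings are the same integral, so only the two tails remain. *)
    rewrite opprD addrACA subrr add0r.
    apply: le_trans (ler_normB _ _) _.
    apply: (@le_trans _ _ (K * fine (m t (old_set t)) + K * fine (mu_infty (old_set t)))).
      rewrite addrC; apply: lerD; apply: Rintegral_bound => //; try by move=> z [].
      by rewrite ltey_eq fin_num_measure.
    apply: le_trans (ler_norm _) _; near: t; exact: c0.
  split; [exact: (limit_fin lambda0_gt0 g_density Sg_C1 mu_inftyP S_fin)|exact: weak|exact: weak].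
Unshelve. all: by end_near. Qed.
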